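(* Let $n \in \mathbb{N}$ and let $\theta$ be a quite irrational real skew-symmetric $n \times n$-matrix. Then a covering $(\mathcal{A}, G, \alpha)$ of the quantum $n$-torus $\mathbb{A}^n_\theta$ is connected if and only if it is equivalent to $(\mathbb{A}^n_{\theta'}, (M^{-1} \cdot \mathbb{Z}^n)/\mathbb{Z}^n, \gamma')$ for some invertible $n \times n$-matrix $M$ with integer valued entries, some real skew-symmetric $n \times n$-matrix $\theta'$ satisfying $$M \theta' M^T \in \theta + M_n(\mathbb{Z}),$$ and the gauge action $\gamma'$ on $\mathbb{A}^n_{\theta'}$ (restricted to the finite subgroup $(M^{-1} \cdot \mathbb{Z}^n)/\mathbb{Z}^n$ of $\mathbb{R}^n/\mathbb{Z}^n$).
   Context: C*-dynamical systems. A C*-dynamical system $(\mathcal{A}, G, \alpha)$ consists of a unital C*-algebra $\mathcal{A}$, a topological group $G$ and an action of $G$ by *-automorphisms $\alpha_g$ of $\mathcal{A}$ such that $G \times \mathcal{A} \to \mathcal{A}$, $(g,a) \mapsto \alpha_g(a)$, is continuous. Its fixed point algebra is $\mathcal{A}^G = \{a : \alpha_g(a) = a \ \forall g \in G\}$; the system is ergodic if $\mathcal{A}^G = \mathbb{C}\mathbf{1}$. Two systems $(\mathcal{A}, G, \alpha)$ and $(\mathcal{A}', G', \alpha')$ are equivalent if there are a *-isomorphism $\Phi: \mathcal{A} \to \mathcal{A}'$ and a group isomorphism $\phi: G \to G'$ with $\Phi \circ \alpha_g = \alpha'_{\phi(g)} \circ \Phi$ for all $g \in G$. For compact $G$, the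 system is free if the map $\mathcal{A} \otimes_{\mathrm{alg}} \mathcal{A} \to C(G, \mathcal{A})$, $x \otimes y \mapsto (g \mapsto x\alpha_g(y))$, has dense range in the C*-norm (supremum norm). Covering. A covering of a unital C*-algebra $\mathcal{B}$ is a free C*-dynamical system $(\mathcal{A}, G, \alpha)$ with a finite group $G$ and fixed point algebra $\mathcal{B}$. Quantum tori. For a real skew-symmetric $n \times n$-matrix $\theta$, $\mathbb{A}^n_\theta$ is the universal C*-algebra generated by unitaries $u_1, \dots, u_n$ subject to $u_k u_\ell = \exp(2\pi i \theta_{k\ell}) u_\ell u_k$ for all $1 \le k, \ell \le n$. The gauge action of $\mathbb{R}^n$ on $\mathbb{A}^n_\theta$ is $\gamma_s(u_k) := \exp(2\pi i s_k) u_k$ for $s \in \mathbb{R}^n$; it factors through $\mathbb{R}^n/\mathbb{Z}^n$. The matrix $\theta$ is quite irrational if for all $\lambda \in \mathbb{Z}^n$ the condition $\exp(2\pi i \langle \lambda, \theta\mu\rangle) = 1$ for all $\mu \in \mathbb{Z}^n$ implies $\lambda = 0$. Lifts and connectedness. Let $\mathcal{A}$ be a C*-algebra containing $\mathbb{A}^n_\theta$. A C*-dynamical system $(\mathcal{A}, \mathbb{R}^n, \beta)$ is a lift of the gauge action if $\Gamma := \ker\beta = \{s \in \mathbb{R}^n : \beta_s = \mathrm{id}\}$ is of maximal rank, i.e. $\mathbb{R}^n/\Gamma$ is compact, and $\beta_s(x) = \gamma_s(x)$ for all $s \in \mathbb{R}^n$ and $x \in \mathbb{A}^n_\theta$. A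 covering $(\mathcal{A}, G, \alpha)$ of $\mathbb{A}^n_\theta$ is connected if there is an ergodic lift $(\mathcal{A}, \mathbb{R}^n, \beta)$ of the gauge action such that $\alpha_g \circ \beta_s = \beta_s \circ \alpha_g$ for all $g \in G$ and $s \in \mathbb{R}^n$.
   Formalization: The identification of the quantum torus with the fixed point algebra is not fixed in advance: a covering is connected if an ergodic commuting lift exists for some such identification. For a fixed inclusion the ''if'' part fails, since equivalence of systems ignores the inclusion. *)

(* Defs.v *)
From HB Require Import structures.
From mathcomp Require Import fingroup.
From mathcomp Require Import all_boot all_order all_algebra.
From mathcomp Require Import complex.
From mathcomp Require Import all_classical all_reals all_analysis.
From mathcomp Require Import ring.

Set Implicit Arguments.
Unset Strict Implicit.
Unset Printing Implicit Defensive.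

Import Order.TTheory GRing.Theory Num.Theory.
Import numFieldNormedType.Exports.

Local Open Scope classical_set_scope.
Local Open Scope ring_scope.

Declare Scope cstar_scope.
Delimit Scope cstar_scope with cstar.
Local Open Scope cstar_scope.

(* Unital C*-algebras, nonzero like all rings of the library.  The product is
   part of the mixin because Hierarchy Builder rejects a join of algType and
   normedModType (their common ancestors already meet in numDomainType).
   The norm takes its (real, nonnegative) values in R[i]. *)
HB.mixin Record NormedModule_isCStarAlgebra (R : realType) A
    & CompleteNormedModule R[i] A := {
  cmul : A -> A -> A;
  cone : A;
  star : A -> A;
  cmulA : associative cmul;
  cmul1x : left_id cone cmul;
  cmulx1 : right_id cone cmul;
  cmulDl : left_distributive cmul +%R;
  cmulDr : right_distributive cmul +%R;
  cscaleAl : forall (c : R[i]) x y, c *: cmul x y = cmul (c *: x) y;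
  cscaleAr : forall (c : R[i]) x y, c *: cmul x y = cmul x (c *: y);
  cone_neq0 : cone != 0;
  starK : involutive star;
  starD : {morph star : x y / x + y};
  starZ : forall (c : R[i]) x, star (c *: x) = conjc c *: star x;
  starM : forall x y, star (cmul x y) = cmul (star y) (star x);
  cnormM : forall x y : A, `|cmul x y| <= `|x| * `|y|;
  cnorm_star : forall x : A, `|cmul (star x) x| = `|x| ^+ 2
}.

#[short(type="cstarAlgType")]
HB.structure Definition CStarAlgebra (R : realType) :=
  {A of NormedModule_isCStarAlgebra R A & CompleteNormedModule R[i] A}.

Notation "x ** y" := (cmul x y)
  (at level 40, left associativity) : cstar_scope.

Record star_morphism (R : realType) (A B : cstarAlgType R) (f : A -> B)
  : Prop := StarMorphism {
  star_morphism_linear : linear f;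
  star_morphism1 : f cone = cone;
  star_morphismM : forall x y, f (x ** y) = f x ** f y;
  star_morphism_star : forall x, f (star x) = star (f x)
}.

Definition star_isomorphism (R : realType) (A B : cstarAlgType R)
    (f : A -> B) : Prop :=
  star_morphism f /\ bijective f.

HB.mixin Record isTopologicalGroup G & Topological G & monoid.Group G := {
  mulg_continuous : continuous (fun p : G * G => (p.1 * p.2)%g);
  invg_continuous : continuous (fun x : G => (x^-1)%g)
}.

#[short(type="topGroupType")]
HB.structure Definition TopologicalGroup :=
  {G of Topological G & monoid.Group G & isTopologicalGroup G}.

HB.instance Definition _ (G : groupType) := monoid.Group.copy (discrete_topology G) G.

Fact discrete_mulg_continuous (G : groupType) :
  continuous (fun p : discrete_topology G * discrete_topology G =>
    (p.1 * p.2)%g).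
Proof.
move=> [x y] U /principal_filterP Uxy.
exists ([set x], [set y]); first by split; exact/principal_filterP.
by move=> [a b] /= [-> ->].
Qed.

Fact discrete_invg_continuous (G : groupType) :
  continuous (fun x : discrete_topology G => (x^-1)%g).
Proof. by move=> x U /principal_filterP Ux; exact/principal_filterP. Qed.

HB.instance Definition _ (G : groupType) :=
  isTopologicalGroup.Build (discrete_topology G)
    (@discrete_mulg_continuous G) (@discrete_invg_continuous G).

(* R^n is additive in the library, topGroupType is multiplicative. *)
Notation Rn R n := (GRing.to_multiplicative 'cV[R]_n).

HB.instance Definition _ (R : realType) (n : nat) :=
  Topological.copy (Rn R n) 'cV[R]_n.

Fact Rn_mulg_continuous (R : realType) (n : nat) :
  continuous (fun p : Rn R n * Rn R n => (p.1 * p.2)%g).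
Proof.
move=> [x y] U [P Pxy PU].
have cD i j : nbhs ((x : 'cV[R]_n) i j, (y : 'cV[R]_n) i j)
    ((fun p : R * R => p.1 + p.2) @^-1` P i j).
  by apply: add_continuous; have := Pxy i j; rewrite mxE.
pose Q i j := xget ([set: R], [set: R]) [set Q |
  [/\ nbhs ((x : 'cV[R]_n) i j) Q.1, nbhs ((y : 'cV[R]_n) i j) Q.2 &
      Q.1 `*` Q.2 `<=` (fun p : R * R => p.1 + p.2) @^-1` P i j]].
have QP i j : [/\ nbhs ((x : 'cV[R]_n) i j) (Q i j).1,
    nbhs ((y : 'cV[R]_n) i j) (Q i j).2 &
    (Q i j).1 `*` (Q i j).2 `<=` (fun p : R * R => p.1 + p.2) @^-1` P i j].
  rewrite /Q; case: xgetP => [? _ //|noQ]; exfalso.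
  by have [B [B1 B2] BP] := cD i j; apply: (noQ B).
exists ([set M : 'cV[R]_n | forall i j, (Q i j).1 (M i j)],
        [set M : 'cV[R]_n | forall i j, (Q i j).2 (M i j)]).
  split; [exists (fun i j => (Q i j).1) => // i j|
          exists (fun i j => (Q i j).2) => // i j];
  by have [] := QP i j.
move=> [a b] [/= Qa Qb]; apply: PU => i j; rewrite mxE.
by have [_ _ /(_ (a i j, b i j))] := QP i j; apply; split.
Qed.

Fact Rn_invg_continuous (R : realType) (n : nat) :
  continuous (fun x : Rn R n => (x^-1)%g).
Proof.
move=> x U [P Px PU].
exists (fun i j => -%R @^-1` P i j) => [i j|y Py].
  by apply: (@opp_continuous R^o); have := Px i j; rewrite mxE.
by apply: PU => i j; rewrite mxE; exact: Py.
Qed.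

HB.instance Definition _ (R : realType) (n : nat) :=
  isTopologicalGroup.Build (Rn R n)
    (@Rn_mulg_continuous R n) (@Rn_invg_continuous R n).

Record dynsys (R : realType) (A : cstarAlgType R) (G : topGroupType) :=
  DynSys {
  dyn_act :> G -> A -> A;
  dyn_automorphism : forall g, star_isomorphism (dyn_act g);
  dyn_act1 : forall a, dyn_act 1%g a = a;
  dyn_actM : forall g h a, dyn_act (g * h)%g a = dyn_act g (dyn_act h a);
  dyn_continuous : continuous (fun p : G * A => dyn_act p.1 p.2)
}.

Definition fixed_points (R : realType) (A : cstarAlgType R) (G : topGroupType)
    (alpha : dynsys A G) : set A :=
  [set a | forall g, alpha g a = a].

Definition ergodic (R : realType) (A : cstarAlgType R) (G : topGroupType)
    (alpha : dynsys A G) : Prop :=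
  fixed_points alpha = range (fun c : R[i] => c *: (cone : A)).

(* For compact G: the elements x (x) y span a subspace with dense image in
   C(G, A) for the supremum norm.  The sequence s stands for the tensor
   \sum_(p <- s) p.1 (x) p.2. *)
Definition free_dynsys (R : realType) (A : cstarAlgType R) (G : topGroupType)
    (alpha : dynsys A G) : Prop :=
  forall f : G -> A, continuous f -> forall eps : R, 0 < eps ->
  exists s : seq (A * A), forall g : G,
    `|f g - \sum_(p <- s) p.1 ** alpha g p.2| < (eps%:C)%C.

Definition equivalent (R : realType) (A A' : cstarAlgType R) (G G' : groupType)
    (alpha : G -> A -> A) (alpha' : G' -> A' -> A') : Prop :=
  exists (Phi : A -> A') (phi : G -> G'),
    [/\ star_isomorphism Phi,
        bijective phi,
        {morph phi : g h / (g * h)%g >-> (g * h)%g} &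
        forall g a, Phi (alpha g a) = alpha' (phi g) (Phi a)].

Definition fixed_point_embedding (R : realType) (B A : cstarAlgType R)
    (G : topGroupType) (alpha : dynsys A G) (iota : B -> A) : Prop :=
  [/\ star_morphism iota, injective iota & range iota = fixed_points alpha].

(* A finite group carries the discrete topology (topological groups being
   Hausdorff), and "with fixed point algebra B" is up to isomorphism. *)
Definition covering (R : realType) (B A : cstarAlgType R) (G : finGroupType)
    (alpha : dynsys A (discrete_topology G)) : Prop :=
  free_dynsys alpha /\ exists iota : B -> A, fixed_point_embedding alpha iota.

Definition e2pi (R : realType) (x : R) : R[i] :=
  (cos (2 * pi * x) +i* sin (2 * pi * x))%C.

Definition unitary (R : realType) (A : cstarAlgType R) (u : A) : Prop :=
  star u ** u = cone /\ u ** star u = cone.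

Definition qtorus_rel (R : realType) (n : nat) (theta : 'M[R]_n)
    (A : cstarAlgType R) (u : 'I_n -> A) : Prop :=
  (forall k, unitary (u k)) /\
  forall k l, u k ** u l = e2pi (theta k l) *: (u l ** u k).

(* The models of the universal C*-algebra of the relations; any two of them are
   isomorphic by a unique isomorphism that respects the generators. *)
Record quantum_torus (R : realType) (n : nat) (theta : 'M[R]_n) :=
  QuantumTorus {
  qtorus_alg :> cstarAlgType R;
  qtorus_gen : 'I_n -> qtorus_alg;
  qtorus_genP : qtorus_rel theta qtorus_gen;
  qtorus_universal : forall (B : cstarAlgType R) (v : 'I_n -> B),
    qtorus_rel theta v ->
    exists! f : qtorus_alg -> B,
      star_morphism f /\ forall k, f (qtorus_gen k) = v k
}.

Definition quite_irrational (R : realType) (n : nat) (theta : 'M[R]_n) : Prop :=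
  forall lambda : 'cV[int]_n,
  (forall mu : 'cV[int]_n,
     e2pi (((map_mx intr lambda)^T *m (theta *m map_mx intr mu)) 0 0) = 1) ->
  lambda = 0.

Fact conjc_e2pi (R : realType) (x : R) : conjc (e2pi x) * e2pi x = 1.
Proof.
apply/eqP; rewrite eq_complex /= mulNr opprK -!expr2 cos2Dsin2 eqxx /=.
by rewrite mulNr mulrC subrr.
Qed.

Section Gauge.
Variables (R : realType) (n : nat) (theta : 'M[R]_n) (T : quantum_torus theta).

Fact gauge_gen_rel (s : 'cV[R]_n) :
  qtorus_rel theta (fun k => e2pi (s k 0) *: qtorus_gen T k).
Proof.
have [uU uC] := qtorus_genP T; split=> [k|k l].
  have [u1 u2] := uU k; split.
    by rewrite starZ -cscaleAl -cscaleAr scalerA conjc_e2pi scale1r.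
  by rewrite starZ -cscaleAl -cscaleAr scalerA mulrC conjc_e2pi scale1r.
rewrite -!cscaleAl -!cscaleAr uC !scalerA; congr (_ *: _).
by ring.
Qed.

Definition gauge (s : 'cV[R]_n) : T -> T :=
  sval (cid (qtorus_universal T (gauge_gen_rel s))).

Fact gaugeP (s : 'cV[R]_n) : star_morphism (gauge s) /\
  forall k, gauge s (qtorus_gen T k) = e2pi (s k 0) *: qtorus_gen T k.
Proof. by rewrite /gauge; case: cid => f []. Qed.

Fact gauge_unique (s : 'cV[R]_n) (f : T -> T) : star_morphism f ->
  (forall k, f (qtorus_gen T k) = e2pi (s k 0) *: qtorus_gen T k) ->
  f = gauge s.
Proof.
move=> fM fE; rewrite /gauge; case: cid => g [gP gU] /=.
by rewrite (gU f).
Qed.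

End Gauge.
Arguments gauge {R n theta} T s _.

Definition Zn_pred (R : realType) (n : nat) : {pred 'cV[R]_n} :=
  fun s => s \is a mxOver Num.int.

Fact Zn_zmod_closed (R : realType) (n : nat) : zmod_closed (@Zn_pred R n).
Proof.
split=> [|x y /mxOverP xZ /mxOverP yZ]; apply/mxOverP => i j; rewrite !mxE.
  exact: rpred0.
exact: rpredB.
Qed.

HB.instance Definition _ (R : realType) (n : nat) :=
  GRing.isZmodClosed.Build 'cV[R]_n (@Zn_pred R n) (@Zn_zmod_closed R n).

Notation torus R n := (Quotient.quot (@Zn_pred R n : zmodClosed 'cV[R]_n)).

Definition gauge_torus (R : realType) (n : nat) (theta : 'M[R]_n)
    (T : quantum_torus theta) (x : torus R n) : T -> T :=
  gauge T (repr x).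
Arguments gauge_torus {R n theta} T x _.

Fact e2piDint (R : realType) (x m : R) : m \is a Num.int ->
  e2pi (x + m) = e2pi x.
Proof.
have one_case (y : R) : e2pi (y + 1) = e2pi y.
  rewrite /e2pi; have -> : 2 * pi * (y + 1) = 2 * pi * y + pi *+ 2.
    by rewrite [LHS]mulrDr mulr1 -[pi *+ 2]mulr_natl.
  by rewrite cosD2pi sinD2pi.
have nat_case (y : R) (k : nat) : e2pi (y + k%:R) = e2pi y.
  by elim: k => [|k IHk]; rewrite ?addr0 // -natr1 addrA one_case.
move=> /intrP[[k|k] ->]; first exact: nat_case.
by rewrite NegzE rmorphN /= -[in RHS](subrK k.+1%:R x) nat_case.
Qed.

Fact gauge_torus_pi (R : realType) (n : nat) (theta : 'M[R]_n)
    (T : quantum_torus theta) (s : 'cV[R]_n) :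
  gauge_torus T (\pi_(torus R n) s)%qT = gauge T s.
Proof.
have sP : repr (\pi_(torus R n) s)%qT - s \is a mxOver Num.int.
  suff: repr (\pi_(torus R n) s)%qT - s \in @Zn_pred R n by [].
  by rewrite Quotient.idealrBE reprK.
have [fM fE] := gaugeP T (repr (\pi_(torus R n) s)%qT).
apply: gauge_unique => // k; rewrite /gauge_torus fE; congr (_ *: _).
rewrite -[in RHS](e2piDint _ (mxOverP sP k 0)) !mxE.
by congr e2pi; rewrite [RHS]addrC subrK.
Qed.

Definition lattice_pred (R : realType) (n : nat) (M : 'M[int]_n)
    : {pred torus R n} :=
  fun x => `[< exists k : 'cV[int]_n,
    x = (\pi_(torus R n) (invmx (map_mx intr M) *m map_mx intr k))%qT >].

Fact lattice_zmod_closed (R : realType) (n : nat) (M : 'M[int]_n) :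
  zmod_closed (@lattice_pred R n M).
Proof.
split=> [|x y /asboolP[k ->] /asboolP[l ->]]; apply/asboolP.
  by exists 0; rewrite map_mx0 mulmx0 raddf0.
by exists (k - l); rewrite map_mxB mulmxBr raddfB.
Qed.

HB.instance Definition _ (R : realType) (n : nat) (M : 'M[int]_n) :=
  GRing.isZmodClosed.Build (torus R n) (@lattice_pred R n M)
    (@lattice_zmod_closed R n M).

(* (M^-1 Z^n) / Z^n, as the image of M^-1 Z^n in torus R n = R^n / Z^n; it is
   meant for M invertible over R. *)
Definition lattice_quotient (R : realType) (n : nat) (M : 'M[int]_n) : Type :=
  {x : torus R n | lattice_pred M x}.

HB.instance Definition _ (R : realType) (n : nat) (M : 'M[int]_n) :=
  SubChoice.on (lattice_quotient R M).
HB.instance Definition _ (R : realType) (n : nat) (M : 'M[int]_n) :=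
  [SubChoice_isSubZmodule of lattice_quotient R M by <:].

Definition gauge_lattice (R : realType) (n : nat) (theta : 'M[R]_n)
    (T : quantum_torus theta) (M : 'M[int]_n)
    (x : GRing.to_multiplicative (lattice_quotient R M)) : T -> T :=
  gauge_torus T (val (x : lattice_quotient R M)).
Arguments gauge_lattice {R n theta} T M x _.

Definition dyn_ker (R : realType) (n : nat) (A : cstarAlgType R)
    (beta : dynsys A (Rn R n)) : {pred 'cV[R]_n} :=
  fun s => `[< forall a, beta s a = a >].

Fact dyn_ker_zmod_closed (R : realType) (n : nat) (A : cstarAlgType R)
  (beta : dynsys A (Rn R n)) : zmod_closed (dyn_ker beta).
Proof.
have betaD (s t : 'cV[R]_n) a : beta (s + t) a = beta s (beta t a).
  exact: (dyn_actM beta).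
split=> [|s t /asboolP sK /asboolP tK]; apply/asboolP => a.
  exact: (dyn_act1 beta).
by have := betaD (s - t) t a; rewrite subrK sK tK => /esym.
Qed.

HB.instance Definition _ (R : realType) (n : nat) (A : cstarAlgType R)
    (beta : dynsys A (Rn R n)) :=
  GRing.isZmodClosed.Build 'cV[R]_n (dyn_ker beta) (dyn_ker_zmod_closed beta).

Definition gauge_lift (R : realType) (n : nat) (theta : 'M[R]_n)
    (T : quantum_torus theta) (A : cstarAlgType R) (iota : T -> A)
    (beta : dynsys A (Rn R n)) : Prop :=
  compact [set: quotient_topology (Quotient.quot (dyn_ker beta : zmodClosed 'cV[R]_n))] /\
  forall (s : 'cV[R]_n) (x : T), beta s (iota x) = iota (gauge T s x).

(* A covering is a triple (A, G, alpha) and does not come with an identification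
   of the fixed point algebra with the quantum torus, hence the first
   existential quantifier.  For one fixed identification, connectedness would
   not be invariant under equivalence: composing the identification with an
   automorphism of the quantum torus can destroy it. *)
Definition connected_covering (R : realType) (n : nat) (theta : 'M[R]_n)
    (T : quantum_torus theta) (A : cstarAlgType R) (G : finGroupType)
    (alpha : dynsys A (discrete_topology G)) : Prop :=
  exists iota : T -> A, fixed_point_embedding alpha iota /\
  exists beta : dynsys A (Rn R n),
    [/\ gauge_lift iota beta,
        ergodic beta &
        forall (g : G) (s : 'cV[R]_n) (a : A),
          alpha g (beta s a) = beta s (alpha g a)].

(* Main.v *)
From HB Require Import structures.
Require Import Defs.
From mathcomp Require Import fingroup cyclic.
From mathcomp Require Import all_boot all_order all_algebra.
From mathcomp Require Import complex finmap.
From mathcomp Require Import all_classical all_reals all_analysis.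
From mathcomp Require Import ring lra zify.

(* If the covering is connected, ergodicity makes each spectral subspace
   A_chi of the lift beta at most one-dimensional and spanned by a unitary, and
   by Fejer's theorem these subspaces span a dense part of A.  The set S of the
   chi with A_chi <> 0 is a group with Z^n <= S <= |G|^-1 Z^n, hence
   S = M^-T Z^n for an integer matrix M.  Unitaries for a basis of S satisfy the
   relations of a theta' with M theta' M^T in theta + M_n(Z), and G acts on them
   by scalars, that is through the gauge action; freeness and duality of
   lattices identify G with (M^-1 Z^n) / Z^n.

   Conversely the monomials with exponents the rows of M generate a copy of the
   theta-torus in the theta'-torus, and s acts by gauge'_{M^-1 s}.

   In both directions one must compare norms of polynomials in unitaries that
   satisfy the same relations.  The coefficients of a polynomial p(u) are bounded
   by its norm as soon as the gauge action exists on u, so that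
   |p(v)| <= (2d+1)^n |p(u)| in degree d; applied to the powers of p^* p this
   polynomial factor disappears and |p(v)| <= |p(u)|.  Hence a C*-algebra
   densely spanned by such u is universal. *)

Set Implicit Arguments.
Unset Strict Implicit.
Unset Printing Implicit Defensive.

Import Order.TTheory GRing.Theory Num.Theory.
Import numFieldNormedType.Exports.

Local Open Scope classical_set_scope.
Local Open Scope ring_scope.
Local Open Scope cstar_scope.

(** * Real-valued norms on complex normed modules *)

(** The quantum torus is given only by its universal property, so nothing is known in advance about
    the norm of a polynomial in the generators, not even that the monomials are independent. Lower
    bounds for such norms are extracted from the gauge action: averaging over it isolates one
    coefficient, and averages are contractive because star morphisms are. Contractivity of star
    morphisms, and the sign of a scalar [star a ** a], are in turn derived from the C*-identity,
    through a square root built by iteration and through second order expansions, without any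
    spectral theory. Integrals over the circle are limits of Riemann sums, and finite grids suffice
    where the degree is bounded. Compactness of the quotient by the kernel of the lift is used to
    make the lift periodic in every coordinate direction, so that Fourier analysis on the circle can
    be applied to one coordinate after another. *)

Section RealNorm.
Variables (R : realType) (V : normedZmodType R[i]).
Implicit Types x y : V.

Definition nm x : R := complex.Re `|x|.

Lemma nmE x : `|x| = ((nm x)%:C)%C.
Proof. by rewrite /nm RRe_real // ger0_real. Qed.

Lemma nm_ge0 x : 0 <= nm x.
Proof. by rewrite -ler0c -nmE. Qed.

Lemma nmD x y : nm (x + y) <= nm x + nm y.
Proof. by rewrite -lecR rmorphD /= -!nmE ler_normD. Qed.

Lemma nmN x : nm (- x) = nm x.
Proof. by rewrite /nm normrN. Qed.

Lemma nmB x y : nm (x - y) <= nm x + nm y.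
Proof. by rewrite -(nmN y) nmD. Qed.

Lemma nm_distC x y : nm (x - y) = nm (y - x).
Proof. by rewrite /nm distrC. Qed.

Lemma nm0 : nm (0 : V) = 0.
Proof. by rewrite /nm normr0. Qed.

Lemma nm_eq0 x : nm x = 0 -> x = 0.
Proof. by move=> x0; apply/normr0_eq0; rewrite nmE x0. Qed.

Lemma nm_le0 x : nm x <= 0 -> x = 0.
Proof. by move=> x0; apply/nm_eq0/eqP; rewrite eq_le x0 nm_ge0. Qed.

Lemma nm_dist_trans z x y : nm (x - y) <= nm (x - z) + nm (z - y).
Proof. by rewrite -[x - y](subrKA z) nmD. Qed.

Lemma nm_sum (I : Type) (r : seq I) (P : pred I) (F : I -> V) :
  nm (\sum_(i <- r | P i) F i) <= \sum_(i <- r | P i) nm (F i).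
Proof.
elim/big_ind2: _ => [|x a y b xa yb|//]; first by rewrite nm0.
by apply: le_trans (nmD _ _) _; exact: lerD.
Qed.

Lemma nm_le_lim x (c : R) : (forall e : R, 0 < e -> nm x <= c + e) -> nm x <= c.
Proof. by move=> h; apply/ler_addgt0Pr => e /h. Qed.

Lemma nm_eq_lim x y (c : R) :
  (forall e : R, 0 < e -> nm (x - y) <= c * e) -> x = y.
Proof.
move=> h; apply/eqP; rewrite -subr_eq0; apply/eqP/nm_le0.
have c1 : 0 < `|c| + 1 by rewrite ltr_wpDl.
apply/ler_addgt0Pr => e e0; rewrite add0r.
apply: le_trans (h (e / (`|c| + 1)) _) _; first by rewrite divr_gt0.
rewrite mulrA ler_pdivrMr // mulrC ler_pM2l //.
by rewrite (le_trans (ler_norm _)) // lerDl.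
Qed.

End RealNorm.

Section Scalars.
Variable R : realType.

Lemma nmZ (V : normedModType R[i]) (c : R[i]) (x : V) : nm (c *: x) = nm c * nm x.
Proof. by apply: complexI; rewrite rmorphM /= -!nmE normrZ. Qed.

Lemma nmcM (c d : R[i]) : nm (c * d) = nm c * nm d.
Proof. by apply: complexI; rewrite rmorphM /= -!nmE normrM. Qed.

Lemma nm1c : nm (1 : R[i]) = 1.
Proof. by rewrite /nm normr1. Qed.

Lemma nm_real (r : R) : nm (r%:C)%C = `|r|.
Proof. by rewrite /nm normc_def /= expr0n addr0 sqrtr_sqr. Qed.

Lemma nm_half : nm (2^-1 : R[i]) = 2^-1.
Proof.
have -> : (2^-1 : R[i]) = ((2^-1 : R)%:C)%C by rewrite fmorphV rmorph_nat.
by rewrite nm_real ger0_norm // invr_ge0.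
Qed.

Lemma mul_ii : 'i%C * 'i%C = -1 :> R[i].
Proof. by rewrite -expr2 sqr_i. Qed.

Lemma conjc_i : conjc 'i%C = - 'i%C :> R[i].
Proof. by apply/eqP; rewrite eq_complex /= oppr0 !eqxx. Qed.

Lemma nm_i : nm ('i%C : R[i]) = 1.
Proof. by rewrite /nm normc_def /= expr0n expr1n add0r sqrtr1. Qed.

(** Error budget for [c *: x + y]: the first summand is approximated up to [e / 2 / (nm c + 1)],
    where the added 1 covers the case [c = 0]. *)
Lemma mul_half_div_succ_le (a e : R) : 0 <= a -> 0 < e -> a * (e / 2 / (a + 1)) <= e / 2.
Proof.
move=> a0 e0; rewrite mulrA ler_pdivrMr ?ltr_wpDl // mulrC ler_pM2l ?divr_gt0 //.
by rewrite lerDl.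
Qed.

Lemma invSn_eventually_lt (e : R) : 0 < e ->
  exists N : nat, forall m, (N <= m)%N -> m.+1%:R^-1 < e.
Proof.
move=> e0; exists (Num.truncn e^-1) => m Nm; rewrite invf_plt ?posrE ?ltr0n //.
by apply: lt_le_trans (truncnS_gt _) _; rewrite ler_nat ltnS.
Qed.

Lemma nm_cJ (c : R[i]) : nm (conjc c) = nm c.
Proof. by rewrite /nm !normc_def /=; case: c => a b /=; rewrite sqrrN. Qed.

End Scalars.

Lemma ltr0c (R : realType) (x : R) : (0 < (x%:C)%C) = (0 < x).
Proof. by rewrite -(ltcR 0 x). Qed.

Section NormTopology.
Variables (R : realType) (V : normedModType R[i]).

Lemma nm_cvgP (T : Type) (F : set_system T) (FF : Filter F) (f : T -> V) (l : V) :
  f @ F --> l <-> forall e : R, 0 < e -> \forall t \near F, nm (f t - l) < e.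
Proof.
split=> [/cvgrPdist_lt h e e0|h].
  have := h (e%:C)%C; rewrite ltr0c => /(_ e0); apply: filterS => t.
  by rewrite distrC nmE ltcR.
apply/cvgrPdist_lt => e e0.
have eE : e = ((complex.Re e)%:C)%C by rewrite RRe_real // gtr0_real.
have /h : 0 < complex.Re e by rewrite -ltr0c -eE.
rewrite eE; apply: filterS => t; by rewrite distrC nmE ltcR.
Qed.

Lemma nm_nbhsP (x : V) (P : set V) :
  nbhs x P <-> exists2 e : R, 0 < e & forall y, nm (y - x) < e -> P y.
Proof.
split=> [|[e e0 h]].
  move=> /nbhs_normP[e /= e0 h].
  have eE : e = ((complex.Re e)%:C)%C by rewrite RRe_real // gtr0_real.
  exists (complex.Re e) => [|y yx]; first by rewrite -ltr0c -eE.
  by apply: h; rewrite /= distrC eE nmE ltcR.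
apply/nbhs_normP; exists (e%:C)%C => [|y]; first by rewrite /= ltr0c.
by rewrite /= distrC nmE ltcR => /h.
Qed.

Lemma nm_closedP (D : set V) :
  (forall x, (forall e : R, 0 < e -> exists2 y, D y & nm (x - y) < e) -> D x) <->
  closed D.
Proof.
split=> [h x Dx|h x xD]; [apply: h => e e0|apply: h => P].
  have [y [Dy yx]] := Dx _ (proj2 (nm_nbhsP x [set y | nm (y - x) < e])
    (ex_intro2 _ _ e e0 (fun y h => h))).
  by exists y => //; rewrite nm_distC.
move=> /nm_nbhsP[e e0 eP]; have [y Dy yx] := xD e e0.
by exists y; split => //; apply: eP; rewrite nm_distC.
Qed.

End NormTopology.

Lemma nm_cauchy (R : realType) (V : completeNormedModType R[i]) (u : nat -> V) :
  (forall e : R, 0 < e -> exists N, forall m n, (N <= m)%N -> (N <= n)%N ->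
     nm (u m - u n) < e) ->
  exists l : V, forall e : R, 0 < e -> exists N, forall n, (N <= n)%N ->
    nm (u n - l) < e.
Proof.
move=> h.
have uC : cvg (u @ \oo).
  apply/cauchy_cvgP/cauchy_exP => e e0.
  have eE : e = ((complex.Re e)%:C)%C by rewrite RRe_real // gtr0_real.
  have [|N hN] := h (complex.Re e); first by rewrite -ltr0c -eE.
  exists (u N); exists N => // n /= Nn; rewrite -ball_normE /= eE nmE ltcR.
  exact: hN.
exists (lim (u @ \oo)) => e e0.
have /nm_cvgP /(_ e e0)[N _ hN] := uC.
by exists N => n Nn; exact: hN.
Qed.

(** * C*-algebras and their morphisms *)

Section CStarBasics.
Variables (R : realType) (A : cstarAlgType R).
Implicit Types (x y z u v h : A) (c : R[i]).

Lemma cmul0x x : 0 ** x = 0.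
Proof. by apply: (addrI (0 ** x)); rewrite -cmulDl !addr0. Qed.

Lemma cmulx0 x : x ** 0 = 0.
Proof. by apply: (addrI (x ** 0)); rewrite -cmulDr !addr0. Qed.

Lemma cmulNx x y : (- x) ** y = - (x ** y).
Proof. by apply: (addrI (x ** y)); rewrite -cmulDl !subrr cmul0x. Qed.

Lemma cmulxN x y : x ** (- y) = - (x ** y).
Proof. by apply: (addrI (x ** y)); rewrite -cmulDr !subrr cmulx0. Qed.

Lemma cmulBl x y z : (x - y) ** z = x ** z - y ** z.
Proof. by rewrite cmulDl cmulNx. Qed.

Lemma cmulBr x y z : z ** (x - y) = z ** x - z ** y.
Proof. by rewrite cmulDr cmulxN. Qed.

Lemma cmul_suml (I : Type) (r : seq I) (P : pred I) (F : I -> A) x :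
  (\sum_(i <- r | P i) F i) ** x = \sum_(i <- r | P i) (F i ** x).
Proof. by elim/big_rec2: _ => [|i a b _ <-]; rewrite ?cmul0x ?cmulDl. Qed.

Lemma cmul_sumr (I : Type) (r : seq I) (P : pred I) (F : I -> A) x :
  x ** (\sum_(i <- r | P i) F i) = \sum_(i <- r | P i) (x ** F i).
Proof. by elim/big_rec2: _ => [|i a b _ <-]; rewrite ?cmulx0 ?cmulDr. Qed.

Lemma star0 : star 0 = 0 :> A.
Proof. by have := starZ 0 (0 : A); rewrite !scale0r conjc0 scale0r. Qed.

Lemma starN x : star (- x) = - star x.
Proof. by apply: (addrI (star x)); rewrite -starD !subrr star0. Qed.

Lemma starB x y : star (x - y) = star x - star y.
Proof. by rewrite starD starN. Qed.

Lemma star_sum (I : Type) (r : seq I) (P : pred I) (F : I -> A) :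
  star (\sum_(i <- r | P i) F i) = \sum_(i <- r | P i) star (F i).
Proof. by elim/big_rec2: _ => [|i a b _ <-]; rewrite ?star0 ?starD. Qed.

Lemma star1 : star cone = cone :> A.
Proof. by rewrite -[RHS]starK -[in RHS](cmulx1 (star cone)) starM starK cmulx1. Qed.

Lemma nmM x y : nm (x ** y) <= nm x * nm y.
Proof. by rewrite -lecR rmorphM /= -!nmE cnormM. Qed.

Lemma nm_starM x : nm (star x ** x) = nm x ^+ 2.
Proof. by apply: complexI; rewrite rmorphXn /= -!nmE cnorm_star. Qed.

Lemma nm_star x : nm (star x) = nm x.
Proof.
have le y : nm y <= nm (star y).
  have [->|y0] := eqVneq (nm y) 0; first exact: nm_ge0.
  have y1 : 0 < nm y by rewrite lt_def y0 nm_ge0.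
  by rewrite -(ler_pM2r y1) -expr2 -nm_starM nmM.
by apply/eqP; rewrite eq_le le andbT (le_trans (le _)) ?starK.
Qed.

Lemma nm_cone : nm (cone : A) = 1.
Proof.
have e : nm (cone : A) = nm (cone : A) ^+ 2 by rewrite -nm_starM star1 cmul1x.
have n0 : nm (cone : A) != 0.
  by apply: contraTneq (@cone_neq0 _ A) => /nm_eq0 ->; rewrite eqxx.
by apply: (mulIf n0); rewrite mul1r -expr2 -e.
Qed.

Lemma nm_unitary u : unitary u -> nm u = 1.
Proof.
move=> [uu _]; have := nm_starM u; rewrite uu nm_cone => /esym/eqP.
by rewrite sqrf_eq1 => /orP[/eqP //|/eqP u1]; have := nm_ge0 u; rewrite u1; lra.
Qed.

Lemma unitary_neq0 u : unitary u -> u != 0.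
Proof. by move=> /nm_unitary u1; apply/eqP => u0; move: u1; rewrite u0 nm0; lra. Qed.

Lemma unitary1 : unitary (cone : A).
Proof. by split; rewrite star1 cmul1x. Qed.

Lemma unitaryM u v : unitary u -> unitary v -> unitary (u ** v).
Proof.
move=> [u1 u2] [v1 v2]; split; rewrite starM.
  by rewrite -cmulA (cmulA (star u)) u1 cmul1x.
by rewrite -cmulA (cmulA v) v2 cmul1x.
Qed.

Lemma unitary_star u : unitary u -> unitary (star u).
Proof. by move=> [u1 u2]; split; rewrite starK. Qed.

Fixpoint cpow x (n : nat) : A := if n is m.+1 then @cmul R A x (cpow x m) else @cone R A.

Lemma cpow_comm x y (n : nat) : x ** y = y ** x -> cpow x n ** y = y ** cpow x n.
Proof.
by move=> xy; elim: n => [|n IH] /=; rewrite ?cmulx1 ?cmul1x // -cmulA IH !cmulA xy.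
Qed.

Lemma cpowD x m n : cpow x (m + n) = cpow x m ** cpow x n.
Proof. by elim: m => [|m IH] /=; rewrite ?cmul1x // IH cmulA. Qed.

Lemma star_cpow x n : star (cpow x n) = cpow (star x) n.
Proof.
by elim: n => [|n IH] /=; rewrite ?star1 // starM IH (cpow_comm n (erefl _)).
Qed.

Lemma unitary_cpow u n : unitary u -> unitary (cpow u n).
Proof.
move=> uu; elim: n => [|n IH] /=; first exact: unitary1.
exact: unitaryM.
Qed.

Lemma nm_selfadj_sq h : star h = h -> nm (h ** h) = nm h ^+ 2.
Proof. by move=> hh; rewrite -nm_starM hh. Qed.

(** The C*-identity controls squares, hence the powers [2 ^ m]; this takes the place of the spectral
    radius formula. *)
Lemma nm_selfadj_pow h m : star h = h -> nm (cpow h (2 ^ m)) = nm h ^+ (2 ^ m).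
Proof.
move=> hh; elim: m => [|m IH]; first by rewrite expn0 /= cmulx1 expr1.
rewrite expnS mul2n -addnn cpowD nm_selfadj_sq; last by rewrite star_cpow hh.
by rewrite IH exprD expr2.
Qed.

End CStarBasics.

Section StarMorphism.
Variables (R : realType) (A B : cstarAlgType R) (f : A -> B).
Hypothesis fM : star_morphism f.

Lemma sm_D x y : f (x + y) = f x + f y.
Proof. by have := star_morphism_linear fM 1 x y; rewrite !scale1r. Qed.

Lemma sm_0 : f 0 = 0.
Proof. by apply: (addrI (f 0)); rewrite -sm_D !addr0. Qed.

Lemma sm_Z c x : f (c *: x) = c *: f x.
Proof. by have := star_morphism_linear fM c x 0; rewrite !addr0 sm_0 addr0. Qed.

Lemma sm_N x : f (- x) = - f x.
Proof. by rewrite -scaleN1r sm_Z scaleN1r. Qed.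

Lemma sm_B x y : f (x - y) = f x - f y.
Proof. by rewrite sm_D sm_N. Qed.

Lemma sm_sum (I : Type) (r : seq I) (P : pred I) (F : I -> A) :
  f (\sum_(i <- r | P i) F i) = \sum_(i <- r | P i) f (F i).
Proof. by elim/big_rec2: _ => [|i a b _ <-]; rewrite ?sm_0 ?sm_D. Qed.

Lemma sm_1 : f cone = cone.
Proof. exact: star_morphism1 fM. Qed.

Lemma sm_M x y : f (x ** y) = f x ** f y.
Proof. exact: star_morphismM fM _ _. Qed.

Lemma sm_star x : f (star x) = star (f x).
Proof. exact: star_morphism_star fM _. Qed.

Lemma sm_unitary u : unitary u -> unitary (f u).
Proof. by move=> [u1 u2]; split; rewrite -sm_star -sm_M ?u1 ?u2 sm_1. Qed.

End StarMorphism.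

Lemma sm_id (R : realType) (A : cstarAlgType R) : star_morphism (@id A).
Proof. by []. Qed.

Lemma sm_comp (R : realType) (A B C : cstarAlgType R) (f : A -> B) (g : B -> C) :
  star_morphism f -> star_morphism g -> star_morphism (g \o f).
Proof.
move=> fM gM; split=> [c x y||x y|x] /=.
- by rewrite (sm_D fM) (sm_Z fM) (sm_D gM) (sm_Z gM).
- by rewrite (sm_1 fM) (sm_1 gM).
- by rewrite (sm_M fM) (sm_M gM).
- by rewrite (sm_star fM) (sm_star gM).
Qed.

Lemma sm_can (R : realType) (A B : cstarAlgType R) (f : A -> B) (g : B -> A) :
  star_morphism f -> cancel f g -> cancel g f -> star_morphism g.
Proof.
move=> fM fK gK; split=> [c x y||x y|x]; apply: (can_inj fK).
- by rewrite (sm_D fM) (sm_Z fM) !gK.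
- by rewrite (sm_1 fM) !gK.
- by rewrite (sm_M fM) !gK.
- by rewrite (sm_star fM) !gK.
Qed.

(** * Square roots by iteration, and contractivity of star morphisms *)

Section Sqrt.
Variables (R : realType) (A : cstarAlgType R) (h : A).
Hypotheses (h_sa : star h = h) (h_le : nm h <= 2^-1).

Let half : R[i] := 2^-1.
(** A fixed point [w] satisfies [2 w = h^2 + w^2], that is [(1 - w)^2 = 1 - h^2]. For [nm h <= 1/2]
    the map preserves the ball of radius 1/2 and contracts distances there by 1/2, so the iterates
    from 0 converge. *)
Let F (w : A) : A := half *: (h ** h + w ** w).
Let w (n : nat) := iter n F 0.

Let nm_hh : nm (h ** h) <= 4^-1.
Proof.
apply: le_trans (nmM _ _) _.
have := ler_pM (nm_ge0 h) (nm_ge0 h) h_le h_le; lra.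
Qed.

Let nm_F x : nm x <= 2^-1 -> nm (F x) <= 2^-1.
Proof.
move=> x2; rewrite nmZ nm_half.
have h1 := nmD (h ** h) (x ** x); have h2 := nmM x x.
have h3 := ler_pM (nm_ge0 x) (nm_ge0 x) x2 x2; have h4 := nm_hh; lra.
Qed.

Let nm_w n : nm (w n) <= 2^-1.
Proof. by elim: n => [|n IH]; rewrite /w ?nm0 ?invr_ge0 //; exact: nm_F. Qed.

Let F_contr x y : nm x <= 2^-1 -> nm y <= 2^-1 -> nm (F x - F y) <= 2^-1 * nm (x - y).
Proof.
move=> x2 y2; rewrite /F -scalerBr nmZ nm_half ler_pM2l ?invr_gt0 // opprD addrACA subrr add0r.
have -> : x ** x - y ** y = x ** (x - y) + (x - y) ** y.
  by rewrite cmulBr cmulBl addrA subrK.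
apply: le_trans (nmD _ _) _.
have h1 := nmM x (x - y); have h2 := nmM (x - y) y; have h3 := nm_ge0 (x - y).
have h4 : nm x * nm (x - y) <= 2^-1 * nm (x - y) by rewrite ler_wpM2r.
have h5 : nm (x - y) * nm y <= nm (x - y) * 2^-1 by rewrite ler_wpM2l.
lra.
Qed.


Let w_dist n k : nm (w (n + k) - w n) <= 2^-1 ^+ n.
Proof.
elim: n => [|n IH]; first by rewrite expr0 subr0 (le_trans (nm_w _)) // invf_le1 // ler1n.
rewrite addSn exprS; apply: le_trans (F_contr (nm_w _) (nm_w _)) _.
by rewrite ler_pM2l // invr_gt0.
Qed.

Let w_star n : star (w n) = w n.
Proof.
elim: n => [|n IH]; first exact: star0.
by rewrite /w iterS -/(w n) starZ starD !starM h_sa IH /half conjc_inv conjc_nat.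
Qed.

Let w_comm n : w n ** h = h ** w n.
Proof.
elim: n => [|n IH]; first by rewrite cmul0x cmulx0.
rewrite /w iterS -/(w n) -cscaleAl -cscaleAr cmulDl cmulDr cmulA.
by congr (_ *: (_ + _)); rewrite -cmulA IH cmulA IH cmulA.
Qed.

(** The root is [cone - l] for the limit [l] of the iterates. They are self-adjoint and commute with
    [h], and both properties pass to the limit. *)
Lemma sqrt_one_sub_sq :
  exists y : A, [/\ star y = y, h ** y = y ** h & y ** y = cone - h ** h].
Proof.
have [e e0|l lP] := @nm_cauchy _ A w.
  have [N hN] : exists N, (2^-1 : R) ^+ N < e / 2.
    have := @cvg_geometric R 1 2^-1; rewrite ger0_norm ?invr_ge0 // invf_lt1 // ltr1n.
    move=> /(_ isT) /cvgrPdist_lt /(_ (e / 2)); rewrite divr_gt0 // => /(_ isT)[N _ hN].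
    exists N; have := hN N (leqnn N); rewrite /geometric /= mul1r sub0r normrN.
    by rewrite ger0_norm // exprn_ge0 // invr_ge0.
  exists N => m n Nm Nn; rewrite -(subnKC Nm) -(subnKC Nn).
  have h1 := w_dist N (m - N); have h2 := w_dist N (n - N).
  have := nm_dist_trans (w N) (w (N + (m - N))) (w (N + (n - N))).
  by rewrite (nm_distC (w N)); lra.
have l_le : nm l <= 2^-1.
  apply: nm_le_lim => e /lP[N /(_ N (leqnn N))]; rewrite nm_distC => h1.
  by have := nmD (l - w N) (w N); rewrite subrK; have := nm_w N; lra.
have lF : l = F l.
  apply: (@nm_eq_lim _ _ _ _ 2) => e e0; have [N hN] := lP e e0.
  have h1 := hN N.+1 (leqnSn _); have h2 := hN N (leqnn _).
  have h3 := F_contr (nm_w N) l_le.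
  have := nm_dist_trans (w N.+1) l (F l); rewrite (nm_distC l (w _)).
  have -> : w N.+1 = F (w N) by [].
  by move: h1; have -> : w N.+1 = F (w N) by []; lra.
have l_star : star l = l.
  apply: (@nm_eq_lim _ _ _ _ 2) => e e0; have [N /(_ N (leqnn _)) h1] := lP e e0.
  have := nm_dist_trans (w N) (star l) l.
  by rewrite -{1}(w_star N) -starB nm_star (nm_distC l (w _)); lra.
have l_comm : l ** h = h ** l.
  apply: (@nm_eq_lim _ _ _ _ 1) => e e0; have [N /(_ N (leqnn _)) h1] := lP e e0.
  have := nm_dist_trans (w N ** h) (l ** h) (h ** l).
  rewrite {2}w_comm -cmulBl -cmulBr.
  have := nmM (l - w N) h; have := nmM h (w N - l); rewrite (nm_distC l (w _)).
  have h3 := ler_wpM2l (nm_ge0 (w N - l)) h_le.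
  have h4 := ler_wpM2r (nm_ge0 (w N - l)) h_le.
  by lra.
have l2 : h ** h + l ** l = l + l.
  have half1 : half + half = 1 by rewrite [RHS](splitr 1) !mul1r.
  by rewrite {3 4}lF /F -scalerDl half1 scale1r.
exists (cone - l); split; first by rewrite starB star1 l_star.
  by rewrite cmulBr cmulBl cmulx1 cmul1x l_comm.
rewrite cmulBr cmulx1 cmulBl cmul1x opprB addrA addrAC.
have -> : l ** l = l + l - h ** h by rewrite -l2 addrC addKr.
by rewrite addrA -(addrA cone) -opprD subrK.
Qed.

End Sqrt.

Lemma exp_unbounded (R : realType) (r K : R) : 1 < r -> exists n : nat, K < r ^+ n.
Proof.
move=> r1; have [N KN] : exists N : nat, K < N%:R * (r - 1).
  have r0 : 0 < r - 1 by rewrite subr_gt0.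
  exists (Num.truncn `|K / (r - 1)|).+1.
  rewrite -ltr_pdivrMr // (le_lt_trans (ler_norm _)) // truncnS_gt //.
exists N; apply: lt_le_trans KN _.
(* Bernoulli's inequality. *)
suff : 1 + N%:R * (r - 1) <= r ^+ N by lra.
elim: N => [|N IH]; first by rewrite mul0r addr0 expr0.
have h1 : (1 + N%:R * (r - 1)) * r <= r ^+ N * r by rewrite ler_pM2r //; lra.
rewrite exprSr (le_trans _ h1) // -natr1.
have : 0 <= N%:R * (r - 1) * (r - 1).
  by rewrite !mulr_ge0 // subr_ge0 ltW.
by lra.
Qed.

(* Only the exponential rate survives the extraction of [2 ^ m]-th roots. *)
Lemma le_of_pow_bound (R : realType) (a b K L : R) :
  0 <= a -> 0 <= b -> 1 <= L ->
  (forall m, a ^+ (2 ^ m) <= K * L ^+ m * b ^+ (2 ^ m)) -> a <= b.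
Proof.
move=> a0 b0 L1 h; rewrite leNgt; apply/negP => ba.
have b1 : b != 0.
  apply: contraTneq (h 0) => be; rewrite expn0 !expr1 be mulr0 -ltNge.
  by rewrite -be.
have {b1}b1 : 0 < b by rewrite lt_def b1.
have [r r1 hr] : exists2 r : R, 1 < r & forall m, r ^+ (2 ^ m) <= K * L ^+ m.
  exists (a / b) => [|m]; first by rewrite ltr_pdivlMr // mul1r.
  by rewrite expr_div_n ler_pdivrMr ?exprn_gt0.
(* Once [r ^ (2 ^ j) >= 2 L], the exponent [2 ^ (j + i)] gives at least [(2 L) ^ i], which beats
   [K * L ^ (j + i)] as soon as [2 ^ i > K * L ^ j]. *)
have [n hn] := exp_unbounded (2 * L) r1.
pose j := n.
have rj : 2 * L <= r ^+ (2 ^ j).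
  by apply: (le_trans (ltW hn)); rewrite ler_weXn2l ?(ltW r1) // ltnW // ltn_expl.
have L0 : 0 < L by lra.
have [i hi] := exp_unbounded (K * L ^+ j) (ltr1n R 2 : 1 < 2).
suff : 2 ^+ i <= K * L ^+ j by rewrite leNgt hi.
rewrite -(@ler_pM2r _ (L ^+ i)) ?exprn_gt0 // -mulrA -exprD -exprMn.
apply: le_trans (hr _); rewrite expnD exprM.
apply: (@le_trans _ _ ((r ^+ (2 ^ j)) ^+ i)).
  by apply: lerXn2r; rewrite ?nnegrE // ?exprn_ge0 //; lra.
by apply: ler_weXn2l; [rewrite exprn_ege1 // ltW|rewrite ltnW // ltn_expl].
Qed.

(* A self-adjoint [h] of norm at most [1/2] is the real part of the unitary
   [h + i sqrt (1 - h^2)], and unitaries are mapped to unitaries. *)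
Lemma sm_contractive_half (R : realType) (A B : cstarAlgType R) (f : A -> B)
  (fM : star_morphism f) (h : A) : star h = h -> nm h <= 2^-1 -> nm (f h) <= 1.
Proof.
move=> hh h2; have [y [yy hy y2]] := sqrt_one_sub_sq hh h2.
pose i : R[i] := 'i%C; have i2 : i * i = -1 := mul_ii R.
have ci : conjc i = - i := conjc_i R.
have uU : unitary (h + i *: y).
  have -> : unitary (h + i *: y) <-> True; last by [].
  split=> // _; split; rewrite starD starZ hh yy ci scaleNr.
    rewrite cmulBl !cmulDr -!cscaleAl -!cscaleAr scalerA i2 scaleN1r hy y2.
    by rewrite opprD opprK addrA addrK addrC subrK.
  rewrite cmulDl !cmulBr -!cscaleAl -!cscaleAr scalerA i2 scaleN1r hy y2.
  by rewrite opprK addrA subrK addrC subrK.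
have hE : h = (2^-1 : R[i]) *: ((h + i *: y) + star (h + i *: y)).
  rewrite starD starZ hh yy ci scaleNr addrACA subrr addr0 -mulr2n -[h *+ 2]scaler_nat.
  by rewrite scalerA mulVf ?scale1r // pnatr_eq0.
rewrite hE (sm_Z fM) (sm_D fM) nmZ.
rewrite nm_half; have := nmD (f (h + i *: y)) (f (star (h + i *: y))).
rewrite (nm_unitary (sm_unitary fM uU)).
by rewrite (nm_unitary (sm_unitary fM (unitary_star uU))); lra.
Qed.

(** Scaling a self-adjoint element to norm 1/2 yields the estimate up to a factor 2. Applied to the
    powers [2 ^ m], this factor is lost in the extraction of roots; a general [x] is reduced to
    [star x ** x]. *)
Lemma sm_contractive (R : realType) (A B : cstarAlgType R) (f : A -> B) :
  star_morphism f -> forall x, nm (f x) <= nm x.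
Proof.
move=> fM.
have sa2 h : star h = h -> nm (f h) <= 2 * nm h.
  move=> hh; have [/nm_eq0 ->|h0] := eqVneq (nm h) 0.
    by rewrite (sm_0 fM) !nm0 mulr0.
  have h1 : 0 < nm h by rewrite lt_def h0 nm_ge0.
  pose c : R := (2 * nm h)^-1; have c0 : 0 < c by rewrite invr_gt0 mulr_gt0.
  have := @sm_contractive_half _ _ _ f fM ((c%:C)%C *: h).
  rewrite starZ conjc_real hh (sm_Z fM) !nmZ nm_real gtr0_norm //.
  move=> /(_ erefl); rewrite [c * nm h]mulrC ler_pdivrMr ?mulr_gt0 //.
  rewrite mulKf // lexx => /(_ isT).
  by rewrite mulrC ler_pdivrMr ?mulr_gt0 // mul1r.
have sa h : star h = h -> nm (f h) <= nm h.
  move=> hh; apply: (@le_of_pow_bound _ _ _ 2 1) => [||//|m]; try exact: nm_ge0.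
  have fP n : f (cpow h n) = cpow (f h) n.
    by elim: n => [|n IH] /=; rewrite ?(sm_1 fM) // (sm_M fM) IH.
  rewrite -nm_selfadj_pow; last by rewrite -(sm_star fM) hh.
  rewrite -fP expr1n mulr1 -nm_selfadj_pow //; apply: sa2.
  by rewrite star_cpow hh.
move=> x; rewrite -(ler_pXn2r (n := 2)) ?nnegrE ?nm_ge0 //.
by rewrite -!nm_starM -(sm_star fM) -(sm_M fM) sa // starM starK.
Qed.

(** * Closed subalgebras and generation of quantum tori *)

(** Closedness makes the subset complete, so that the subtype is a C*-algebra and an admissible
    target of the universal property. *)
Record star_subalgebra (R : realType) (A : cstarAlgType R) := StarSubalgebra {
  ssa_set :> A -> Prop;
  ssa1 : ssa_set cone;
  ssa_lin : forall c x y, ssa_set x -> ssa_set y -> ssa_set (c *: x + y);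
  ssaM : forall x y, ssa_set x -> ssa_set y -> ssa_set (x ** y);
  ssa_star : forall x, ssa_set x -> ssa_set (star x);
  ssa_closed : closed (ssa_set : set A)
}.

Section SubAlgebra.
Variables (R : realType) (A : cstarAlgType R).

Definition ssa_pred (S : star_subalgebra A) : {pred A} := fun x => `[< S x >].

Fact ssa_submod_closed S : submod_closed (ssa_pred S).
Proof.
split=> [|c x y /asboolP xS /asboolP yS]; apply/asboolP; last exact: ssa_lin.
by have := ssa_lin (-1) (ssa1 S) (ssa1 S); rewrite scaleN1r addNr.
Qed.

HB.instance Definition _ S :=
  GRing.isSubmodClosed.Build R[i] A (ssa_pred S) (ssa_submod_closed S).

Definition ssa_type S : Type := {x : A | ssa_pred S x}.

HB.instance Definition _ S := SubChoice.on (ssa_type S).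
HB.instance Definition _ S := [SubChoice_isSubZmodule of ssa_type S by <:].
HB.instance Definition _ S := [SubZmodule_isSubLmodule of ssa_type S by <:].

Variable S : star_subalgebra A.
Implicit Types x y : ssa_type S.

Definition ssa_norm x : R[i] := `|val x|.

Fact ssa_normD x y : ssa_norm (x + y) <= ssa_norm x + ssa_norm y.
Proof. exact: ler_normD. Qed.

Fact ssa_normZ (c : R[i]) x : ssa_norm (c *: x) = `|c| * ssa_norm x.
Proof. exact: normrZ. Qed.

Fact ssa_norm_eq0 x : ssa_norm x = 0 -> x = 0.
Proof. by move=> /normr0_eq0 x0; apply/val_inj. Qed.

HB.instance Definition _ :=
  Lmodule_isNormed.Build R[i] (ssa_type S) ssa_normD ssa_normZ ssa_norm_eq0.

Fact ssa_complete (F : set_system (ssa_type S)) :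
  ProperFilter F -> cauchy F -> cvg F.
Proof.
move=> FF /cauchy_ballP FC.
pose v : ssa_type S -> A := val.
have /cauchy_cvg vF : cauchy (v @ F).
  apply/cauchy_ballP => e e0; case: (FC e e0) => -[P Q] /= [FP FQ] PQ.
  exists (v @` P, v @` Q).
    by split; [apply: filterS FP|apply: filterS FQ] => x Px; exists x.
  move=> [a b] /= [[x Px <-] [y Qy <-]].
  by have := PQ (x, y); rewrite /= -!ball_normE /=; apply; split.
pose l := lim (v @ F).
have lS : ssa_set S l.
  apply: (proj2 (nm_closedP _) (@ssa_closed _ _ S)) => e e0.
  have /nm_cvgP /(_ e e0) /filter_ex[x xl] := vF.
  by exists (v x); [exact/asboolP/(valP x)|rewrite nm_distC].
apply/cvg_ex; exists (exist _ l (asboolT lS) : ssa_type S) => P /nm_nbhsP[e e0 eP].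
have /nm_cvgP /(_ e e0) := vF; rewrite nbhs_simpl; apply: filterS => x xl.
exact: eP.
Qed.

HB.instance Definition _ := Uniform_isComplete.Build (ssa_type S) ssa_complete.

Definition ssa_cone : ssa_type S := exist _ cone (asboolT (ssa1 S)).

Definition ssa_cmul x y : ssa_type S :=
  exist _ (val x ** val y) (asboolT (ssaM (asboolW (valP x)) (asboolW (valP y)))).

Definition ssa_cstar x : ssa_type S :=
  exist _ (star (val x)) (asboolT (ssa_star (asboolW (valP x)))).

Fact ssa_cmulA : associative ssa_cmul.
Proof. by move=> x y z; apply/val_inj; rewrite /= cmulA. Qed.
Fact ssa_cmul1x : left_id ssa_cone ssa_cmul.
Proof. by move=> x; apply/val_inj; rewrite /= cmul1x. Qed.
Fact ssa_cmulx1 : right_id ssa_cone ssa_cmul.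
Proof. by move=> x; apply/val_inj; rewrite /= cmulx1. Qed.
Fact ssa_cmulDl : left_distributive ssa_cmul +%R.
Proof. by move=> x y z; apply/val_inj; rewrite /= cmulDl. Qed.
Fact ssa_cmulDr : right_distributive ssa_cmul +%R.
Proof. by move=> x y z; apply/val_inj; rewrite /= cmulDr. Qed.
Fact ssa_cscaleAl (c : R[i]) x y : c *: ssa_cmul x y = ssa_cmul (c *: x) y.
Proof. by apply/val_inj; rewrite /= cscaleAl. Qed.
Fact ssa_cscaleAr (c : R[i]) x y : c *: ssa_cmul x y = ssa_cmul x (c *: y).
Proof. by apply/val_inj; rewrite /= cscaleAr. Qed.
Fact ssa_cone_neq0 : ssa_cone != 0.
Proof. exact: cone_neq0. Qed.
Fact ssa_starK : involutive ssa_cstar.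
Proof. by move=> x; apply/val_inj; rewrite /= starK. Qed.
Fact ssa_starD : {morph ssa_cstar : x y / x + y}.
Proof. by move=> x y; apply/val_inj; rewrite /= starD. Qed.
Fact ssa_starZ (c : R[i]) x : ssa_cstar (c *: x) = conjc c *: ssa_cstar x.
Proof. by apply/val_inj; rewrite /= starZ. Qed.
Fact ssa_starM x y : ssa_cstar (ssa_cmul x y) = ssa_cmul (ssa_cstar y) (ssa_cstar x).
Proof. by apply/val_inj; rewrite /= starM. Qed.
Fact ssa_cnormM x y : `|ssa_cmul x y| <= `|x| * `|y|.
Proof. exact: cnormM. Qed.
Fact ssa_cnorm_star x : `|ssa_cmul (ssa_cstar x) x| = `|x| ^+ 2.
Proof. exact: cnorm_star. Qed.

HB.instance Definition _ := NormedModule_isCStarAlgebra.Build R (ssa_type S)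
  ssa_cmulA ssa_cmul1x ssa_cmulx1 ssa_cmulDl ssa_cmulDr ssa_cscaleAl ssa_cscaleAr
  ssa_cone_neq0 ssa_starK ssa_starD ssa_starZ ssa_starM ssa_cnormM ssa_cnorm_star.

Lemma ssa_val_morphism : star_morphism (val : ssa_type S -> A).
Proof. by []. Qed.

End SubAlgebra.

Lemma qtorus_uniq (R : realType) (n : nat) (theta : 'M[R]_n) (T : quantum_torus theta)
    (B : cstarAlgType R) (f g : T -> B) : star_morphism f -> star_morphism g ->
  (forall k, f (qtorus_gen T k) = g (qtorus_gen T k)) -> f = g.
Proof.
move=> fM gM fg.
have fR : qtorus_rel theta (fun k => f (qtorus_gen T k)).
  have [uU uC] := qtorus_genP T; split=> [k|k l]; first exact: sm_unitary.
  by rewrite -!(sm_M fM) uC (sm_Z fM).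
have [h [_ hu]] := qtorus_universal T fR.
by rewrite -(hu f) //; apply: hu; split=> // k; rewrite fg.
Qed.

(* The generators lie in the subalgebra [S], so universality gives a morphism
   into [S]; its composition with the inclusion is the identity. *)
Lemma qtorus_generated (R : realType) (n : nat) (theta : 'M[R]_n)
    (T : quantum_torus theta) (S : star_subalgebra T) :
  (forall k, ssa_set S (qtorus_gen T k)) -> forall x, ssa_set S x.
Proof.
move=> genS x.
pose v k : ssa_type S := exist _ (qtorus_gen T k) (asboolT (genS k)).
have vR : qtorus_rel theta v.
  have [uU uC] := qtorus_genP T; split=> [k|k l]; last first.
    by apply/val_inj; rewrite /= uC.
  by have [u1 u2] := uU k; split; apply/val_inj.
have [f [[fM fv] _]] := qtorus_universal T vR.
have : val \o f = id.
  apply: qtorus_uniq => // [|k]; last by rewrite /= fv.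
  by apply: sm_comp fM _; exact: ssa_val_morphism.
by move=> /(congr1 (fun h => h x)) /= <-; exact/asboolP/(valP (f x)).
Qed.

(** * The exponential and positivity *)

Section E2pi.
Variable R : realType.
Implicit Types x y : R.

Lemma e2piD x y : e2pi (x + y) = e2pi x * e2pi y.
Proof.
rewrite /e2pi mulrDr cosD sinD; simpc; congr (_ +i* _)%C.
by rewrite addrC [X in _ + X]mulrC.
Qed.

Lemma e2pi0 : e2pi (0 : R) = 1.
Proof. by rewrite /e2pi mulr0 cos0 sin0. Qed.

Lemma e2piN x : e2pi (- x) = conjc (e2pi x).
Proof. by rewrite /e2pi mulrN cosN sinN. Qed.

Lemma nm_e2pi x : nm (e2pi x) = 1.
Proof.
have /(congr1 (@nm _ _)) := conjc_e2pi x; rewrite nmcM nm_cJ nm1c => /eqP.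
rewrite -expr2 sqrf_eq1 => /orP[/eqP //|/eqP h].
by have := nm_ge0 (e2pi x); rewrite h; lra.
Qed.

Lemma e2pi_neq0 x : e2pi x != 0.
Proof. by apply: contra_eq_neq (nm_e2pi x) => ->; rewrite nm0 eq_sym oner_eq0. Qed.

Lemma e2pi_nat x m : e2pi (m%:R * x) = e2pi x ^+ m.
Proof.
elim: m => [|m IH]; first by rewrite mul0r e2pi0.
by rewrite -natr1 mulrDl mul1r e2piD IH exprSr.
Qed.

Lemma e2pi_sum (I : Type) (r : seq I) (P : pred I) (F : I -> R) :
  e2pi (\sum_(i <- r | P i) F i) = \prod_(i <- r | P i) e2pi (F i).
Proof. by elim/big_rec2: _ => [|i a b _ <-]; rewrite ?e2pi0 ?e2piD. Qed.

Lemma e2pi_int x : x \is a Num.int -> e2pi x = 1.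
Proof. by move=> /e2piDint h; rewrite -[x]add0r h e2pi0. Qed.

(** For the fractional part [r] of [x], [cos (2 pi r) = 1 - 2 sin^2 (pi r)] forces [sin (pi r) = 0],
    whereas the sine is positive for [0 < r < 1]. *)
Lemma e2pi_eq1 x : e2pi x = 1 -> x \is a Num.int.
Proof.
move=> e1; have xr := floor_itv x.
pose r := x - (Num.floor x)%:~R.
have xE : x = r + (Num.floor x)%:~R by rewrite subrK.
have r0 : 0 <= r by rewrite subr_ge0; case/andP: xr.
have r1 : r < 1 by rewrite ltrBlDl -intrD1; case/andP: xr.
have er : cos (pi * r *+ 2) = 1.
  move: e1; rewrite xE e2piDint ?intr_int // => -[<- _].
  by rewrite -mulr_natl mulrA.
suff -> : x = (Num.floor x)%:~R by exact: intr_int.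
rewrite [LHS]xE; apply/eqP; rewrite -subr_eq0 addrK.
apply: contraT => rn0; have {rn0}r0 : 0 < r by rewrite lt_def rn0.
have sr : 0 < sin (pi * r).
  by rewrite sin_gt0_pi // mulr_gt0 ?pi_gt0 //= gtr_pMr ?pi_gt0.
have : 0 < sin (pi * r) ^+ 2 by rewrite exprn_gt0.
by move: er; rewrite cos_mulr2n cos2sin2 => er; lra.
Qed.

Lemma e2pi_eq x y : e2pi x = e2pi y -> x - y \is a Num.int.
Proof.
move=> xy; apply: e2pi_eq1; rewrite e2piD e2piN xy mulrC; exact: conjc_e2pi.
Qed.

Lemma e2pi_surj (z : R[i]) : nm z = 1 -> exists x, z = e2pi x.
Proof.
case: z => a b /(congr1 (fun x => x ^+ 2)).
have -> : nm (a +i* b)%C ^+ 2 = a ^+ 2 + b ^+ 2.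
  by apply: complexI; rewrite rmorphXn /= -nmE -add_Re2_Im2.
rewrite expr1n => ab.
have a1 : -1 <= a <= 1.
  rewrite -ler_norml -(ler_pXn2r (n := 2)) ?nnegrE // real_normK ?num_real //.
  by rewrite expr1n -ab lerDl sqr_ge0.
have p0 : pi != 0 :> R by rewrite gt_eqF ?pi_gt0.
have b2 : 1 - a ^+ 2 = b ^+ 2 by rewrite -ab addrAC subrr add0r.
have [b0|b0] := leP 0 b.
  exists (acos a / (2 * pi)); rewrite /e2pi mulrC mulfVK ?mulf_neq0 ?pnatr_eq0 //.
  by rewrite acosK ?in_itv //= sin_acos // b2 sqrtr_sqr ger0_norm.
exists (- (acos a / (2 * pi))); rewrite /e2pi mulrN [_ * (_ / _)]mulrC.
rewrite mulfVK ?mulf_neq0 ?pnatr_eq0 // cosN sinN.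
by rewrite acosK ?in_itv //= sin_acos // b2 sqrtr_sqr ltr0_norm // opprK.
Qed.

Lemma e2pi_continuous0 (e : R) : 0 < e ->
  exists2 d : R, 0 < d & forall x, `|x| < d -> nm (e2pi x - 1) < e.
Proof.
move=> e0; have e2 : 0 < e / 2 by rewrite divr_gt0.
have := @continuous_cos R 0 => /cvgrPdist_lt /(_ _ e2).
have := @continuous_sin R 0 => /cvgrPdist_lt /(_ _ e2).
move=> /nbhs_normP[d1 /= d10 h1] /nbhs_normP[d2 /= d20 h2].
have p0 : 0 < 2 * pi :> R by rewrite mulr_gt0 ?pi_gt0.
exists (Num.min d1 d2 / (2 * pi)) => [|x].
  by rewrite divr_gt0 // lt_min d10 d20.
rewrite ltr_pdivlMr // lt_min => /andP[x1 x2].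
have nx : `|0 - 2 * pi * x| = `|x| * (2 * pi).
  by rewrite sub0r normrN normrM (gtr0_norm p0) mulrC.
have := h1 (2 * pi * x); have := h2 (2 * pi * x).
rewrite /ball_ /= nx cos0 sin0 => /(_ x2) c1 /(_ x1); rewrite sub0r normrN => s1.
have -> : e2pi x - 1 = ((cos (2 * pi * x) - 1)%:C)%C + 'i%C * ((sin (2 * pi * x))%:C)%C.
  apply/eqP; rewrite eq_complex /=.
  by rewrite !(mul0r, mulr0, mul1r, subr0, addr0, add0r, oppr0) !eqxx.
apply: le_lt_trans (nmD _ _) _; rewrite nmcM !nm_real.
by rewrite nm_i mul1r -(distrC 1) in c1 *; move: c1 s1; rewrite distrC; lra.
Qed.

End E2pi.

Section Positivity.
Variables (R : realType) (A : cstarAlgType R).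

(* [w = 1 + i sqrt(2 d) x - d x^2] has [w^* w = 1 + d^2 x^4] and real part
   [1 - d x^2]: this is [exp (i sqrt(2 d) x)] up to the order that matters. *)
Lemma nm_one_sub_sq (x : A) (d : R) : star x = x -> 0 <= d ->
  nm (cone - (d%:C)%C *: (x ** x)) <= 1 + d ^+ 2 * nm x ^+ 4.
Proof.
move=> xx d0; set p := cone - _.
have pp : star p = p by rewrite starB star1 starZ conjc_real starM xx.
have px : p ** x = x ** p.
  by rewrite cmulBl cmulBr cmul1x cmulx1 -cscaleAl -cscaleAr cmulA.
have pD : p = cone - (d%:C)%C *: (x ** x) by [].
clearbody p.
pose i : R[i] := 'i%C; have i2 : i * i = -1 := mul_ii R.
pose s : R[i] := ((Num.sqrt (2 * d))%:C)%C.
have s2 : s * s = ((2 * d)%:C)%C by rewrite -rmorphM /= -expr2 sqr_sqrtr // mulr_ge0.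
pose w := p + (i * s) *: x.
have ws : star w = p - (i * s) *: x.
  rewrite starD pp starZ xx -scaleNr; congr (_ + _ *: _).
  apply/eqP; rewrite eq_complex /=.
  by rewrite !(mul0r, mulr0, mul1r, subr0, addr0, add0r, oppr0) !eqxx.
have ww : star w ** w = cone + ((d ^+ 2)%:C)%C *: ((x ** x) ** (x ** x)).
  rewrite ws cmulBl !cmulDr -!cscaleAl -!cscaleAr px opprD addrA addrK.
  rewrite scalerA mulrACA i2 s2 mulN1r scaleNr opprK pD.
  rewrite cmulBl cmul1x cmulBr cmulx1 -cscaleAl -cscaleAr scalerA opprB.
  have -> : 2 * d = d + d by rewrite mulr_natl.
  by rewrite addrACA -opprD rmorphD /= scalerDl subrK -rmorphM.
have w2 : nm w ^+ 2 <= 1 + d ^+ 2 * nm x ^+ 4.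
  rewrite -nm_starM ww; apply: le_trans (nmD _ _) _; rewrite nm_cone lerD2l.
  rewrite nmZ nm_real ger0_norm ?sqr_ge0 // ler_wpM2l ?sqr_ge0 //.
  apply: le_trans (nmM _ _) _.
  have -> : nm x ^+ 4 = (nm x * nm x) * (nm x * nm x) by rewrite !exprS expr0 mulr1 !mulrA.
  by rewrite ler_pM ?nm_ge0 // nmM.
have pE : p = (2^-1 : R[i]) *: (w + star w).
  rewrite ws addrACA subrr addr0 -mulr2n -[p *+ 2]scaler_nat.
  by rewrite scalerA mulVf ?scale1r // pnatr_eq0.
have pw : nm p <= nm w.
  rewrite pE nmZ.
  by rewrite nm_half; have := nmD w (star w); rewrite nm_star; lra.
apply: le_trans pw _; rewrite -(ler_pXn2r (n := 2)) ?nnegrE ?nm_ge0 //; last first.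
  by rewrite addr_ge0 // mulr_ge0 ?sqr_ge0 // exprn_ge0 // nm_ge0.
apply: le_trans w2 _; rewrite sqrrD expr1n mul1r.
have h : 0 <= d ^+ 2 * nm x ^+ 4 by rewrite mulr_ge0 ?sqr_ge0 // exprn_ge0 // nm_ge0.
have := sqr_ge0 (d ^+ 2 * nm x ^+ 4); rewrite -[_ *+ 2]mulr_natl; lra.
Qed.

(** The product of [1 - d x^2] and [1 - d y^2] is [(1 - d s) + d^2 x^2 y^2]. If [s] were negative,
    its norm would grow linearly in [d], whereas the norms of the two factors are [1 + O(d^2)]. *)
Lemma sum_sq_scalar_ge0 (x y : A) (s : R) : star x = x -> star y = y ->
  x ** x + y ** y = (s%:C)%C *: cone -> 0 <= s.
Proof.
move=> xx yy xy; rewrite leNgt; apply/negP => s0.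
pose X := nm x ^+ 4; pose Y := nm y ^+ 4; pose K := nm (x ** x ** (y ** y)).
have X0 : 0 <= X by rewrite exprn_ge0 ?nm_ge0.
have Y0 : 0 <= Y by rewrite exprn_ge0 ?nm_ge0.
have K0 : 0 <= K by exact: nm_ge0.
pose M := K + X + Y + X * Y.
have XY0 : 0 <= X * Y by rewrite mulr_ge0.
have M0 : 0 <= M by rewrite /M; lra.
have key d : 0 <= d -> d <= 1 -> 1 - d * s <= 1 + d ^+ 2 * M.
  move=> d0 d1.
  have h1 := nm_one_sub_sq xx d0; have h2 := nm_one_sub_sq yy d0.
  have h3 := nmM (cone - (d%:C)%C *: (x ** x)) (cone - (d%:C)%C *: (y ** y)).
  have h4 := ler_pM (nm_ge0 _) (nm_ge0 _) h1 h2.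
  have E : (cone - (d%:C)%C *: (x ** x)) ** (cone - (d%:C)%C *: (y ** y)) =
     ((1 - d * s)%:C)%C *: cone + ((d ^+ 2)%:C)%C *: (x ** x ** (y ** y)).
    rewrite cmulBl cmul1x cmulBr cmulx1 -cscaleAl -cscaleAr scalerA opprB.
    rewrite addrACA -opprD -scalerDr [y ** y + _]addrC xy addrAC.
    by rewrite scalerA rmorphB rmorph1 /= scalerBl scale1r -!rmorphM.
  move: h3; rewrite E => h3.
  have h5 := nmD (((1 - d * s)%:C)%C *: (cone : A) + ((d ^+ 2)%:C)%C *: (x ** x ** (y ** y)))
     (- (((d ^+ 2)%:C)%C *: (x ** x ** (y ** y)))).
  move: h5; rewrite addrK nmN !nmZ !nm_real nm_cone mulr1 -/K (ger0_norm (sqr_ge0 _)).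
  have ds : d * s <= 0 by rewrite mulr_ge0_le0 // ltW.
  rewrite ger0_norm; last by lra.
  have d2 : d ^+ 2 * d ^+ 2 <= d ^+ 2.
    by rewrite ler_piMl ?sqr_ge0 // exprn_ile1.
  have h6 := ler_wpM2r XY0 d2.
  move=> h5; move: h3 h4 h5; rewrite /M -/X -/Y; lra.
(* Chosen so that [d <= 1] and [d * M < - s], which contradicts [key]. *)
pose d := - s / (M + 1 - s).
have D0 : 0 < M + 1 - s by lra.
have d0 : 0 < d by rewrite divr_gt0 // oppr_gt0.
have d1 : d <= 1 by rewrite ler_pdivrMr // mul1r; lra.
have : - s <= d * M by rewrite -(ler_pM2l d0); have := key d (ltW d0) d1; lra.
have -> : d * M = - s * (M / (M + 1 - s)) by rewrite /d mulrAC mulrA.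
rewrite leNgt => /negP; apply.
by rewrite gtr_pMr ?oppr_gt0 // ltr_pdivrMr // mul1r; lra.
Qed.

(** The two bracketings of [a ** star a ** a] give [c = c'], and the star makes [c] real. Once [c]
    is known to be positive, [a] is divided by its square root. *)
Lemma unitary_of_scalar_squares (a : A) (c c' : R[i]) : a != 0 ->
  star a ** a = c *: cone -> a ** star a = c' *: cone ->
  exists2 r : R, 0 < r & unitary ((r%:C)%C *: a).
Proof.
move=> a0 aa aa'.
have cc : c' = c.
  have : (c' - c) *: a = 0.
    rewrite scalerBl -{1}[a]cmul1x -[a in X in _ - X]cmulx1 cscaleAl -aa'.
    by rewrite cscaleAr -aa cmulA subrr.
  by move=> /eqP; rewrite scaler_eq0 (negPf a0) orbF subr_eq0 => /eqP.
have creal : conjc c = c.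
  have /eqP := congr1 star aa; rewrite starM starK aa starZ star1 -subr_eq0 -scalerBl.
  by rewrite scaler_eq0 (negPf (@cone_neq0 _ A)) orbF subr_eq0 => /eqP.
have {creal}cE : c = ((complex.Re c)%:C)%C.
  case: c creal {cc aa} => u v /= [] /eqP; rewrite -subr_eq0 -opprD oppr_eq0 -mulr2n.
  by rewrite mulrn_eq0 /= => /eqP ->.
set t := complex.Re c in cE.
have t0 : 0 <= t.
  have h : 0 <= t *+ 4.
    apply: (@sum_sq_scalar_ge0 (a + star a) ('i%C *: (a - star a))).
    - by rewrite starD starK addrC.
    - by rewrite starZ conjc_i starB starK scaleNr -scalerN opprB.
    - rewrite -cscaleAl -cscaleAr scalerA mul_ii scaleN1r.
      rewrite !cmulDl !cmulDr !cmulNx !cmulxN !opprK aa aa' cc cE.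
      set q := a ** a; set q' := star a ** star a; set u := _ *: cone.
      rewrite [u + q']addrC [q + u + _]addrACA [- u + q']addrC [q - u + _]addrACA.
      by rewrite -opprD opprB [LHS]addrC subrKA rmorphMn /= -scalerMnl !mulrS mulr0n addr0 !addrA.
  by move: h; rewrite -mulr_natr; lra.
have t0' : t != 0.
  apply: contraNneq a0 => t0'; have := nm_starM a.
  by rewrite aa cE t0' scale0r nm0 => /esym/eqP; rewrite expf_eq0 => /andP[_ /eqP/nm_eq0 ->].
have {t0'}t0 : 0 < t by rewrite lt_def t0'.
pose r := (Num.sqrt t)^-1; have r0 : 0 < r by rewrite invr_gt0 sqrtr_gt0.
have rrt : (r%:C * (r%:C * c) = 1)%C.
  have rt : r * (r * t) = 1.
    by rewrite mulrA -expr2 exprVn sqr_sqrtr ?(ltW t0) // mulVf // gt_eqF.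
  by rewrite cE -!rmorphM /= rt.
exists r => //; split; rewrite starZ conjc_real -cscaleAl -cscaleAr ?aa ?aa' ?cc !scalerA.
  by rewrite -mulrA rrt scale1r.
by rewrite -mulrA rrt scale1r.
Qed.

End Positivity.

(** * Fourier coefficients and Fejer's theorem *)

Section Means.
Variables (R : realType) (V : completeNormedModType R[i]).
Implicit Types (F G : R -> V) (l : V).

Definition rsum (N : nat) F (t : R) : V := \sum_(0 <= j < N) F (t + j%:R / N%:R).
(* Riemann sums replace the Bochner integral over [R / Z]. *)
Definition ravg (N : nat) F : V := ((N%:R^-1 : R)%:C)%C *: rsum N F 0.

Definition unif_cont (W : normedZmodType R[i]) (F : R -> W) := forall e : R, 0 < e ->
  exists2 d : R, 0 < d & forall x y, `|x - y| < d -> nm (F x - F y) < e.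

Definition is_mean F l := forall e : R, 0 < e ->
  exists N0, forall N, (N0 <= N)%N -> nm (ravg N F - l) < e.

Lemma nm_invn (N : nat) : nm ((N%:R^-1 : R)%:C)%C = N%:R^-1.
Proof. by rewrite nm_real ger0_norm // invr_ge0 ler0n. Qed.

Lemma ravg_dist (N : nat) F G (c : R) : (0 < N)%N ->
  (forall x, nm (F x - G x) <= c) -> nm (ravg N F - ravg N G) <= c.
Proof.
move=> N0 FG; rewrite -scalerBr nmZ nm_invn -sumrB mulrC ler_pdivrMr ?ltr0n //.
apply: le_trans (nm_sum _ _ _) _; apply: le_trans (ler_sum _ (fun i _ => FG _)) _.
by rewrite sumr_const_nat subn0 mulr_natr.
Qed.

Lemma sum_nat_mul (N M : nat) (g : nat -> V) :
  \sum_(0 <= k < N * M) g k = \sum_(0 <= j < N) \sum_(0 <= i < M) g (j * M + i)%N.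
Proof.
elim: N => [|N IH]; first by rewrite mul0n !big_geq.
rewrite big_nat_recr //= -IH mulSnr (big_cat_nat (n := N * M)) ?leq_addr //=.
congr (_ + _); rewrite -{1}[(N * M)%N]add0n big_addn addnC addnK.
by apply: eq_big_nat => i _; rewrite addnC.
Qed.

Lemma ravg_mul (N M : nat) F (d c : R) : (0 < N)%N -> (0 < M)%N ->
  (forall x y, `|x - y| < d -> nm (F x - F y) <= c) -> N%:R^-1 < d ->
  nm (ravg (N * M) F - ravg N F) <= c.
Proof.
move=> N0 M0 Fd Nd; have N1 : (0 : R) < N%:R by rewrite ltr0n.
have M1 : (0 : R) < M%:R by rewrite ltr0n.
have -> : ravg N F = (((N * M)%:R^-1 : R)%:C)%C *:
    \sum_(0 <= j < N) \sum_(0 <= i < M) F (0 + j%:R / N%:R).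
  under eq_bigr do rewrite sumr_const_nat subn0 -scaler_nat.
  rewrite -scaler_sumr scalerA /ravg /rsum; congr (_ *: _).
  rewrite -(rmorph_nat (real_complex R) M) -rmorphM /= natrM invfM mulfVK //.
  by rewrite gt_eqF.
rewrite /ravg /rsum sum_nat_mul -scalerBr nmZ nm_invn -sumrB mulrC.
rewrite ler_pdivrMr ?ltr0n ?muln_gt0 ?N0 //.
apply: le_trans (nm_sum _ _ _) _.
have -> : c * (N * M)%:R = \sum_(0 <= j < N) \sum_(0 <= i < M) c.
  under eq_bigr do rewrite sumr_const_nat subn0.
  by rewrite sumr_const_nat subn0 -mulrnA mulnC mulr_natr.
apply: ler_sum => j _; rewrite -sumrB; apply: le_trans (nm_sum _ _ _) _.
rewrite big_nat_cond [leRHS]big_nat_cond; apply: ler_sum => i /andP[/andP[_ iM] _].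
apply: Fd; rewrite !add0r natrD !natrM mulrDl.
have -> : j%:R * M%:R / (N%:R * M%:R) = j%:R / N%:R :> R.
  by rewrite invfM mulrACA mulfV ?mulr1 // gt_eqF.
rewrite addrAC subrr add0r ger0_norm ?divr_ge0 ?mulr_ge0 ?ler0n //.
apply: le_lt_trans Nd; rewrite ler_pdivrMr ?mulr_gt0 // mulKf ?gt_eqF //.
by rewrite ler_nat ltnW.
Qed.

(** Cauchy property: the averages over [m] and over [n] points are both compared with the average
    over the common refinement of [m * n] points. *)
Lemma mean_exists F : unif_cont F -> exists l, is_mean F l.
Proof.
move=> Fu.
have [e e0|l lP] := @nm_cauchy _ V (fun m => ravg m F); last by exists l.
have [d d0 dP] := Fu (e / 4) ltac:(by rewrite divr_gt0).
have [K Kd] : exists K : nat, forall N, (K <= N)%N -> (0 < N)%N /\ N%:R^-1 < d.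
  exists (Num.truncn d^-1).+1 => N KN; have N0 : (0 < N)%N by apply: leq_trans KN.
  split=> //; rewrite invf_plt ?posrE ?ltr0n //.
  by apply: lt_le_trans (truncnS_gt _) _; rewrite ler_nat.
exists K => m n /Kd[m0 md] /Kd[n0 nd].
have dP' x y : `|x - y| < d -> nm (F x - F y) <= e / 4 by move=> /dP /ltW.
have h1 := ravg_mul m0 n0 dP' md; have := ravg_mul n0 m0 dP' nd.
rewrite mulnC => h2; have := nm_dist_trans (ravg (m * n) F) (ravg m F) (ravg n F).
by rewrite (nm_distC (ravg m F) (ravg (m * n) F)); lra.
Qed.

Lemma mean_unique F l l' : is_mean F l -> is_mean F l' -> l = l'.
Proof.
move=> h h'; apply: (@nm_eq_lim _ _ _ _ 2) => e e0.
have [N hN] := h e e0; have [N' hN'] := h' e e0.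
have := hN (maxn N N') (leq_maxl _ _); have := hN' (maxn N N') (leq_maxr _ _).
have := nm_dist_trans (ravg (maxn N N') F) l l'; rewrite (nm_distC l (ravg _ _)).
by lra.
Qed.

Lemma mean_lin (c : R[i]) F G l l' : is_mean F l -> is_mean G l' ->
  is_mean (fun t => c *: F t + G t) (c *: l + l').
Proof.
move=> h h' e e0; have c0 : 0 < nm c + 1 by rewrite ltr_wpDl ?nm_ge0.
have [N hN] := h (e / 2 / (nm c + 1)) ltac:(by rewrite !divr_gt0).
have [N' hN'] := h' (e / 2) ltac:(by rewrite divr_gt0).
exists (maxn N N') => m; rewrite geq_max => /andP[/hN h1 /hN' h2].
have -> : ravg m (fun t => c *: F t + G t) = c *: ravg m F + ravg m G.
  by rewrite /ravg /rsum big_split -scaler_sumr scalerDr /= !scalerA mulrC.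
rewrite opprD addrACA -scalerBr; apply: le_lt_trans (nmD _ _) _; rewrite nmZ.
have := ler_wpM2l (nm_ge0 c) (ltW h1).
by have := mul_half_div_succ_le (nm_ge0 c) e0; lra.
Qed.

Lemma mean0 : is_mean (fun=> 0 : V) 0.
Proof.
by move=> e e0; exists 0%N => N _; rewrite /ravg /rsum big1 // scaler0 subrr nm0.
Qed.

Lemma mean_ext F G l : F =1 G -> is_mean F l -> is_mean G l.
Proof. by move=> /funext ->. Qed.

Lemma mean_map (L : V -> V) F l : linear L -> (forall x, nm (L x) <= nm x) ->
  is_mean F l -> is_mean (L \o F) (L l).
Proof.
move=> Ll Lc h e e0; have [N hN] := h e e0; exists N => m /hN; apply: le_lt_trans.
have L0 : L 0 = 0 by have := Ll (-1) 0 0; rewrite !scaleN1r !addNr.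
have LZ c x : L (c *: x) = c *: L x by have := Ll c x 0; rewrite !addr0 L0 addr0.
have LD x y : L (x + y) = L x + L y by have := Ll 1 x y; rewrite !scale1r.
have -> : ravg m (L \o F) = L (ravg m F).
  rewrite /ravg LZ; congr (_ *: _); rewrite /rsum.
  by elim/big_rec2: _ => [|i a b _ ->]; rewrite ?L0 ?LD.
by rewrite -scaleN1r -LZ -LD scaleN1r.
Qed.

(** A shift by a multiple of [1 / m] permutes the [m] grid points modulo the period. What remains of
    [t] is some [r] with [0 <= r < 1 / m], which uniform continuity absorbs. *)
Lemma mean_shift F l t : unif_cont F -> (forall x, F (x + 1) = F x) ->
  is_mean F l -> is_mean (fun x => F (x + t)) l.
Proof.
move=> Fu Fp h e e0; have [d d0 dP] := Fu (e / 2) ltac:(by rewrite divr_gt0).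
have [N hN] := h (e / 2) ltac:(by rewrite divr_gt0).
exists (maxn N (Num.truncn d^-1).+1) => m; rewrite geq_max => /andP[Nm dm].
have m0 : (0 < m)%N by apply: leq_trans dm.
have m1 : (0 : R) < m%:R by rewrite ltr0n.
have {}dm : m%:R^-1 < d.
  rewrite invf_plt ?posrE //.
  by apply: lt_le_trans (truncnS_gt _) _; rewrite ler_nat.
have Sp x : rsum m F (x + m%:R^-1) = rsum m F x.
  rewrite /rsum; case: m m0 m1 {Nm dm} => // m _ m1.
  have E (i : nat) : x + m.+1%:R^-1 + i%:R / m.+1%:R = x + i.+1%:R / m.+1%:R.
    by rewrite -[i.+1%:R]nat1r mulrDl mul1r addrA.
  rewrite big_nat_recr //= big_nat_recl //= addrC mul0r addr0; congr (_ + _).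
    by rewrite E mulfV ?gt_eqF // Fp.
  by apply: eq_bigr => i _; rewrite E.
have SpN x k : rsum m F (x + k%:R / m%:R) = rsum m F x.
  elim: k => [|k IH]; first by rewrite mul0r addr0.
  by rewrite -natr1 mulrDl mul1r addrA Sp.
have SpZ x (k : int) : rsum m F (x + k%:~R / m%:R) = rsum m F x.
  case: k => k; first exact: SpN.
  by rewrite NegzE -(SpN _ k.+1) mulrNz mulNr subrK.
pose k := Num.floor (t * m%:R); pose r := t - k%:~R / m%:R.
have /andP[k1 k2] := floor_itv (t * m%:R).
have r0 : 0 <= r by rewrite subr_ge0 ler_pdivrMr.
have r1 : r < d.
  apply: le_lt_trans dm; have : t <= (k%:~R + 1) / m%:R.
    by rewrite ler_pdivlMr // -intrD1 ltW.
  by rewrite mulrDl mul1r lerBlDl.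
have -> : ravg m (fun x => F (x + t)) = ravg m (fun x => F (x + r)).
  have E s : \sum_(0 <= j < m) F (0 + j%:R / m%:R + s) = rsum m F s.
    by apply: eq_bigr => j _; rewrite add0r addrC.
  by rewrite /ravg [X in _ *: X = _]E [X in _ = _ *: X]E -[in LHS](subrK (k%:~R / m%:R) t) SpZ.
have h1 : nm (ravg m (fun x => F (x + r)) - ravg m F) <= e / 2.
  apply: ravg_dist => // x; apply/ltW/dP.
  by rewrite addrAC subrr add0r ger0_norm.
have h2 := hN m Nm.
have := nm_dist_trans (ravg m F) (ravg m (fun x => F (x + r))) l; lra.
Qed.

End Means.

Section UnifContScalars.
Variable R : realType.

Definition ucb (c : R -> R[i]) := (forall t, nm (c t) <= 1) /\ unif_cont c.

Lemma ucbM c d : ucb c -> ucb d -> ucb (fun t => c t * d t).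
Proof.
move=> [c1 cu] [d1 du]; split=> [t|e e0].
  by rewrite nmcM -[1]mulr1 ler_pM ?nm_ge0.
have [d' d'0 dP'] := cu (e / 2) ltac:(by rewrite divr_gt0).
have [d'' d''0 dP''] := du (e / 2) ltac:(by rewrite divr_gt0).
exists (Num.min d' d'') => [|x y]; first by rewrite lt_min d'0.
rewrite lt_min => /andP[/dP' h1 /dP'' h2].
have -> : c x * d x - c y * d y = c x * (d x - d y) + (c x - c y) * d y.
  by rewrite mulrBr mulrBl addrA subrK.
apply: le_lt_trans (nmD _ _) _; rewrite !nmcM.
have := ler_wpM2r (nm_ge0 (d x - d y)) (c1 x).
have := ler_wpM2l (nm_ge0 (c x - c y)) (d1 y); lra.
Qed.

Lemma ucb1 : ucb (fun=> 1).
Proof.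
split=> [t|e e0]; first by rewrite nm1c.
by exists 1 => // x y _; rewrite subrr nm0.
Qed.

Lemma ucbX c n : ucb c -> ucb (fun t => c t ^+ n).
Proof.
move=> cu; elim: n => [|n IH]; first exact: ucb1.
by under eq_fun do rewrite exprS; exact: ucbM.
Qed.

Lemma ucb_e2pi (k : R) : ucb (fun t => e2pi (k * t)).
Proof.
split=> [t|e e0]; first by rewrite nm_e2pi.
have [d d0 dP] := e2pi_continuous0 e0; have k0 : 0 < `|k| + 1 by rewrite ltr_wpDl.
exists (d / (`|k| + 1)) => [|x y xy]; first by rewrite divr_gt0.
have -> : e2pi (k * x) - e2pi (k * y) = e2pi (k * y) * (e2pi (k * (x - y)) - 1).
  by rewrite mulrBr mulr1 -e2piD mulrBr [k * y + _]addrC subrK.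
rewrite nmcM nm_e2pi mul1r; apply: dP; rewrite normrM.
move: xy; rewrite ltr_pdivlMr //; apply: le_lt_trans.
by rewrite mulrC ler_wpM2l // lerDl.
Qed.

(** This is [cos^2 (pi t)]. Its powers replace the usual Fejer kernels: one more factor mixes just
    three neighbouring frequencies, which suits an induction. *)
Definition fejer_base (t : R) : R := (1 + cos (2 * pi * t)) / 2.

Lemma fejer_base_e2pi t : ((fejer_base t)%:C)%C =
  (4^-1%:C)%C * (2 + e2pi t + e2pi (- t)) :> R[i].
Proof.
rewrite /fejer_base /e2pi mulrN cosN sinN.
have -> : (2 : R[i]) = (2%:C)%C by rewrite rmorph_nat.
apply/eqP; rewrite eq_complex /=; apply/andP; split; apply/eqP; by field.
Qed.

Lemma ucb_fejer_base : ucb (fun t => ((fejer_base t)%:C)%C).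
Proof.
split=> [t|e e0].
  rewrite nm_real /fejer_base; have := cos_le1 (2 * pi * t).
  by have := cos_geN1 (2 * pi * t); rewrite ler_norml; move=> ? ?; apply/andP; split; lra.
have [_ /(_ _ e0)[d d0 dP]] := ucb_e2pi 1.
exists d => // x y xy; rewrite !fejer_base_e2pi -mulrBr nmcM nm_real.
have -> : 2 + e2pi x + e2pi (- x) - (2 + e2pi y + e2pi (- y)) =
    (e2pi (1 * x) - e2pi (1 * y)) + conjc (e2pi (1 * x) - e2pi (1 * y)).
  by rewrite !mul1r !e2piN rmorphB /=; ring.
have := nmD (e2pi (1 * x) - e2pi (1 * y)) (conjc (e2pi (1 * x) - e2pi (1 * y))).
have := dP x y xy; rewrite nm_cJ ger0_norm ?invr_ge0 //; lra.
Qed.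

Lemma fejer_base_ge0 t : 0 <= fejer_base t.
Proof. by rewrite /fejer_base; have := cos_geN1 (2 * pi * t); lra. Qed.

Let pi0 : 0 < pi :> R. Proof. exact: pi_gt0. Qed.

Lemma fejer_base_decr (s t : R) : 0 <= s -> s <= t -> t <= 2^-1 ->
  fejer_base t <= fejer_base s.
Proof.
move=> s0 st t2; rewrite /fejer_base ler_pM2r ?invr_gt0 // lerD2l.
have p0 := pi0; have h1 := ler_wpM2l (ltW p0) t2.
have h2 := ler_wpM2l (ltW p0) st; have h3 : 0 <= pi * s by rewrite mulr_ge0 // ltW.
rewrite leNgt ltr_cos ?in_itv /=; [rewrite -leNgt|apply/andP; split|apply/andP; split]; lra.
Qed.

Lemma fejer_base_sym t : fejer_base (1 - t) = fejer_base t.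
Proof.
rewrite /fejer_base; congr ((_ + _) / _); rewrite mulrBr mulr1 mulr_natl addrC.
by rewrite cosD2pi cosN.
Qed.

Lemma fejer_base_half (d : R) : 0 < d -> d <= 2^-1 ->
  fejer_base d < fejer_base (d / 2).
Proof.
move=> d0 d2; rewrite /fejer_base ltr_pM2r ?invr_gt0 // ltrD2l.
have p0 := pi0; have pd : 0 < pi * d by rewrite mulr_gt0.
have := ler_wpM2l (ltW p0) d2 => h.
rewrite ltr_cos ?in_itv /=; try by apply/andP; split; lra.
by lra.
Qed.

End UnifContScalars.

(** Norm-closed subspaces as predicates. Density of a set is then the statement that every closed
    subspace containing it is everything, and no closure of a span has to be formed. *)
Definition submodule_closed (R : realType) (V : normedModType R[i]) (D : V -> Prop) :=
  [/\ D 0, forall c x y, D x -> D y -> D (c *: x + y) &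
      forall x, (forall e : R, 0 < e -> exists2 y, D y & nm (x - y) < e) -> D x].

Section Fejer.
Variables (R : realType) (V : completeNormedModType R[i]) (U : R -> V -> V).
Hypotheses (U_lin : forall t, linear (U t)) (U_contr : forall t x, nm (U t x) <= nm x).
Hypothesis UD : forall s t x, U (s + t) x = U s (U t x).
Hypothesis U1 : forall x, U 1 x = x.
Hypothesis U_cont : forall x (e : R), 0 < e ->
  exists2 d : R, 0 < d & forall t, `|t| < d -> nm (U t x - x) < e.

Let U_B t x y : U t (x - y) = U t x - U t y.
Proof. by rewrite addrC -scaleN1r U_lin scaleN1r addrC. Qed.

Lemma unif_cont_orbit a : unif_cont (fun t => U t a).
Proof.
move=> e e0; have [d d0 dP] := U_cont a e0; exists d => // x y xy.
have -> : U x a - U y a = U y (U (x - y) a - a) by rewrite U_B -UD [y + _]addrC subrK.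
by apply: le_lt_trans (U_contr _ _) _; exact: dP.
Qed.

Lemma unif_cont_ucb_orbit c a : ucb c -> unif_cont (fun t => c t *: U t a).
Proof.
move=> [c1 cu] e e0; have a0 : 0 < nm a + 1 by rewrite ltr_wpDl ?nm_ge0.
have [d d0 dP] := cu (e / 2 / (nm a + 1)) ltac:(by rewrite !divr_gt0).
have e2 : 0 < e / 2 by rewrite divr_gt0.
have [d' d'0 dP'] := unif_cont_orbit a e2.
exists (Num.min d d') => [|x y]; first by rewrite lt_min d0.
rewrite lt_min => /andP[/dP h1 /dP' h2].
have -> : c x *: U x a - c y *: U y a = c x *: (U x a - U y a) + (c x - c y) *: U y a.
  by rewrite scalerBr scalerBl addrA subrK.
apply: le_lt_trans (nmD _ _) _; rewrite !nmZ.
have h3 := ler_wpM2r (nm_ge0 (U x a - U y a)) (c1 x).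
have h4 := ler_wpM2l (nm_ge0 (c x - c y)) (U_contr y a).
have h5 := ler_wpM2r (nm_ge0 a) (ltW h1).
suff : e / 2 / (nm a + 1) * nm a <= e / 2 by lra.
by rewrite mulrAC ler_pdivrMr // ler_pM2l ?divr_gt0 // lerDl.
Qed.

(** A relation, because the existence of the mean is a separate fact. With this sign the coefficient
    has the eigenvalue [e2pi (- k s)] under [U s]. *)
Definition fourier_coef (k : int) (a l : V) :=
  is_mean (fun t => e2pi (k%:~R * t) *: U t a) l.

(** Under the mean, [U s] amounts to a shift of the variable by [s], up to a phase, and the mean is
    shift invariant. *)
Lemma fourier_coef_eigen k a l s : fourier_coef k a l ->
  U s l = e2pi (- (k%:~R * s)) *: l.
Proof.
move=> kl; have p1 := mean_map (U_lin s) (U_contr s) kl.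
have ZU t c x : U t (c *: x) = c *: U t x.
  have := U_lin t c x 0; rewrite !addr0 => ->.
  by have := U_B t 0 0; rewrite !subrr => ->; rewrite addr0.
have p2 : is_mean (fun x => e2pi (k%:~R * (x + s)) *: U (x + s) a) l.
  apply: (@mean_shift _ _ (fun t => e2pi (k%:~R * t) *: U t a)) => // [|x].
    by apply: unif_cont_ucb_orbit; exact: ucb_e2pi.
  by rewrite mulrDr mulr1 e2piDint ?intr_int // addrC UD U1.
have := mean_lin (e2pi (- (k%:~R * s))) p2 (@mean0 _ _); rewrite addr0.
move=> p3; apply: mean_unique p1 _; apply: mean_ext p3 => t /=.
by rewrite addr0 scalerA -e2piD mulrDr addrC addrK addrC UD ZU.
Qed.

Variables (D : V -> Prop) (a : V).
Hypothesis D_closed : submodule_closed D.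
Hypothesis D_coef : forall k l, fourier_coef k a l -> D l.

(** One factor [fejer_base] turns the mean at frequency [k] into a combination of the means at [k],
    [k + 1] and [k - 1] with one factor less. *)
Lemma fejer_coef N k l :
  is_mean (fun t => (((fejer_base t)%:C)%C ^+ N * e2pi (k%:~R * t)) *: U t a) l -> D l.
Proof.
elim: N => [|N IH] in k l *.
  by move=> h; apply: (@D_coef k); apply: mean_ext h => t; rewrite expr0 mul1r.
have [D0 Dlin _] := D_closed.
have ex j : exists l, is_mean (fun t =>
    (((fejer_base t)%:C)%C ^+ N * e2pi (j%:~R * t)) *: U t a) l.
  apply: mean_exists; apply: unif_cont_ucb_orbit; apply: ucbM; last exact: ucb_e2pi.
  exact/ucbX/ucb_fejer_base.
have [l0 h0] := ex k; have [l1 h1] := ex (k + 1); have [l2 h2] := ex (k - 1).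
pose c : R[i] := ((4^-1 : R)%:C)%C.
have p := mean_lin (c * 2) h0 (mean_lin c h1 (mean_lin c h2 (@mean0 _ _))).
move=> h; suff -> : l = c * 2 *: l0 + (c *: l1 + (c *: l2 + 0)).
  apply: (Dlin _ _ _ (IH _ _ h0)); apply: (Dlin _ _ _ (IH _ _ h1)).
  exact: (Dlin _ _ _ (IH _ _ h2)).
apply: mean_unique h _; apply: mean_ext p => t.
rewrite addr0 !scalerA -!scalerDl; congr (_ *: _).
rewrite exprS fejer_base_e2pi -/c !rmorphD rmorphN /= !mulrDl mulNr !mul1r !e2piD.
by ring.
Qed.

(* The powers of [fejer_base] concentrate at [0] modulo [1]: the [N]-th one is at
   least [p ^+ N] on [[0, d / 2]] and at most [q ^+ N] on [[d, 1 - d]]. *)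
Lemma fejer : D a.
Proof.
have [D0 Dlin Dcl] := D_closed; apply: Dcl => e e0.
have e4 : 0 < e / 4 by rewrite divr_gt0.
have [d' d'0 dP'] := U_cont a e4.
pose d := Num.min d' 2^-1; have d0 : 0 < d by rewrite lt_min d'0 invr_gt0 ltr0n.
have d2 : d <= 2^-1 by rewrite ge_min lexx orbT.
have dP t : `|t| < d -> nm (U t a - a) < e / 4.
  by move=> td; apply: dP'; apply: lt_le_trans td _; rewrite ge_min lexx.
pose v := @fejer_base R; pose p := v (d / 2); pose q := v d.
have qp : q < p by exact: fejer_base_half.
have q0 : 0 <= q by exact: fejer_base_ge0.
have p0 : 0 < p by apply: le_lt_trans qp.
have [N hN] : exists N : nat, 2 * nm a * q ^+ N <= e / 4 * (d / 2 * p ^+ N).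
  have [qz|qn0] := eqVneq q 0.
    exists 1%N; rewrite qz !expr1 mulr0.
    by rewrite mulr_ge0 ?(ltW e4) ?mulr_ge0 ?(ltW p0) ?divr_ge0 ?(ltW d0).
  have q1 : 0 < q by rewrite lt_def qn0.
  have pq1 : 1 < p / q by rewrite ltr_pdivlMr // mul1r.
  have [N hN] := exp_unbounded (2 * nm a / (e / 4 * (d / 2))) pq1.
  exists N; move: hN; rewrite ltr_pdivrMr ?mulr_gt0 ?invr_gt0 // expr_div_n mulrAC.
  by rewrite ltr_pdivlMr ?exprn_gt0 // => /ltW /le_trans; apply; rewrite [leLHS]mulrC -!mulrA.
pose c0 := d / 2 * p ^+ N; have c00 : 0 < c0 by rewrite mulr_gt0 ?divr_gt0 ?exprn_gt0.
have ucN : ucb (fun t => ((v t)%:C)%C ^+ N) by exact/ucbX/ucb_fejer_base.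
have [l lP] := mean_exists (unif_cont_ucb_orbit a ucN).
have Dl : D l.
  apply: (@fejer_coef N 0); apply: mean_ext lP => t.
  by rewrite mul0r e2pi0 mulr1.
have [M0 hM0] := lP (e / 4 * c0) ltac:(by rewrite mulr_gt0).
pose M := M0.+1; have := hM0 M (leqnSn _).
set b := ravg _ _ => bl.
have M1 : (0 : R) < M%:R by rewrite ltr0n.
(* The kernel is not normalised: [l] is close to [c *: a], and the approximation of [a] is
   [c^-1 *: l]. This is why the tolerances carry a factor [c0 <= c]. *)
pose c : R := M%:R^-1 * \sum_(0 <= j < M) v (j%:R / M%:R) ^+ N.
have v0 t : 0 <= v t ^+ N by rewrite exprn_ge0 // fejer_base_ge0.
have c_ge : c0 <= c.
  (* The grid points [j / M] with [j < K] lie in [[0, d / 2]], and [K >= M * (d / 2)]. *)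
  pose K := (Num.truncn (M%:R * (d / 2))).+1.
  have d20 : 0 <= M%:R * (d / 2) by rewrite mulr_ge0 ?ler0n // divr_ge0 ?ltW.
  have /andP[K1 K2] := truncn_itv d20.
  have KM : (K <= M)%N.
    rewrite -ltnS ltnS /K -(ltr_nat R); apply: le_lt_trans K1 _.
    by rewrite gtr_pMr //; lra.
  rewrite /c mulrC ler_pdivlMr // (big_cat_nat (n := K)) //=.
  apply: ler_wpDr; first by apply: sumr_ge0.
  apply: (@le_trans _ _ (\sum_(0 <= j < K) p ^+ N)).
    have pN0 : 0 < p ^+ N by rewrite exprn_gt0.
    have := ler_wpM2r (ltW pN0) (ltW K2); rewrite -/K.
    rewrite sumr_const_nat subn0 -(mulr_natr (p ^+ N) K) /c0.
    by lra.
  apply: ler_sum_nat => j /= jK.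
  apply: lerXn2r; rewrite ?nnegrE ?(ltW p0) ?fejer_base_ge0 //.
  have jd : j%:R / M%:R <= d / 2.
    rewrite ler_pdivrMr // mulrC; apply: le_trans K1; rewrite ler_nat.
    by rewrite -ltnS.
  apply: fejer_base_decr => //.
  by apply: le_trans d2; lra.
have c1 : 0 < c by apply: lt_le_trans c_ge.
(* Near 0, and by periodicity near 1, the orbit is close to [a] and gives the first term. In between
   the kernel is at most [q ^ N] and gives the second one. *)
have dev t : 0 <= t -> t < 1 ->
    v t ^+ N * nm (U t a - a) <= e / 4 * v t ^+ N + 2 * nm a * q ^+ N.
  move=> t0 t1.
  have r0 : 0 <= 2 * nm a * q ^+ N by rewrite !mulr_ge0 ?nm_ge0 // exprn_ge0.
  have near : nm (U t a - a) < e / 4 ->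
      v t ^+ N * nm (U t a - a) <= e / 4 * v t ^+ N + 2 * nm a * q ^+ N.
    by move=> /ltW /(ler_wpM2l (v0 t)); rewrite [v t ^+ N * (e / 4)]mulrC; lra.
  have [td|dt] := ltP t d; first by apply: near; apply: dP; rewrite ger0_norm.
  have [td|dt'] := ltP (1 - d) t.
    apply: near; rewrite -[t](subrK 1) UD U1; apply: dP.
    by rewrite distrC ger0_norm; lra.
  have vq : v t <= q.
    have [t2|t2] := leP t 2^-1; first by apply: fejer_base_decr => //; exact: ltW.
    by rewrite /v -fejer_base_sym; apply: fejer_base_decr; lra.
  have h1 : v t ^+ N <= q ^+ N by apply: lerXn2r; rewrite ?nnegrE ?fejer_base_ge0.
  have h2 : nm (U t a - a) <= 2 * nm a.
    by have := nmB (U t a) a; have := U_contr t a; lra.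
  have h3 := ler_pM (v0 t) (nm_ge0 _) h1 h2.
  have : 0 <= e / 4 * v t ^+ N by rewrite mulr_ge0 // ltW.
  by rewrite [2 * nm a * _]mulrC; lra.
have bca : nm (b - (c%:C)%C *: a) <= e / 2 * c.
  have -> : (c%:C)%C *: a = ((M%:R^-1 : R)%:C)%C *:
      \sum_(0 <= j < M) (((v (j%:R / M%:R) ^+ N)%:C)%C *: a).
    by rewrite -scaler_suml scalerA /c rmorphM rmorph_sum.
  rewrite /b /ravg -scalerBr nmZ nm_invn /rsum -sumrB mulrC ler_pdivrMr //.
  apply: le_trans (nm_sum _ _ _) _.
  apply: (@le_trans _ _ (\sum_(0 <= j < M) (e / 4 * v (j%:R / M%:R) ^+ N + 2 * nm a * q ^+ N))).
    rewrite big_nat_cond [leRHS]big_nat_cond; apply: ler_sum => j /andP[/andP[_ jM] _].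
    rewrite add0r -rmorphXn /= -scalerBr nmZ nm_real ger0_norm // dev //.
    by rewrite ltr_pdivrMr // mul1r ltr_nat.
  rewrite big_split /= -mulr_sumr sumr_const_nat subn0 -(mulr_natr (2 * nm a * q ^+ N) M).
  have -> : \sum_(0 <= j < M) v (j%:R / M%:R) ^+ N = c * M%:R.
    by rewrite /c mulrC mulrA mulfV ?mul1r // gt_eqF.
  rewrite (mulrA (e / 4)) -mulrDl ler_pM2r //.
  have := ler_wpM2l (ltW e4) c_ge; move: hN; rewrite -/c0; lra.
exists ((c^-1%:C)%C *: l); first by have := Dlin (c^-1%:C)%C l 0 Dl D0; rewrite addr0.
have -> : a - (c^-1%:C)%C *: l = (c^-1%:C)%C *: ((c%:C)%C *: a - l).
  by rewrite scalerBr scalerA -rmorphM /= mulVf ?gt_eqF // scale1r.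
rewrite nmZ nm_real gtr0_norm ?invr_gt0 // mulrC ltr_pdivrMr //.
have := nm_dist_trans b ((c%:C)%C *: a) l; rewrite (nm_distC ((c%:C)%C *: a) b).
have := ler_wpM2l (ltW e4) c_ge; have : 0 < e * c by rewrite mulr_gt0.
by lra.
Qed.

End Fejer.

(** * Joint eigenvectors of a periodic action of R^n *)

Definition dotv (R : realType) (n : nat) (x y : 'cV[R]_n) : R := \sum_i x i 0 * y i 0.

Section RnAction.
Variables (R : realType) (n : nat) (A : cstarAlgType R) (beta : dynsys A (Rn R n)).
Implicit Types a : A.

Lemma actRn_morphism (s : 'cV[R]_n) : star_morphism (beta s).
Proof. by have [] := dyn_automorphism beta s. Qed.

Lemma actRnD (s t : 'cV[R]_n) a : beta (s + t) a = beta s (beta t a).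
Proof. exact: (dyn_actM beta). Qed.

Lemma actRn0 a : beta (0 : 'cV[R]_n) a = a.
Proof. exact: (dyn_act1 beta). Qed.

Lemma actRn_contr (s : 'cV[R]_n) a : nm (beta s a) <= nm a.
Proof. exact/sm_contractive/actRn_morphism. Qed.

Lemma actRn_cont (v : 'cV[R]_n) a (e : R) : 0 < e ->
  exists2 d : R, 0 < d & forall t : R, `|t| < d -> nm (beta (t *: v) a - a) < e.
Proof.
move=> e0; have := @dyn_continuous _ _ _ beta ((0 : 'cV[R]_n) : Rn R n, a).
move=> /nm_cvgP /(_ e e0) [[P Q] /= [P0 Qa] PQ].
have : (fun t : R => t *: v) @ (0 : R) --> (0 : R) *: v.
  by apply: cvgZr_tmp; exact: cvg_id.
rewrite scale0r => /(_ P P0) /nbhs_normP[d /= d0 dP].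
exists d => // t td; rewrite -{2}(actRn0 a).
apply: (PQ (t *: v, a)); split => /=; last exact: nbhs_singleton.
by apply: dP; rewrite /ball_ /= sub0r normrN.
Qed.

Lemma actRn_sum (I : Type) (r : seq I) (F : I -> 'cV[R]_n) (c : I -> R) a :
  (forall i, beta (F i) a = e2pi (c i) *: a) ->
  beta (\sum_(i <- r) F i) a = e2pi (\sum_(i <- r) c i) *: a.
Proof.
move=> h; elim: r => [|i r IH]; first by rewrite !big_nil actRn0 e2pi0 scale1r.
by rewrite !big_cons actRnD IH (sm_Z (actRn_morphism _)) h scalerA e2piD mulrC.
Qed.

Definition eigenvec (chi : 'cV[R]_n) a := forall s : 'cV[R]_n, beta s a = e2pi (dotv chi s) *: a.

Definition basis_vec (i : 'I_n) : 'cV[R]_n := delta_mx i 0.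

Variables (q : R) (D : A -> Prop).
Hypotheses (q0 : 0 < q) (q_period : forall i a, beta (q *: basis_vec i) a = a).
Hypothesis D_closed : submodule_closed D.
Hypothesis D_eigen : forall chi a, eigenvec chi a -> D a.

Let partial_eigen (k : nat) a := forall j : 'I_n, (j < k)%N ->
  exists c : R, forall t : R, beta (t *: basis_vec j) a = e2pi (c * t) *: a.

(** Induction on the number [k] of coordinates still to be diagonalised. By [fejer] it suffices to
    treat the Fourier coefficients in the next coordinate; they stay eigenvectors for the earlier
    coordinates because the action is commutative. *)
Let partial_eigen_D k a : (k <= n)%N -> partial_eigen (n - k) a -> D a.
Proof.
elim: k a => [|k IH] a kn.
  rewrite subn0 => pe.
  have [c cP] := choice (fun j => pe j (ltn_ord j)).
  apply: (@D_eigen (\col_j c j)) => s.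
  have sE : s = \sum_j s j 0 *: basis_vec j.
    by rewrite [LHS]matrix_sum_delta; apply: eq_bigr => j _; rewrite big_ord1.
  rewrite {1}sE; rewrite (actRn_sum _ (c := fun j => c j * s j 0)) // /dotv.
  by congr (e2pi _ *: _); apply: eq_bigr => j _; rewrite mxE.
move=> pe; have kn' : (n - k.+1 < n)%N by rewrite ltn_subrL /= (leq_ltn_trans _ kn).
pose i : 'I_n := Ordinal kn'.
(* Rescaled by [q] to have period 1. *)
pose U (t : R) : A -> A := beta ((t * q) *: basis_vec i).
have U_lin t : linear (U t) by apply: star_morphism_linear; exact: actRn_morphism.
have U_c t x : nm (U t x) <= nm x by exact: actRn_contr.
have U_D s t x : U (s + t) x = U s (U t x) by rewrite /U mulrDl scalerDl actRnD.
have U_1 x : U 1 x = x by rewrite /U mul1r q_period.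
have U_cont x (e : R) : 0 < e ->
    exists2 d : R, 0 < d & forall t, `|t| < d -> nm (U t x - x) < e.
  move=> e0; have [d d0 dP] := actRn_cont (q *: basis_vec i) x e0.
  by exists d => // t /dP; rewrite scalerA.
apply: (fejer U_lin U_c U_D U_1 U_cont D_closed) => m l ml.
apply: (IH _ (ltnW kn)) => j; rewrite -(subnSK kn) ltnS leq_eqVlt => /orP[/eqP ji|ji].
  have -> : j = i by exact/val_inj.
  exists (- m%:~R / q) => t.
  have := fourier_coef_eigen U_lin U_c U_D U_1 U_cont (t / q) ml.
  rewrite /U divfK ?gt_eqF // => ->; congr (e2pi _ *: _).
  by rewrite mulrA mulrAC mulNr mulNr.
have [c cP] := pe j ji; exists c => t.
have p1 := mean_map (star_morphism_linear (actRn_morphism (t *: basis_vec j)))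
  (actRn_contr _) ml.
apply: mean_unique p1 _; rewrite -[_ *: l]addr0.
apply: mean_ext (mean_lin (e2pi (c * t)) ml (@mean0 _ _)) => x /=.
rewrite addr0 (sm_Z (actRn_morphism _)) /U -actRnD addrC actRnD cP.
by rewrite (sm_Z (actRn_morphism _)) !scalerA mulrC.
Qed.

Lemma eigenvec_dense a : D a.
Proof. by apply: (@partial_eigen_D n) => // j; rewrite subnn. Qed.

End RnAction.

(** * Monomials and polynomials in q-commuting unitaries *)

HB.instance Definition _ (R : realType) (A : cstarAlgType R) :=
  Monoid.isLaw.Build A cone (@cmul R A) (@cmulA R A) (@cmul1x R A) (@cmulx1 R A).

Section QComm.
Variables (R : realType) (A : cstarAlgType R).
Implicit Types (x y u : A) (c d : R).

Definition qcomm c x y := x ** y = e2pi c *: (y ** x).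

Lemma e2piNK c : e2pi (- c) * e2pi c = 1.
Proof. by rewrite e2piN conjc_e2pi. Qed.

Lemma qcomm1 y : qcomm 0 cone y.
Proof. by rewrite /qcomm cmul1x cmulx1 e2pi0 scale1r. Qed.

Lemma qcommM c d x x' y : qcomm c x y -> qcomm d x' y -> qcomm (c + d) (x ** x') y.
Proof.
by move=> xy xy'; rewrite /qcomm -cmulA xy' -cscaleAr cmulA xy -cscaleAl scalerA
  e2piD mulrC cmulA.
Qed.

Lemma qcomm_sym c x y : qcomm c x y -> qcomm (- c) y x.
Proof. by rewrite /qcomm => ->; rewrite scalerA e2piNK scale1r. Qed.

Lemma qcomm_star c x y : unitary x -> qcomm c x y -> qcomm (- c) (star x) y.
Proof.
move=> [x1 x2] xy; rewrite /qcomm.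
suff -> : y ** star x = e2pi c *: (star x ** y) by rewrite scalerA e2piNK scale1r.
rewrite -[y in LHS]cmul1x -x1 -!cmulA (cmulA x y) xy -cscaleAl -cscaleAr.
by rewrite -(cmulA y) x2 cmulx1.
Qed.

Definition upow x (m : int) : A :=
  match m with Posz p => cpow x p | Negz p => cpow (star x) p.+1 end.

Lemma upow_unitary u m : unitary u -> unitary (upow u m).
Proof.
by move=> uu; case: m => p; apply: unitary_cpow => //; exact: unitary_star.
Qed.

Lemma upowS u m : unitary u -> upow u (m + 1) = upow u m ** u.
Proof.
move=> [u1 u2]; case: m => [p|[|p]].
- by rewrite -PoszD addn1 /= (cpow_comm p (erefl _)).
- by rewrite /= cmulx1 u1.
have -> : Negz p.+1 + 1 = Negz p by rewrite !NegzE -[p.+2]addn1 PoszD opprD addrNK.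
rewrite /upow -[p.+2]addn1 cpowD -cmulA; have -> : cpow (star u) 1 = star u.
  by rewrite /= cmulx1.
by rewrite u1 cmulx1.
Qed.

Lemma qcomm_cpow c x y p : qcomm c x y -> qcomm (p%:R * c) (cpow x p) y.
Proof.
move=> xy; elim: p => [|p IH]; first by rewrite mul0r; exact: qcomm1.
by rewrite -natr1 mulrDl mul1r addrC; exact: qcommM.
Qed.

Lemma qcomm_upow c u y m : unitary u -> qcomm c u y -> qcomm (m%:~R * c) (upow u m) y.
Proof.
move=> uu uy; case: m => p; first exact: qcomm_cpow.
by rewrite NegzE mulrNz mulNr -mulrN; apply: qcomm_cpow; exact: qcomm_star.
Qed.

Lemma qcomm_prod (I : Type) (r : seq I) (c : I -> R) (F : I -> A) y :
  (forall i, qcomm (c i) (F i) y) ->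
  qcomm (\sum_(i <- r) c i) (\big[cmul/cone]_(i <- r) F i) y.
Proof.
move=> h; elim: r => [|i r IH]; first by rewrite !big_nil; exact: qcomm1.
by rewrite !big_cons; exact: qcommM.
Qed.

Lemma unitary_prod (I : Type) (r : seq I) (F : I -> A) :
  (forall i, unitary (F i)) -> unitary (\big[cmul/cone]_(i <- r) F i).
Proof.
move=> h; elim: r => [|i r IH]; first by rewrite big_nil; exact: unitary1.
by rewrite big_cons; exact: unitaryM.
Qed.

End QComm.

Section Monomials.
Variables (R : realType) (n : nat).
Implicit Types k l : 'cV[int]_n.

Definition int_dot k (s : 'cV[R]_n) : R := \sum_i (k i 0)%:~R * s i 0.

Definition mono (A : cstarAlgType R) (u : 'I_n -> A) k : A :=
  \big[cmul/cone]_(i < n) upow (u i) (k i 0).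

Lemma mono0 (A : cstarAlgType R) (u : 'I_n -> A) : mono u 0 = cone.
Proof. by rewrite /mono big1 // => i _; rewrite mxE. Qed.

Lemma mono_delta (A : cstarAlgType R) (u : 'I_n -> A) (j : 'I_n) :
  mono u (delta_mx j 0) = u j.
Proof.
have E (r : seq 'I_n) : uniq r ->
  \big[cmul/cone]_(i <- r) upow (u i) ((delta_mx j 0 : 'cV[int]_n) i 0)
   = if j \in r then u j else cone.
  elim: r => [|i r IH] /=; first by rewrite big_nil.
  move=> /andP[ir ur]; rewrite big_cons IH // inE mxE eqxx andbT eq_sym.
  case: eqVneq => [->|ij] /=; first by rewrite (negPf ir) !cmulx1.
  by rewrite cmul1x.
by rewrite /mono E ?index_enum_uniq // mem_index_enum.
Qed.

Lemma mono_morph (A B : cstarAlgType R) (f : A -> B) (u : 'I_n -> A) k :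
  star_morphism f -> f (mono u k) = mono (f \o u) k.
Proof.
move=> fM; have fP x p : f (cpow x p) = cpow (f x) p.
  by elim: p => [|p IH] /=; rewrite ?(sm_1 fM) // (sm_M fM) IH.
rewrite /mono; elim/big_rec2: _ => [|i a b _ <-]; first by rewrite (sm_1 fM).
by rewrite (sm_M fM) /upow; case: (k i 0) => p; rewrite fP ?(sm_star fM).
Qed.

Lemma mono_scale (A : cstarAlgType R) (u : 'I_n -> A) (s : 'cV[R]_n) k :
  mono (fun i => e2pi (s i 0) *: u i) k = e2pi (int_dot k s) *: mono u k.
Proof.
have cE (c : R) (x : A) p : cpow (e2pi c *: x) p = e2pi (p%:R * c) *: cpow x p.
  elim: p => [|p IH] /=; first by rewrite mul0r e2pi0 scale1r.
  by rewrite IH -cscaleAl -cscaleAr scalerA -e2piD -natr1 mulrDl mul1r addrC.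
rewrite /mono /int_dot.
elim: (index_enum 'I_n) => [|i r IH]; first by rewrite !big_nil e2pi0 scale1r.
rewrite !big_cons IH.
have -> : upow (e2pi (s i 0) *: u i) (k i 0) =
    e2pi ((k i 0)%:~R * s i 0) *: upow (u i) (k i 0).
  case: (k i 0) => p; first exact: cE.
  by rewrite /upow starZ -e2piN cE NegzE mulrNz mulNr mulrN.
by rewrite -cscaleAl -cscaleAr scalerA e2piD.
Qed.

Variable theta : 'M[R]_n.

Lemma mono_unitary (A : cstarAlgType R) (u : 'I_n -> A) k :
  qtorus_rel theta u -> unitary (mono u k).
Proof. by move=> [uU _]; apply: unitary_prod => i; exact: upow_unitary. Qed.

Lemma mono_comm (A : cstarAlgType R) (u : 'I_n -> A) k l :
  qtorus_rel theta u ->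
  qcomm (\sum_i \sum_j (k i 0)%:~R * theta i j * (l j 0)%:~R) (mono u k) (mono u l).
Proof.
move=> [uU uC]; apply: qcomm_prod => i.
under eq_bigr do rewrite -mulrA.
rewrite -mulr_sumr; apply: qcomm_upow => //.
rewrite -[X in qcomm X]opprK; apply: qcomm_sym; rewrite -sumrN; apply: qcomm_prod => j.
by rewrite mulrC -mulrN; apply: qcomm_upow => //; apply: qcomm_sym; exact: uC.
Qed.

(* The scalars below depend on [theta] and the exponents only, not on the
   algebra, which is what the order of the quantifiers says. *)
Lemma mono_mul_gen k (i : 'I_n) : exists c : R,
  forall (A : cstarAlgType R) (u : 'I_n -> A), qtorus_rel theta u ->
  mono u k ** u i = e2pi c *: mono u (k + delta_mx i 0).
Proof.
suff h (r : seq 'I_n) : uniq r -> i \in r -> exists c : R,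
    forall (A : cstarAlgType R) (u : 'I_n -> A), qtorus_rel theta u ->
    (\big[cmul/cone]_(j <- r) upow (u j) (k j 0)) ** u i =
    e2pi c *: \big[cmul/cone]_(j <- r) upow (u j) ((k + delta_mx i 0) j 0).
  by apply: h; rewrite ?index_enum_uniq ?mem_index_enum.
elim: r => // j r IH /= /andP[jr ur]; rewrite inE.
case: (eqVneq i j) => [ij _|ij /= ir].
  subst j.
  exists (\sum_(j <- r) (k j 0)%:~R * theta j i) => A u [uU uC].
  rewrite !big_cons -cmulA (@qcomm_prod _ _ _ r (fun j => (k j 0)%:~R * theta j i)).
    rewrite -cscaleAr cmulA -upowS //; congr (_ *: (_ ** _)).
      by rewrite !mxE !eqxx.
    apply: eq_big_seq => l lr; rewrite !mxE andbT.
    by case: eqVneq lr => [-> ir|_ _]; [rewrite ir in jr|rewrite addr0].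
  by move=> l; apply: qcomm_upow.
have [c cP] := IH ur ir; exists c => A u uR.
rewrite !big_cons -cmulA cP // -cscaleAr; congr (_ *: (upow _ _ ** _)).
by rewrite !mxE andbT eq_sym (negPf ij) addr0.
Qed.

Lemma mono_mul_genV k (i : 'I_n) : exists c : R,
  forall (A : cstarAlgType R) (u : 'I_n -> A), qtorus_rel theta u ->
  mono u k ** star (u i) = e2pi c *: mono u (k - delta_mx i 0).
Proof.
have [c cP] := mono_mul_gen (k - delta_mx i 0) i.
exists (- c) => A u uR; have := cP A u uR; rewrite subrK => h.
have -> : mono u k = e2pi (- c) *: (mono u (k - delta_mx i 0) ** u i).
  by rewrite h scalerA e2piNK scale1r.
by have [uU _] := uR; have [_ u2] := uU i; rewrite -cscaleAl -cmulA u2 cmulx1.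
Qed.

Lemma mono_mul k l : exists c : R,
  forall (A : cstarAlgType R) (u : 'I_n -> A), qtorus_rel theta u ->
  mono u k ** mono u l = e2pi c *: mono u (k + l).
Proof.
have posS (p : nat) : p.+1%:Z = p%:Z + 1 by rewrite -PoszD addn1.
have up k' (i : 'I_n) m : exists c : R,
    forall (A : cstarAlgType R) (u : 'I_n -> A), qtorus_rel theta u ->
    mono u k' ** upow (u i) m = e2pi c *: mono u (k' + m *: delta_mx i 0).
  have pos : forall p, exists c : R,
    forall (A : cstarAlgType R) (u : 'I_n -> A), qtorus_rel theta u ->
    mono u k' ** cpow (u i) p = e2pi c *: mono u (k' + p%:Z *: delta_mx i 0).
    elim=> [|p [c cP]].
      by exists 0 => A u _; rewrite /= cmulx1 scale0r addr0 e2pi0 scale1r.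
    have [d dP] := mono_mul_gen (k' + p%:Z *: delta_mx i 0) i.
    exists (c + d) => A u uR; rewrite /= -(cpow_comm p (erefl _)) cmulA cP //.
    by rewrite -cscaleAl dP // scalerA -e2piD posS scalerDl scale1r addrA.
  have neg : forall p, exists c : R,
    forall (A : cstarAlgType R) (u : 'I_n -> A), qtorus_rel theta u ->
    mono u k' ** cpow (star (u i)) p = e2pi c *: mono u (k' - p%:Z *: delta_mx i 0).
    elim=> [|p [c cP]].
      by exists 0 => A u _; rewrite /= cmulx1 scale0r subr0 e2pi0 scale1r.
    have [d dP] := mono_mul_genV (k' - p%:Z *: delta_mx i 0) i.
    exists (c + d) => A u uR; rewrite /= -(cpow_comm p (erefl _)) cmulA cP //.
    by rewrite -cscaleAl dP // scalerA -e2piD posS scalerDl scale1r opprD addrA.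
  by case: m => p; [exact: pos|rewrite NegzE scaleNr; exact: neg].
suff h (r : seq 'I_n) : exists c : R,
    forall (A : cstarAlgType R) (u : 'I_n -> A), qtorus_rel theta u ->
    mono u k ** \big[cmul/cone]_(j <- r) upow (u j) (l j 0) =
    e2pi c *: mono u (k + \sum_(j <- r) l j 0 *: delta_mx j 0).
  have [c cP] := h (index_enum 'I_n); exists c => A u uR; rewrite cP //.
  congr (_ *: mono _ (_ + _)); rewrite [RHS]matrix_sum_delta.
  by apply: eq_bigr => j _; rewrite big_ord1.
elim/last_ind: r => [|r j [c cP]].
  by exists 0 => A u _; rewrite !big_nil cmulx1 addr0 e2pi0 scale1r.
have [d dP] := up (k + \sum_(j <- r) l j 0 *: delta_mx j 0) j (l j 0).
exists (c + d) => A u uR; rewrite -!cats1 !big_cat !big_seq1 /= cmulA cP //.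
by rewrite -cscaleAl dP // scalerA -e2piD addrA.
Qed.

Lemma mono_star k : exists c : R,
  forall (A : cstarAlgType R) (u : 'I_n -> A), qtorus_rel theta u ->
  star (mono u k) = e2pi c *: mono u (- k).
Proof.
have [c cP] := mono_mul (- k) k; exists (- c) => A u uR.
have := cP A u uR; rewrite addNr mono0 => h.
have [_ u2] := mono_unitary k uR.
have -> : mono u (- k) = e2pi c *: star (mono u k).
  by rewrite -[LHS]cmulx1 -u2 cmulA h -cscaleAl cmul1x.
by rewrite scalerA e2piNK scale1r.
Qed.

End Monomials.

(** Orthogonality of the characters of Z/m. The bound on [a] excludes its nonzero multiples of
    [m]. *)
Lemma sum_e2pi_roots (R : realType) (m : nat) (a : int) : (0 < m)%N -> (`|a| < m)%N ->
  \sum_(j < m) e2pi (a%:~R * (j%:R / m%:R) : R) = if a == 0 then m%:R else 0.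
Proof.
move=> m0 am; have m1 : (0 : R) < m%:R by rewrite ltr0n.
case: eqVneq => [->|a0].
  under eq_bigr do rewrite mulr0z mul0r e2pi0.
  by rewrite sumr_const card_ord.
pose z : R[i] := e2pi (a%:~R / m%:R).
have -> : \sum_(j < m) e2pi (a%:~R * (j%:R / m%:R) : R) = \sum_(j < m) z ^+ j.
  by apply: eq_bigr => j _; rewrite -e2pi_nat mulrA [_ * j%:R]mulrC -mulrA.
have zm : z ^+ m = 1.
  by rewrite -e2pi_nat mulrC mulfVK ?gt_eqF // e2pi_int // intr_int.
have z1 : z != 1.
  apply/eqP => /e2pi_eq1 /intrP[b ab].
  have {}ab : a = b * m%:Z.
    apply: (@intr_inj R); rewrite intrM -ab -pmulrn divfK // gt_eqF //.
  move: a0 am; rewrite ab abszM absz_nat mulf_eq0 negb_or => /andP[b0 _].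
  by rewrite ltnNge leq_pmull // absz_gt0.
have : (z - 1) * \sum_(j < m) z ^+ j = 0 by rewrite -subrX1 zm subrr.
by move/eqP; rewrite mulf_eq0 subr_eq0 (negPf z1) => /eqP.
Qed.

Section Polynomials.
Variables (R : realType) (n : nat) (theta : 'M[R]_n).
Variables (A : cstarAlgType R) (u : 'I_n -> A) (B : cstarAlgType R) (v : 'I_n -> B).
Hypotheses (uR : qtorus_rel theta u) (vR : qtorus_rel theta v).
Implicit Types (k : 'cV[int]_n) (x : A) (y : B).

Definition box_key (d : nat) (f : {ffun 'I_n -> 'I_(d.*2.+1)}) : 'cV[int]_n :=
  \col_i ((f i : nat)%:Z - d%:Z).

Definition in_box (d : nat) k := forall i, (`|k i 0%R| <= d)%N.

(* [qpol d x y]: [x] and [y] are the values at [u] and at [v] of one polynomial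
   with exponents in [-d, d]^n. *)
Definition qpol (d : nat) x y := exists c : {ffun 'I_n -> 'I_(d.*2.+1)} -> R[i],
  x = \sum_f c f *: mono u (box_key f) /\ y = \sum_f c f *: mono v (box_key f).

Lemma in_box_key d k : in_box d k -> exists f, k = @box_key d f.
Proof.
move=> kd; exists [ffun i => inord `|k i 0%R + d%:Z|]; apply/colP => i.
by rewrite !mxE ffunE inordK; have := kd i; lia.
Qed.

Lemma box_key_in d f : in_box d (@box_key d f).
Proof. by move=> i; rewrite !mxE; have := ltn_ord (f i); lia. Qed.

Lemma qpol_lin d (a : R[i]) x y x' y' : qpol d x y -> qpol d x' y' ->
  qpol d (a *: x + x') (a *: y + y').
Proof.
move=> [c [-> ->]] [c' [-> ->]]; exists (fun f => a * c f + c' f).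
by split; rewrite scaler_sumr -big_split; apply: eq_bigr => f _;
  rewrite scalerDl scalerA.
Qed.

Lemma qpol0 d : qpol d 0 0.
Proof. by exists (fun=> 0); split; rewrite big1 // => f _; rewrite scale0r. Qed.

Lemma qpolZ d (a : R[i]) x y : qpol d x y -> qpol d (a *: x) (a *: y).
Proof. by move=> /qpol_lin /(_ (qpol0 d)); move=> /(_ a); rewrite !addr0. Qed.

Lemma qpolD d x y x' y' : qpol d x y -> qpol d x' y' -> qpol d (x + x') (y + y').
Proof. by move=> h /(qpol_lin 1 h); rewrite !scale1r. Qed.

Lemma qpol_sum d (I : Type) (r : seq I) (F : I -> A) (G : I -> B) :
  (forall i, qpol d (F i) (G i)) -> qpol d (\sum_(i <- r) F i) (\sum_(i <- r) G i).
Proof.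
move=> h; elim: r => [|i r IH]; first by rewrite !big_nil; exact: qpol0.
by rewrite !big_cons; exact: qpolD.
Qed.

Lemma qpol_mono d k : in_box d k -> qpol d (mono u k) (mono v k).
Proof.
move=> /in_box_key[f ->]; exists (fun g => (g == f)%:R).
by split; rewrite (bigD1 f) //= eqxx scale1r big1 ?addr0 // => g /negPf ->;
  rewrite scale0r.
Qed.

Lemma qpolM d d' x y x' y' : qpol d x y -> qpol d' x' y' ->
  qpol (d + d') (x ** x') (y ** y').
Proof.
move=> [c [-> ->]] [c' [-> ->]]; rewrite !cmul_suml; apply: qpol_sum => f.
rewrite !cmul_sumr; apply: qpol_sum => g.
rewrite -!cscaleAl -!cscaleAr !scalerA.
have [w wP] := mono_mul theta (box_key f) (box_key g).
rewrite !wP // !scalerA; apply/qpolZ/qpol_mono => i; rewrite mxE.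
move: (box_key_in f i) (box_key_in g i).
by move: (box_key f i 0) (box_key g i 0) => /= p q; lia.
Qed.

Lemma qpol_star d x y : qpol d x y -> qpol d (star x) (star y).
Proof.
move=> [c [-> ->]]; rewrite !star_sum; apply: qpol_sum => f; rewrite !starZ.
have [w wP] := mono_star theta (box_key f).
rewrite !wP // !scalerA; apply/qpolZ/qpol_mono => i; rewrite mxE.
by rewrite abszN; exact: box_key_in.
Qed.

Lemma qpol_one d : qpol d cone cone.
Proof.
rewrite -(mono0 u) -(mono0 v); apply: qpol_mono => i.
by rewrite mxE.
Qed.

Lemma qpol_pow d x y p : qpol d x y -> qpol (p * d) (cpow x p) (cpow y p).
Proof.
move=> h; elim: p => [|p IH] /=; first exact: qpol_one.
by rewrite mulSn; exact: qpolM.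
Qed.

Lemma qpol_widen d d' x y : (d <= d')%N -> qpol d x y -> qpol d' x y.
Proof.
move=> /subnKC <- h; rewrite -[x]cmulx1 -[y]cmulx1.
by apply: qpolM => //; exact: qpol_one.
Qed.

Lemma gauge_mono (g : A -> A) (s : 'cV[R]_n) k : star_morphism g ->
  (forall i, g (u i) = e2pi (s i 0) *: u i) ->
  g (mono u k) = e2pi (int_dot k s) *: mono u k.
Proof.
move=> gM gu; rewrite mono_morph // -mono_scale; congr (mono _ k).
by apply/funext => i /=; rewrite gu.
Qed.

Definition grid (d : nat) (t : {ffun 'I_n -> 'I_(d.*2.+1)}) : 'cV[R]_n :=
  \col_i ((t i)%:R / d.*2.+1%:R).

(** Discrete Fourier inversion. Two exponents in [[-d, d]] differ by at most [2 d], so a grid with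
    [2 d + 1] points per coordinate separates them, and the finite mean isolates one coefficient
    exactly. *)
Lemma grid_mean d (g : {ffun 'I_n -> 'I_(d.*2.+1)} -> A -> A)
    (c : {ffun 'I_n -> 'I_(d.*2.+1)} -> R[i]) f :
  (forall t, star_morphism (g t)) ->
  (forall t i, g t (u i) = e2pi (grid t i 0) *: u i) ->
  \sum_t e2pi (- int_dot (box_key f) (grid t)) *:
      g t (\sum_h c h *: mono u (box_key h)) =
    (d.*2.+1 ^ n)%:R *: (c f *: mono u (box_key f)).
Proof.
move=> gM gu.
under eq_bigr => t _.
  rewrite (sm_sum (gM t)) scaler_sumr.
  under eq_bigr do
    rewrite (sm_Z (gM t)) (gauge_mono _ (gM t) (gu t)) !scalerA mulrAC -e2piD -scalerA.
  over.
rewrite exchange_big (bigD1 f) //= [X in _ + X]big1 ?addr0 => [|h hf].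
  under eq_bigr do rewrite addNr e2pi0 scale1r.
  by rewrite sumr_const card_ffun !card_ord scaler_nat.
rewrite -scaler_suml.
have -> : \sum_(t : {ffun 'I_n -> 'I_(d.*2.+1)})
    e2pi (- int_dot (box_key f) (grid t) + int_dot (box_key h) (grid t)) =
   \sum_(t : {ffun 'I_n -> 'I_(d.*2.+1)})
     \prod_i e2pi (((h i)%:Z - (f i)%:Z)%:~R * ((t i)%:R / d.*2.+1%:R)).
  apply: eq_bigr => t _; rewrite -e2pi_sum addrC -sumrN -big_split /=; congr e2pi.
  apply: eq_bigr => i _; rewrite !mxE -mulrBl; congr (_ * _).
  by rewrite -intrB; congr (_%:~R); lia.
rewrite -(bigA_distr_bigA (fun (i : 'I_n) (j : 'I_(d.*2.+1)) =>
  e2pi (((h i)%:Z - (f i)%:Z)%:~R * (j%:R / d.*2.+1%:R)))).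
have [i hfi] : exists i, h i != f i.
  by apply/existsP; apply: contraNT hf => /existsPn hf; apply/eqP/ffunP => i;
    apply/eqP; rewrite -[_ == _]negbK.
rewrite (bigD1 i) //= sum_e2pi_roots //; last first.
  by have := ltn_ord (h i); have := ltn_ord (f i); lia.
by rewrite subr_eq0 eqz_nat val_eqE (negPf hfi) mul0r scale0r.
Qed.

Hypothesis gauge_u : forall s : 'cV[R]_n, exists2 g : A -> A, star_morphism g &
  forall i, g (u i) = e2pi (s i 0) *: u i.

(** By [grid_mean] the term of index [f] is an average of images of [x] under contractions, with
    phases of modulus 1; the monomial has norm 1. *)
Lemma coef_bound d (c : {ffun 'I_n -> 'I_(d.*2.+1)} -> R[i]) f :
  nm (c f) <= nm (\sum_g c g *: mono u (box_key g)).
Proof.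
set x := \sum_g _.
have [g gP] := choice (fun t => let: ex_intro2 g gM gu := gauge_u (@grid d t) in
  ex_intro (fun g => star_morphism g /\ forall i, g (u i) = e2pi (@grid d t i 0) *: u i)
    g (conj gM gu)).
have gM t : star_morphism (g t) by have [] := gP t.
have E := grid_mean c f gM (fun t => proj2 (gP t)).
have := nm_sum (index_enum {ffun 'I_n -> 'I_(d.*2.+1)}) predT
  (fun t => e2pi (- int_dot (box_key f) (grid t)) *: g t x).
rewrite E nmZ nmZ (nm_unitary (mono_unitary _ uR)) mulr1.
have -> : nm ((d.*2.+1 ^ n)%:R : R[i]) = (d.*2.+1 ^ n)%:R.
  by rewrite -(rmorph_nat (real_complex R)) nm_real ger0_norm // ler0n.
have mn0 : (0 : R) < (d.*2.+1 ^ n)%:R by rewrite ltr0n expn_gt0.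
move=> h; rewrite -(ler_pM2l mn0); apply: le_trans h _.
apply: (@le_trans _ _ (\sum_(t : {ffun 'I_n -> 'I_(d.*2.+1)}) nm x)).
  by apply: ler_sum => t _; rewrite nmZ nm_e2pi mul1r; exact: sm_contractive.
by rewrite sumr_const card_ffun !card_ord mulr_natl.
Qed.

(** The gauge action lives on the side of [u], while [v] ranges over all solutions of the relations,
    as universality demands. The factor counts the coefficients. *)
Lemma qpol_growth d x y : qpol d x y -> nm y <= (d.*2.+1 ^ n)%:R * nm x.
Proof.
move=> [c [-> ->]]; apply: le_trans (nm_sum _ _ _) _.
apply: (@le_trans _ _ (\sum_(f : {ffun 'I_n -> 'I_(d.*2.+1)})
    nm (\sum_g c g *: mono u (box_key g)))).
  apply: ler_sum => f _; rewrite nmZ (nm_unitary (mono_unitary _ vR)) mulr1.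
  exact: coef_bound.
by rewrite sumr_const card_ffun !card_ord mulr_natl.
Qed.

(* The growth bound is polynomial in the degree, so it disappears when it is
   applied to high powers of the self-adjoint element [x^* x]. *)
Lemma qpol_contractive d x y : qpol d x y -> nm y <= nm x.
Proof.
move=> xy; rewrite -(ler_pXn2r (n := 2)) ?nnegrE ?nm_ge0 // -!nm_starM.
have hxy := qpolM (qpol_star xy) xy.
set h := star x ** x in hxy *; set h' := star y ** y in hxy *.
have hh : star h = h by rewrite starM starK.
have hh' : star h' = h' by rewrite starM starK.
(* The power [2 ^ m] of [h] has degree [2 ^ m * 2 d], and [2 ^ m * 4 d + 1 <= (4 d + 1) * 2 ^ m];
   the [n]-th power of this gives the two constants. *)
apply: (@le_of_pow_bound _ _ _ (((d + d).*2.+1 ^ n)%:R) ((2 ^ n)%:R));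
  rewrite ?nm_ge0 ?ler1n ?expn_gt0 // => m.
rewrite -!nm_selfadj_pow //; apply: le_trans (qpol_growth (qpol_pow (2 ^ m) hxy)) _.
rewrite ler_wpM2r ?nm_ge0 // -natrX -natrM ler_nat.
have -> : ((2 ^ n) ^ m = (2 ^ m) ^ n)%N by rewrite -!expnM mulnC.
rewrite -expnMn.
have [->//|n0] := posnP n; rewrite leq_exp2r //; have : (0 < 2 ^ m)%N by rewrite expn_gt0.
by nia.
Qed.

End Polynomials.

(** * Universality from density *)

Section Closure.
Variables (R : realType) (n : nat) (theta : 'M[R]_n).
Variables (A : cstarAlgType R) (u : 'I_n -> A) (B : cstarAlgType R) (v : 'I_n -> B).
Hypotheses (uR : qtorus_rel theta u) (vR : qtorus_rel theta v).

(* The closure in [A * B] of the set of pairs [(p(u), p(v))]. *)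
Definition qclosure (x : A) (y : B) := forall e : R, 0 < e ->
  exists d p r, [/\ qpol u v d p r, nm (x - p) < e & nm (y - r) < e].

Lemma qclosure_qpol d x y : qpol u v d x y -> qclosure x y.
Proof. by move=> h e e0; exists d, x, y; rewrite !subrr !nm0. Qed.

Lemma qclosure_one : qclosure cone cone.
Proof. exact/qclosure_qpol/(qpol_one u v 0). Qed.

Lemma qclosure_gen i : qclosure (u i) (v i).
Proof.
rewrite -(mono_delta u) -(mono_delta v); apply: (@qclosure_qpol 1).
by apply: qpol_mono => j; rewrite mxE eqxx andbT; case: eqP.
Qed.

Lemma qclosure_mono k : qclosure (mono u k) (mono v k).
Proof.
apply: (@qclosure_qpol (\sum_i `|k i 0%R|)%N); apply: qpol_mono => i.
by rewrite (bigD1 i) //= leq_addr.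
Qed.

Lemma qclosure_lin (c : R[i]) x y x' y' : qclosure x y -> qclosure x' y' ->
  qclosure (c *: x + x') (c *: y + y').
Proof.
move=> h h' e e0; have c0 : 0 < nm c + 1 by rewrite ltr_wpDl ?nm_ge0.
have [d [p [r [pr xp yr]]]] := h (e / 2 / (nm c + 1)) ltac:(by rewrite !divr_gt0).
have [d' [p' [r' [pr' xp' yr']]]] := h' (e / 2) ltac:(by rewrite divr_gt0).
exists (maxn d d'), (c *: p + p'), (c *: r + r'); split.
- by apply: (qpol_lin c); [move: pr|move: pr'];
    apply: (qpol_widen uR vR); rewrite ?leq_maxl ?leq_maxr.
- rewrite opprD addrACA -scalerBr; apply: le_lt_trans (nmD _ _) _; rewrite nmZ.
  have h1 := ler_wpM2l (nm_ge0 c) (ltW xp).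
  by have := mul_half_div_succ_le (nm_ge0 c) e0; lra.
rewrite opprD addrACA -scalerBr; apply: le_lt_trans (nmD _ _) _; rewrite nmZ.
have h1 := ler_wpM2l (nm_ge0 c) (ltW yr).
by have := mul_half_div_succ_le (nm_ge0 c) e0; lra.
Qed.

Lemma qclosureM x y x' y' : qclosure x y -> qclosure x' y' ->
  qclosure (x ** x') (y ** y').
Proof.
move=> h h' e e0.
have mulB (C : cstarAlgType R) (a a' b b' : C) (e' : R) : e' <= 1 -> nm (a - b) < e' ->
    nm (a' - b') < e' -> nm (a ** a' - b ** b') <= e' * (nm a + nm a' + 1).
  move=> e1 ab ab'; have -> : a ** a' - b ** b' = (a - b) ** a' + b ** (a' - b').
    by rewrite cmulBl cmulBr addrA subrK.
  apply: le_trans (nmD _ _) _.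
  have h1 := nmM (a - b) a'; have h2 := nmM b (a' - b').
  have h3 := ler_wpM2r (nm_ge0 a') (ltW ab).
  have h4 := ler_wpM2l (nm_ge0 b) (ltW ab').
  have h5 : nm b <= nm a + 1.
    by have := nmB a (a - b); rewrite opprB addrC subrK; lra.
  have e'0 : 0 <= e' by apply: le_trans (ltW ab); exact: nm_ge0.
  have h6 := ler_wpM2r e'0 h5; lra.
pose K := nm x + nm x' + nm y + nm y' + 1.
have K0 : 0 < K by rewrite ltr_wpDl // !addr_ge0 ?nm_ge0.
pose e' := Num.min 1 (e / 2 / K).
have e'0 : 0 < e' by rewrite lt_min ltr01 !divr_gt0.
have e'1 : e' <= 1 by rewrite ge_min lexx.
have e'K : e' * K < e.
  apply: (@le_lt_trans _ _ (e / 2)); last by lra.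
  by rewrite -ler_pdivlMr // ge_min lexx orbT.
have [d [p [r [pr xp yr]]]] := h e' e'0; have [d' [p' [r' [pr' xp' yr']]]] := h' e' e'0.
exists (d + d')%N, (p ** p'), (r ** r'); split; first exact: (qpolM uR vR).
  apply: le_lt_trans (mulB _ _ _ _ _ _ e'1 xp xp') _; apply: le_lt_trans e'K.
  by rewrite ler_wpM2l ?(ltW e'0) // /K; have := nm_ge0 y; have := nm_ge0 y'; lra.
apply: le_lt_trans (mulB _ _ _ _ _ _ e'1 yr yr') _; apply: le_lt_trans e'K.
by rewrite ler_wpM2l ?(ltW e'0) // /K; have := nm_ge0 x; have := nm_ge0 x'; lra.
Qed.

Lemma qclosure_star x y : qclosure x y -> qclosure (star x) (star y).
Proof.
move=> h e e0; have [d [p [r [pr xp yr]]]] := h e e0.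
by exists d, (star p), (star r); rewrite -!starB !nm_star; split=> //; exact: (qpol_star uR vR).
Qed.

Lemma qclosure_closed x y :
  (forall e : R, 0 < e -> exists x' y', [/\ qclosure x' y', nm (x - x') < e & nm (y - y') < e]) ->
  qclosure x y.
Proof.
move=> h e e0; have e2 : 0 < e / 2 by rewrite divr_gt0.
have [x' [y' [xy' xx yy]]] := h _ e2; have [d [p [r [pr xp yr]]]] := xy' _ e2.
exists d, p, r; split=> //.
  by have := nm_dist_trans x' x p; lra.
by have := nm_dist_trans y' y r; lra.
Qed.

Hypothesis gauge_u : forall s : 'cV[R]_n, exists2 g : A -> A, star_morphism g &
  forall i, g (u i) = e2pi (s i 0) *: u i.

Lemma qclosure_contractive x y : qclosure x y -> nm y <= nm x.
Proof.
move=> h; apply/ler_addgt0Pr => e e0; 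
  have [d [p [r [pr xp yr]]]] := h (e / 2) ltac:(by rewrite divr_gt0).
have := qpol_contractive uR vR gauge_u pr.
have := nmB (y - r) (- r); rewrite opprK subrK nmN.
by have := nmB x (x - p); rewrite opprB addrC subrK; lra.
Qed.

(** The closure is linear, so contractivity on the pair [(0, y - y')] makes it the graph of a
    map. *)
Lemma qclosure_fun x y y' : qclosure x y -> qclosure x y' -> y = y'.
Proof.
move=> h h'; apply/eqP; rewrite -subr_eq0; apply/eqP/nm_le0.
have := qclosure_contractive (qclosure_lin (-1) h' h).
by rewrite !scaleN1r addNr nm0 addrC.
Qed.

End Closure.

Section Universal.
Variables (R : realType) (n : nat) (theta : 'M[R]_n).
Variables (A : cstarAlgType R) (u : 'I_n -> A).
Hypothesis uR : qtorus_rel theta u.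
Hypothesis gauge_u : forall s : 'cV[R]_n, exists2 g : A -> A, star_morphism g &
  forall i, g (u i) = e2pi (s i 0) *: u i.
(** Density of the polynomials in [u]: on the diagonal both components of [qpol u u] are the same
    polynomial. *)
Hypothesis dense_u : forall x, qclosure u u x x.

(** Polynomials in [u] that converge to [x] have partners in [v] that form a Cauchy sequence, by
    contractivity. *)
Lemma qclosure_total (B : cstarAlgType R) (v : 'I_n -> B) x :
  qtorus_rel theta v -> exists y, qclosure u v x y.
Proof.
move=> vR.
have app (m : nat) : exists pr : A * B, exists d, qpol u v d pr.1 pr.2 /\
    nm (x - pr.1) < m.+1%:R^-1.
  have [|d [p [r [[c [-> _]] xp _]]]] := dense_u x (e := m.+1%:R^-1).
    by rewrite invr_gt0.
  exists (\sum_f c f *: mono u (box_key f), \sum_f c f *: mono v (box_key f)).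
  by exists d; split=> //; exists c.
have [pr prP] := choice app.
have arch := @invSn_eventually_lt R.
have [e e0|y yP] := @nm_cauchy _ B (fun m => (pr m).2).
  have [N NP] := arch (e / 2) ltac:(by rewrite divr_gt0).
  exists N => m m' /NP h /NP h'.
  have [d [pm xm]] := prP m; have [d' [pm' xm']] := prP m'.
  have pmx := qpol_widen uR vR (leq_maxl d d') pm.
  have pmx' := qpol_widen uR vR (leq_maxr d d') pm'.
  have := qpol_contractive uR vR gauge_u (qpol_lin (-1) pmx' pmx).
  rewrite !scaleN1r ![- _ + _]addrC => /le_lt_trans; apply.
  by have := nm_dist_trans x (pr m).1 (pr m').1; rewrite (nm_distC (pr m).1 x);
    move: (lt_trans xm h) (lt_trans xm' h') => {xm xm' h h'}; lra.
exists y => e e0; have [N NP] := arch e e0; have [N' N'P] := yP e e0.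
have [d [pm xm]] := prP (maxn N N').
exists d, (pr (maxn N N')).1, (pr (maxn N N')).2; split=> //.
  by apply: lt_trans xm (NP _ (leq_maxl _ _)).
by rewrite nm_distC; exact/N'P/leq_maxr.
Qed.

(** The graph is closed under all operations, hence the map is a star morphism. Any competing
    morphism is contractive and agrees on polynomials, so its graph lies in the closure too. *)
Lemma qtorus_universal_of_dense (B : cstarAlgType R) (v : 'I_n -> B) :
  qtorus_rel theta v ->
  exists! f : A -> B, star_morphism f /\ forall k, f (u k) = v k.
Proof.
move=> vR; have [f fP] := choice (fun x => qclosure_total x vR).
have ffun := qclosure_fun uR vR gauge_u.
exists f; split.
  split=> [|k]; last exact: ffun (fP _) (qclosure_gen u v k).
  split=> [c x y||x y|x].
  - by apply: ffun (fP _) _; exact: (qclosure_lin uR vR).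
  - by apply: ffun (fP _) _; exact: qclosure_one.
  - by apply: ffun (fP _) _; exact: (qclosureM uR vR).
  - by apply: ffun (fP _) _; exact: (qclosure_star uR vR).
move=> g [gM gu]; apply/funext => x; apply: ffun (fP x) _ => e e0.
have [d [p [r [[c [pE _]] xp _]]]] := dense_u x e0.
exists d, p, (g p); split=> //; last first.
  by rewrite -(sm_B gM); apply: le_lt_trans xp; exact: sm_contractive.
exists c; split=> //; rewrite pE (sm_sum gM); apply: eq_bigr => h _.
rewrite (sm_Z gM) mono_morph //; congr (_ *: mono _ _).
by apply/funext => i /=; rewrite gu.
Qed.

Definition qtorus_of_dense : quantum_torus theta :=
  QuantumTorus uR qtorus_universal_of_dense.

End Universal.

Section Model.
Variables (R : realType) (n : nat) (theta : 'M[R]_n) (T : quantum_torus theta).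

Lemma qtorus_dense x : qclosure (qtorus_gen T) (qtorus_gen T) x x.
Proof.
have TR := qtorus_genP T.
pose S : T -> Prop := fun x => qclosure (qtorus_gen T) (qtorus_gen T) x x.
have Scl : closed (S : set T).
  apply/nm_closedP => z h; apply: qclosure_closed => e e0.
  by have [y Sy zy] := h e e0; exists y, y.
apply: (@qtorus_generated _ _ _ T (@StarSubalgebra _ _ S _ _ _ _ Scl)) => /=.
- exact: qclosure_one.
- by move=> c y z; exact: (qclosure_lin TR TR).
- by move=> y z; exact: (qclosureM TR TR).
- by move=> y; exact: (qclosure_star TR TR).
by move=> _ _ _ _ k; exact: qclosure_gen.
Qed.

End Model.

(** * Lattices and compact quotients *)

Definition Rof (R : realType) (m n : nat) (z : 'M[int]_(m, n)) : 'M[R]_(m, n) :=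
  map_mx intr z.

Lemma RofM (R : realType) (m n p : nat) (x : 'M[int]_(m, n)) (y : 'M[int]_(n, p)) :
  Rof R (x *m y) = Rof R x *m Rof R y.
Proof. exact: map_mxM. Qed.

Section Lattice.
Variables (R : realType) (n : nat) (H : 'cV[R]_n -> Prop) (q : nat).
Hypotheses (H_sub : forall x y, H x -> H y -> H (x - y)).
Hypotheses (HZ : forall z : 'cV[int]_n, H (Rof R z)) (q0 : (0 < q)%N).
Hypothesis Hq : forall x, H x -> exists z : 'cV[int]_n, q%:R *: x = Rof R z.

Let H0 : H 0. Proof. by have := HZ 0; rewrite /Rof map_mx0. Qed.

Let HD x y : H x -> H y -> H (x + y).
Proof. by move=> hx hy; rewrite -[y]opprK -[- y]sub0r; apply: H_sub => //; exact: H_sub. Qed.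

Let Hint x (m : int) : H x -> H (m%:~R *: x).
Proof.
move=> hx; have nat_case (p : nat) : H (p%:R *: x).
  by elim: p => [|p IH]; rewrite ?scale0r // -natr1 scalerDl scale1r; exact: HD.
case: m => p; first exact: nat_case.
by rewrite NegzE mulrNz scaleNr -sub0r; apply: H_sub => //; exact: nat_case.
Qed.

Let Hsum (I : Type) (r : seq I) (F : I -> 'cV[R]_n) :
  (forall i, H (F i)) -> H (\sum_(i <- r) F i).
Proof. by move=> h; elim/big_ind: _ => // x y; exact: HD. Qed.

Let q1 : (0 : R) < q%:R. Proof. by rewrite ltr0n. Qed.
Let q1' : (q%:R : R) != 0. Proof. by rewrite gt_eqF. Qed.

Let box_vec (f : {ffun 'I_n -> 'I_q}) : 'cV[int]_n := \col_i (f i : nat)%:Z.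
Let good f := `[< H (q%:R^-1 *: Rof R (box_vec f)) >].
Let gen_col (f : {ffun 'I_n -> 'I_q}) : 'cV[int]_n := if good f then box_vec f else 0.
Let N := #|{ffun 'I_n -> 'I_q}|.
(** The columns generate [q H]: the vectors [q e_i], and the residues modulo [q] that belong to
    [q H]. The other residues are replaced by 0, so that the index set remains a full function
    type. *)
Let G : 'M[int]_(n, n + N) :=
  row_mx (q%:Z)%:M (\matrix_(i, j) gen_col (enum_val j) i 0).

Let lattice_gen x : H x <-> exists w, q%:R *: x = Rof R (G *m w).
Proof.
split=> [hx|[w xw]].
  have [z zE] := Hq hx.
  pose a : 'cV[int]_n := \col_i (z i 0%R %/ q%:Z)%Z.
  have zq i : (`|(z i 0%R %% q%:Z)%Z| < q)%N.
    by have := ltz_mod (z i 0%R) (d := q%:Z); have := modz_ge0 (z i 0%R) (d := q%:Z); lia.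
  pose f : {ffun 'I_n -> 'I_q} := [ffun i => Ordinal (zq i)].
  have zaf : z = q%:Z *: a + box_vec f.
    apply/colP => i; rewrite !mxE ffunE /=.
    have := divz_eq (z i 0%R) q%:Z; have := modz_ge0 (z i 0%R) (d := q%:Z); lia.
  have gf : good f.
    apply/asboolP; have -> : q%:R^-1 *: Rof R (box_vec f) = x - Rof R a.
      apply: (@scalerI _ _ (q%:R : R)) => //.
      rewrite scalerA mulfV // scale1r scalerBr zE zaf /Rof map_mxD map_mxZ.
      by rewrite addrAC subrr add0r.
    exact: H_sub.
  exists (col_mx a (delta_mx (enum_rank f) 0)).
  rewrite zE; congr (Rof R _); rewrite /G mul_row_col mul_scalar_mx zaf; congr (_ + _).
  rewrite -colE; apply/colP => i; rewrite !mxE enum_rankK /gen_col gf.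
  by rewrite mxE.
have -> : x = q%:R^-1 *: Rof R (G *m w) by rewrite -xw scalerA mulVf // scale1r.
rewrite -[w]vsubmxK /G mul_row_col mul_scalar_mx /Rof map_mxD map_mxZ scalerDr scalerA.
rewrite [_^-1 * _]mulVf // scale1r; apply: HD; first exact: HZ.
have -> : (\matrix_(i, j) gen_col (enum_val j) i 0) *m dsubmx w =
    \sum_j dsubmx w j 0 *: gen_col (enum_val j) :> 'cV[int]_n.
  apply/colP => i; rewrite !mxE summxE; apply: eq_bigr => j _.
  by rewrite !mxE mulrC.
rewrite (raddf_sum (map_mx intr : {additive 'cV[int]_n -> 'cV[R]_n})) scaler_sumr.
apply: Hsum => j; rewrite /= map_mxZ scalerA mulrC -scalerA; apply: Hint.
rewrite /gen_col; case: ifP => [/asboolP //|_].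
by rewrite map_mx0 scaler0.
Qed.

(** The Smith form turns the generators of [q H] into the [n] columns of a square matrix, so
    [H = V Z^n]. As [Z^n] lies in [H], there is an integer [M] with [V M = 1]. *)
Lemma lattice_basis : exists M : 'M[int]_n, Rof R M \in unitmx /\
  forall x, H x <-> exists k : 'cV[int]_n, x = invmx (Rof R M) *m Rof R k.
Proof.
have [L Lu [P Pu [d _ GE]]] := int_Smith_normal_form G.
(* The last [N] columns of the diagonal factor vanish and [P] is unimodular, so these columns span
   the same lattice as those of [G]. *)
pose V0 := L *m diag_mx (\row_i d`_(i : 'I_n)).
have GV (w : 'cV_(n + N)) : exists k : 'cV_n, G *m w = V0 *m k.
  exists (usubmx (P *m w)); rewrite GE /V0 -!mulmxA; congr (_ *m _).
  apply/colP => i; rewrite !mxE big_split_ord /= [X in _ + X]big1 ?addr0.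
    by apply: eq_bigr => j _; rewrite !mxE (inj_eq val_inj) /=.
  by move=> j _; rewrite !mxE /= ltn_eqF ?mulr0n ?mul0r // ltn_addr.
have VG (k : 'cV_n) : exists w : 'cV_(n + N), V0 *m k = G *m w.
  exists (invmx P *m col_mx k 0); rewrite GE /V0 -!mulmxA mulKVmx //; congr (_ *m _).
  apply/colP => i; rewrite [LHS]mxE [RHS]mxE big_split_ord /= [X in _ = _ + X]big1 ?addr0.
    by apply: eq_bigr => j _; rewrite col_mxEu !mxE (inj_eq val_inj).
  by move=> j _; rewrite col_mxEd [X in _ * X]mxE mulr0.
pose V : 'M[R]_n := q%:R^-1 *: Rof R V0.
have HV x : H x <-> exists k : 'cV[int]_n, x = V *m Rof R k.
  rewrite lattice_gen; split=> [[w xw]|[k ->]].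
    have [k wk] := GV w; exists k.
    by rewrite /V -scalemxAl -RofM -wk -xw scalerA mulVf // scale1r.
  have [w kw] := VG k; exists w.
  by rewrite /V -scalemxAl scalerA mulfV // scale1r -kw RofM.
have /choice[m mP] : forall j : 'I_n, exists k : 'cV[int]_n, Rof R (delta_mx j 0) = V *m Rof R k.
  by move=> j; apply/HV; exact: HZ.
pose M : 'M[int]_n := \matrix_(i, j) m j i 0.
have VM : V *m Rof R M = 1%:M.
  apply/matrixP => i j; have /matrixP/(_ i 0) := mP j; rewrite !mxE => E.
  transitivity (((i == j) && (0 == 0 :> 'I_1))%:R%:~R : R).
    by rewrite E; apply: eq_bigr => l _; rewrite !mxE.
  by rewrite andbT; case: (i == j).
have [Vu Mu] := mulmx1_unit VM.
exists M; split=> // x; rewrite HV.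
suff -> : V = invmx (Rof R M) by [].
by rewrite -[LHS]mulmx1 -(mulmxV Mu) mulmxA VM mul1mx.
Qed.

End Lattice.

Section Quotient.
Variables (R : realType) (n : nat) (A : cstarAlgType R) (beta : dynsys A (Rn R n)).

Let Q := quotient_topology (Quotient.quot (dyn_ker beta : zmodClosed 'cV[R]_n)).
Let p (x : 'cV[R]_n) : Q := \pi_(Quotient.quot (dyn_ker beta : zmodClosed 'cV[R]_n))%qT x.

Let piE x y : p x = p y <-> (x - y) \in dyn_ker beta.
Proof.
rewrite Quotient.idealrBE.
by split=> [xy|/eqP //]; apply/eqP.
Qed.

Let cube (z : 'cV[int]_n) : set Q :=
  [set c | exists2 x, p x = c & forall i, `|x i 0 - (z i 0)%:~R| < 1].

Let cube_open z : open (cube z).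
Proof.
rewrite /open /= /quotient_open.
have -> : (\pi_Q @^-1` cube z)%qT = \bigcup_(g in [set g | g \in dyn_ker beta])
   [set y : 'cV[R]_n | forall i, `|(y + g) i 0 - (z i 0)%:~R| < 1].
  apply/seteqP; split=> y /=.
    move=> [x /piE xy hx]; exists (x - y) => // i.
    by rewrite [y + _]addrC subrK.
  move=> [g gK hy]; exists (y + g) => //; apply/piE.
  by rewrite addrAC subrr add0r.
apply: bigcup_open => g _; rewrite openE => y hy.
pose P (i : 'I_n) (j : 'I_1) := [set t : R | `|t + g i 0 - (z i 0)%:~R| < 1].
exists P => [i j|x Px i]; last by have := Px i 0; rewrite /P /= mxE.
have h1 : 0 < 1 - `|(y + g) i 0 - (z i 0)%:~R| by rewrite subr_gt0.
apply/nbhs_normP; exists (1 - `|(y + g) i 0 - (z i 0)%:~R|) => //= t.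
rewrite ord1 /ball_ /P /= mxE => ht.
have -> : t + g i 0 - (z i 0)%:~R = (y i 0 + g i 0 - (z i 0)%:~R) - (y i 0 - t) by ring.
by apply: le_lt_trans (ler_normB _ _) _; rewrite addrC -ltrBrDr.
Qed.

(* Finitely many open cubes around integer points cover the quotient, and a cube
   of radius [1] contains only one integer point; so [Z^n] is finite modulo the
   kernel. *)
Lemma compact_quotient_period :
  (forall s : 'cV[R]_n, (forall a, beta s a = a) -> exists z, s = Rof R z) ->
  compact [set: Q] ->
  exists2 q : nat, (0 < q)%N & forall i a, beta (q%:R *: basis_vec R i) a = a.
Proof.
move=> kerZ; rewrite compact_cover => /(_ _ setT cube (fun z _ => @cube_open z)).
have cover_all : [set: Q] `<=` cover setT cube.
  move=> c _; pose x : 'cV[R]_n := repr c.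
  exists (\col_i Num.floor (x i 0)) => //; exists x; first exact: reprK.
  move=> i; rewrite mxE; have /andP[h1 h2] := floor_itv (x i 0).
  by rewrite ger0_norm ?subr_ge0 // ltrBlDr addrC -intrD1.
move=> /(_ cover_all)[D _ Dcov].
(* The class of [w] has a representative [x] in an open cube around some [z] of [D]. The kernel
   consists of integer vectors, so [x] is integral and equals [z]. *)
have near_D (w : 'cV[int]_n) : exists2 z, z \in D & (Rof R w - Rof R z) \in dyn_ker beta.
  have [z /= zD [x /piE xw xz]] := Dcov (p (Rof R w)) I.
  exists z => //; have xw' : (Rof R w - x) \in dyn_ker beta by rewrite -opprB rpredN.
  suff <- : x = Rof R z by [].
  have [y yE] := kerZ _ (asboolW xw'); apply/colP => i; rewrite mxE.
  have xi : x i 0 = (w i 0 - y i 0)%:~R.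
    by have /colP/(_ i) := yE; rewrite !mxE intrB => <-; ring.
  have := xz i; rewrite xi -intrB -intr_norm ltrz1 => h.
  by congr (_%:~R); lia.
have period_i (i : 'I_n) : exists m : nat, (0 < m)%N /\
    (m%:R *: basis_vec R i) \in dyn_ker beta.
  have /choice[h hP] : forall m : nat, exists z : D,
      (Rof R (m%:Z *: delta_mx i 0) - Rof R (val z)) \in dyn_ker beta.
    move=> m; have [z zD zP] := near_D (m%:Z *: delta_mx i 0).
    by exists (Sub z zD).
  (* Pigeonhole on [#|D| + 1] multiples of the [i]-th basis vector. *)
  have : ~~ injectiveb (fun m : 'I_(#|{: D}|.+1) => h m).
    apply/negP => /injectiveP /leq_card; rewrite card_ord ltnn.
    by [].
  move=> /injectivePn[m [m' mm' hm]].
  have key : (Rof R ((m : nat)%:Z *: delta_mx i 0) - Rof R ((m' : nat)%:Z *: delta_mx i 0))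
      \in dyn_ker beta.
    by have := rpredB (hP m) (hP m'); rewrite hm opprB addrA subrK.
  have RofE (r : nat) : Rof R (r%:Z *: delta_mx i 0) = r%:R *: basis_vec R i.
    by apply/colP => j; rewrite !mxE intrM; case: (j == i).
  move: key; rewrite !RofE -scalerBl => key.
  wlog lt_mm : m m' mm' key {hm} / (m' < m)%N.
    move=> W; case: (ltngtP m' m) => [|lt|/val_inj e]; first exact: W.
      apply: (W m' m); rewrite // 1?eq_sym //.
      by rewrite -opprB scaleNr rpredN.
    by rewrite e eqxx in mm'.
  by exists (m - m')%N; rewrite subn_gt0 natrB // ltnW.
have [m mP] := choice period_i.
exists (\prod_i m i)%N; first by rewrite prodn_gt0 // => i; have [] := mP i.
move=> i a; have [_ mK] := mP i.
suff : ((\prod_i m i)%:R *: basis_vec R i) \in dyn_ker beta by move=> /asboolP.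
rewrite (bigD1 i) //= mulnC natrM -scalerA.
by rewrite scaler_nat rpredMn.
Qed.

(** The quotient is a continuous image of the unit cube. Row vectors occur because [rV_compact]
    speaks about them. *)
Lemma quotient_compact (M : 'M[R]_n) :
  (forall s : 'cV[R]_n, exists2 r : 'cV[R]_n, (forall i, 0 <= r i 0 <= 1) &
     forall a, beta s a = beta (M *m r) a) ->
  compact [set: Q].
Proof.
move=> h.
pose f (r : 'rV[R]_n) : Q := p (M *m r^T).
have fc : continuous f.
  move=> r; apply: (@continuous_comp _ _ _ (fun r : 'rV[R]_n => M *m r^T : 'cV[R]_n)).
    move=> U [P Pr PU].
    have Pi i : nbhs r [set r' : 'rV[R]_n | P i 0 ((M *m r'^T) i 0)].
      have : continuous (fun r' : 'rV[R]_n => (M *m r'^T) i 0).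
        have -> : (fun r' : 'rV[R]_n => (M *m r'^T) i 0) =
            (fun r' => \sum_j M i j * r' 0 j).
          by apply/funext => r'; rewrite mxE; apply: eq_bigr => j _; rewrite mxE.
        elim: (index_enum _) => [|j s IH] r'.
          under eq_fun do rewrite big_nil.
          exact: cst_continuous.
        under eq_fun do rewrite big_cons.
        rewrite /continuous_at; apply: cvgD (IH r').
        by apply: cvgMl_tmp; exact: coord_continuous.
      by move=> /(_ r) /(_ _ (Pr i 0)).
    have : nbhs r [set r' : 'rV[R]_n | forall i : 'I_n, P i 0 ((M *m r'^T) i 0)].
      exact: (@filter_forall _ _ (fun i r' => P i 0 ((M *m r'^T) i 0)) (nbhs r) _ Pi).
    by apply: filterS => r' Pr'; apply: PU => i j; rewrite ord1; exact: Pr'.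
  exact: pi_continuous.
have Kc := @rV_compact R n (fun=> `[0, 1]%classic) (fun _ => @segment_compact R 0 1).
have -> : [set: Q] = f @` [set v : 'rV[R]_n | forall i, `[0, 1]%classic (v ord0 i)].
  apply/seteqP; split=> // c _.
  have [r r01 rP] := h (repr c).
  exists r^T; first by move=> i; rewrite mxE /= in_itv /= r01.
  rewrite /f trmxK -[RHS]reprK; apply/piE/asboolP => a.
  by rewrite actRnD -rP -actRnD subrr actRn0.
by apply: continuous_compact => //; apply: continuous_subspaceT.
Qed.

End Quotient.

(** * From a connected covering to a gauge model *)

(* If [g] and [h] act in the same way, no sum [\sum x ** alpha _ y] separates
   them. *)
Lemma free_faithful (R : realType) (A : cstarAlgType R) (G : finGroupType)
    (alpha : dynsys A (discrete_topology G)) : free_dynsys alpha ->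
  forall g h : G, (forall a, alpha g a = alpha h a) -> g = h.
Proof.
move=> fr g h gh; apply/eqP/negPn/negP => gh'.
pose f (x : discrete_topology G) : A := if x == g :> G then cone else 0.
have fc : continuous f.
  move=> x U /nbhs_singleton Ux; apply/principal_filterP; exact: Ux.
have [s sP] := fr f fc 2^-1 ltac:(by rewrite invr_gt0).
have := sP g; have := sP h; rewrite /f eqxx [h == g]eq_sym (negPf gh').
under eq_bigr do rewrite -gh.
set y := \sum_(p <- s) _; rewrite !nmE !ltcR => h1 h2.
have := nmB (cone - y) (0 - y); rewrite opprB subr0 subrK nm_cone; lra.
Qed.

Section Connected.
Variables (R : realType) (n : nat) (theta : 'M[R]_n) (T : quantum_torus theta).
Variables (A : cstarAlgType R) (G : finGroupType).
Variables (alpha : dynsys A (discrete_topology G)) (iota : T -> A).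
Variable beta : dynsys A (Rn R n).
Hypotheses (alpha_free : free_dynsys alpha) (iotaP : fixed_point_embedding alpha iota).
Hypotheses (beta_lift : gauge_lift iota beta) (beta_erg : ergodic beta).
Hypothesis comm : forall (g : G) (s : 'cV[R]_n) (a : A),
  alpha g (beta s a) = beta s (alpha g a).

Let iotaM : star_morphism iota. Proof. by have [] := iotaP. Qed.
Let alphaM (g : G) : star_morphism (alpha g). Proof. by have [] := dyn_automorphism alpha g. Qed.
Let betaM (s : 'cV[R]_n) : star_morphism (beta s). Proof. exact: actRn_morphism. Qed.
Let w (k : 'I_n) : A := iota (qtorus_gen T k).

Let wR : qtorus_rel theta w.
Proof.
have [uU uC] := qtorus_genP T; split=> [k|k l]; first exact: (sm_unitary iotaM).
by rewrite /w -!(sm_M iotaM) uC (sm_Z iotaM).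
Qed.

Let beta_w (s : 'cV[R]_n) k : beta s (w k) = e2pi (s k 0) *: w k.
Proof.
have [_ bl] := beta_lift; rewrite /w bl; have [_ ->] := gaugeP T s.
by rewrite (sm_Z iotaM).
Qed.

Let scale_unitary_inj (c d : R[i]) (u : A) : unitary u -> c *: u = d *: u -> c = d.
Proof.
move=> uu /eqP; rewrite -subr_eq0 -scalerBl scaler_eq0 (negPf (unitary_neq0 uu)) orbF.
by rewrite subr_eq0 => /eqP.
Qed.

Let int_vec (s : 'cV[R]_n) : (forall k, s k 0 \is a Num.int) -> exists z, s = Rof R z.
Proof.
move=> h; exists (\col_k Num.floor (s k 0)); apply/colP => k.
by rewrite !mxE floorK.
Qed.

Let ker_int (s : 'cV[R]_n) : (forall a, beta s a = a) -> exists z, s = Rof R z.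
Proof.
move=> h; apply: int_vec => k; apply: e2pi_eq1.
have [wU _] := wR; apply: (scale_unitary_inj (wU k)).
by rewrite -beta_w h scale1r.
Qed.

Let period : exists2 q : nat, (0 < q)%N & forall i a, beta (q%:R *: basis_vec R i) a = a.
Proof. by apply: compact_quotient_period => //; have [] := beta_lift. Qed.

Notation eig := (eigenvec beta).

Let dotvD (x y s : 'cV[R]_n) : dotv (x + y) s = dotv x s + dotv y s :> R.
Proof. by rewrite /dotv -big_split; apply: eq_bigr => i _; rewrite mxE mulrDl. Qed.

Let dotvN (x s : 'cV[R]_n) : dotv (- x) s = - dotv x s.
Proof. by rewrite /dotv -sumrN; apply: eq_bigr => i _; rewrite mxE mulNr. Qed.

Let eigM x y a b : eig x a -> eig y b -> eig (x + y) (a ** b).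
Proof.
move=> xa yb s; rewrite (sm_M (betaM s)) xa yb -cscaleAl -cscaleAr scalerA.
by rewrite dotvD e2piD.
Qed.

Let eig_star x a : eig x a -> eig (- x) (star a).
Proof. by move=> xa s; rewrite (sm_star (betaM s)) xa starZ dotvN e2piN. Qed.

Let eigZ x a c : eig x a -> eig x (c *: a).
Proof. by move=> xa s; rewrite (sm_Z (betaM s)) xa !scalerA mulrC. Qed.

Let eig0 a : eig 0 a -> exists c, a = c *: cone.
Proof.
move=> a0; have : fixed_points beta a.
  move=> s; rewrite a0 /dotv big1 ?e2pi0 ?scale1r // => i _.
  by rewrite mxE mul0r.
by rewrite beta_erg => -[c _ <-]; exists c.
Qed.

Let eig_unitary x a : eig x a -> a != 0 -> exists2 r : R, 0 < r & unitary ((r%:C)%C *: a).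
Proof.
move=> xa a0; have [c cE] : exists c, star a ** a = c *: cone.
  by apply: eig0; rewrite -(addNr x); exact: eigM (eig_star xa) xa.
have [c' c'E] : exists c, a ** star a = c *: cone.
  by apply: eig0; rewrite -(addrN x); exact: eigM xa (eig_star xa).
exact: unitary_of_scalar_squares cE c'E.
Qed.

(** [star u ** a] has weight 0, hence is a scalar by ergodicity. *)
Let eig_line x a u : eig x a -> eig x u -> unitary u -> exists c, a = c *: u.
Proof.
move=> xa xu [_ u2]; have [c cE] : exists c, star u ** a = c *: cone.
  by apply: eig0; rewrite -(addNr x); exact: eigM (eig_star xu) xa.
by exists c; rewrite -[a]cmul1x -u2 -cmulA cE -cscaleAr cmulx1.
Qed.

Let eig_line_unitary x u v : eig x u -> eig x v -> unitary u -> unitary v ->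
  exists t : R, u = e2pi t *: v.
Proof.
move=> xu xv uu vv; have [c cE] := eig_line xu xv vv.
have [|t tE] := @e2pi_surj R c; last by exists t; rewrite -tE.
by have := nm_unitary uu; rewrite cE nmZ (nm_unitary vv) mulr1.
Qed.

Let eig_mono (u : 'I_n -> A) (X : 'M[R]_n) (k : 'cV[int]_n) :
  (forall j, eig (col j X) (u j)) -> eig (X *m Rof R k) (mono u k).
Proof.
move=> h s; rewrite mono_morph //.
have -> : beta s \o u = fun i => e2pi ((\col_i dotv (col i X) s) i 0) *: u i.
  by apply/funext => i /=; rewrite h mxE.
rewrite mono_scale; congr (e2pi _ *: _); rewrite /int_dot /dotv.
under eq_bigr do rewrite mxE mulr_sumr.
rewrite exchange_big; apply: eq_bigr => i _; rewrite mxE mulr_suml.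
by apply: eq_bigr => j _; rewrite !mxE; ring.
Qed.

Let w_eig k : eig (col k 1%:M) (w k).
Proof.
move=> s; rewrite beta_w; congr (e2pi _ *: _).
rewrite /dotv (bigD1 k) //= big1 ?addr0 => [|i ik]; first by rewrite !mxE eqxx mul1r.
by rewrite !mxE (negPf ik) mul0r.
Qed.

Let alpha_eig g x a : eig x a -> eig x (alpha g a).
Proof. by move=> xa s; rewrite -comm xa (sm_Z (alphaM g)). Qed.

(** A [G]-fixed [u] comes from the quantum torus, where [beta] is the gauge action and the standard
    basis vectors act trivially. So [e2pi (x k 0) = 1] for every [k]. *)
Let fixed_eig x u : eig x u -> unitary u -> (forall g : G, alpha g u = u) ->
  exists z, x = Rof R z.
Proof.
move=> xu uu fu; have [_ _ rg] := iotaP.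
have : fixed_points alpha u by [].
rewrite -rg => -[t _ tu]; apply: int_vec => k; apply: e2pi_eq1.
apply: (scale_unitary_inj uu); rewrite scale1r.
have <- : dotv x (delta_mx k 0) = x k 0.
  rewrite /dotv (bigD1 k) //= big1 ?addr0 => [|i ik]; first by rewrite !mxE !eqxx mulr1.
  by rewrite !mxE (negPf ik) mulr0.
have [_ bl] := beta_lift; rewrite -xu -tu bl; congr iota.
suff <- : id = gauge T (delta_mx k 0) by [].
apply: gauge_unique; first exact: sm_id.
move=> i; rewrite mxE eqxx andbT e2pi_int ?scale1r //; case: eqP.
Qed.

Let alpha_pow (g : G) u (t : R) m : alpha g u = e2pi t *: u ->
  alpha (g ^+ m)%g u = e2pi (m%:R * t) *: u.
Proof.
move=> gu; elim: m => [|m IH].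
  by rewrite mul0r e2pi0 scale1r; exact: (dyn_act1 alpha).
rewrite expgS (dyn_actM alpha) IH (sm_Z (alphaM g)) gu scalerA -e2piD.
by rewrite -natr1 mulrDl mul1r.
Qed.

Let alpha_period (g : G) u (t : R) : unitary u -> alpha g u = e2pi t *: u ->
  #|G|%:R * t \is a Num.int.
Proof.
move=> uu /(alpha_pow #|G|); rewrite -cardsT expg_cardG ?inE // => h.
apply: e2pi_eq1; apply: (scale_unitary_inj uu); rewrite -h scale1r.
exact: (dyn_act1 alpha).
Qed.

Let S (x : 'cV[R]_n) := exists2 u, unitary u & eig x u.

(** The monomials in [w] realise all integer weights. Each [g] multiplies [u] by a root of unity of
    order dividing [#|G|], so the power [#|G|] of [u] is fixed by [G] and has integral weight. *)
Let lattice_S : exists M : 'M[int]_n, Rof R M \in unitmx /\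
  forall x, S x <-> exists k : 'cV[int]_n, x = invmx (Rof R M) *m Rof R k.
Proof.
apply: (@lattice_basis R n S #|G|) => [x y [u uu xu] [v vv yv]|z||x [u uu xu]].
- exists (u ** star v); first by apply: unitaryM => //; exact: unitary_star.
  exact: eigM xu (eig_star yv).
- exists (mono w z); first exact: (mono_unitary z wR).
  by rewrite -[Rof R z]mul1mx; apply: eig_mono; exact: w_eig.
- by rewrite -cardsT cardG_gt0.
have xuN m : eig (m%:R *: x) (cpow u m).
  elim: m => [|m IH] /=; last by rewrite -nat1r scalerDl scale1r; exact: eigM.
  move=> s; rewrite (sm_1 (betaM s)) scale0r /dotv big1 ?e2pi0 ?scale1r // => i _.
  by rewrite mxE mul0r.
apply: (fixed_eig (xuN #|G|)); first exact: unitary_cpow.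
move=> g; have [t tE] := eig_line_unitary (alpha_eig g xu) xu (sm_unitary (alphaM g) uu) uu.
have E p : alpha g (cpow u p) = e2pi (p%:R * t) *: cpow u p.
  elim: p => [|p IH] /=; first by rewrite (sm_1 (alphaM g)) mul0r e2pi0 scale1r.
  by rewrite (sm_M (alphaM g)) IH tE -cscaleAl -cscaleAr scalerA -e2piD -nat1r mulrDl mul1r.
by rewrite E e2pi_int ?scale1r //; exact: (alpha_period uu tE).
Qed.

Section Model.
Variable N : 'M[int]_n.
Hypothesis N_unit : Rof R N \in unitmx.
Hypothesis SN : forall x, S x <-> exists k : 'cV[int]_n, x = invmx (Rof R N) *m Rof R k.
Let V := invmx (Rof R N).
Variable u : 'I_n -> A.
Hypotheses (uU : forall j, unitary (u j)) (u_eig : forall j, eig (col j V) (u j)).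

Let monoU k : unitary (mono u k).
Proof. by apply: unitary_prod => i; exact: upow_unitary. Qed.

Let mono_eig k : eig (V *m Rof R k) (mono u k).
Proof. exact: eig_mono. Qed.

Let VN (m : nat) (X : 'M[R]_(n, m)) : V *m (Rof R N *m X) = X.
Proof. by rewrite mulmxA mulVmx // mul1mx. Qed.

(** The weight of [w k] is the basis vector [e_k], which is [V] times the [k]-th column of [N];
    spectral subspaces being lines, [w k] is that monomial up to a phase. *)
Let w_mono k : exists t : R, w k = e2pi t *: mono u (col k N).
Proof.
have [wU _] := wR; apply: (eig_line_unitary (w_eig k)) => //.
suff -> : col k 1%:M = V *m Rof R (col k N) :> 'cV[R]_n by exact: mono_eig.
by rewrite -[LHS]VN [col k 1%:M]colE mul1mx -colE; congr (_ *m _); apply/colP => i; rewrite !mxE.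
Qed.

Let beta_u (s : 'cV[R]_n) i : beta s (u i) = e2pi ((V^T *m s) i 0) *: u i.
Proof.
rewrite u_eig; congr (e2pi _ *: _); rewrite /dotv mxE.
by apply: eq_bigr => j _; rewrite !mxE.
Qed.

(** The lift itself provides the gauge action on [u], after a linear change of the parameter. *)
Let gauge_u (s : 'cV[R]_n) : exists2 g : A -> A, star_morphism g &
  forall i, g (u i) = e2pi (s i 0) *: u i.
Proof.
exists (beta ((Rof R N)^T *m s)) => // i.
by rewrite beta_u mulmxA -trmx_mul mulmxV // trmx1 mul1mx.
Qed.

Variable theta' : 'M[R]_n.
Hypothesis uR : qtorus_rel theta' u.

Let dense_u x : qclosure u u x x.
Proof.
have [q q0 qP] := period.
apply: (@eigenvec_dense _ _ _ beta q%:R (fun x => qclosure u u x x)) => [|i a||chi a aE].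
- by rewrite ltr0n.
- exact: qP.
- split=> [|c y z|y h].
  + by apply: (@qclosure_qpol _ _ _ _ _ _ 0); exact: qpol0.
  + exact: (qclosure_lin uR uR).
  + apply: qclosure_closed => e e0; have [z Sz yz] := h e e0.
    by exists z, z.
have q00 : qclosure u u 0 0 by apply: (@qclosure_qpol _ _ _ _ _ _ 0); exact: qpol0.
have [->//|a0] := eqVneq a 0.
have [r r0 ru] := eig_unitary aE a0.
have /SN[k kE] : S chi by exists ((r%:C)%C *: a) => //; exact: eigZ.
have [c ->] : exists c, a = c *: mono u k.
  by apply: (eig_line aE) => //; rewrite kE; exact: mono_eig.
rewrite -[_ *: _]addr0; apply: (qclosure_lin uR uR) => //.
exact: qclosure_mono.
Qed.

Let T' : quantum_torus theta' := qtorus_of_dense uR gauge_u dense_u.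
(** The columns of [V = N^-1] are weights, whereas gauge parameters are paired with weights:
    [beta s] acts on [u] by [V^T s = M^-1 s]. Hence the transpose. *)
Let M := N^T.

Let RofT m p (X : 'M[int]_(m, p)) : Rof R X^T = (Rof R X)^T.
Proof. by rewrite /Rof map_trmx. Qed.

Let M_unit : Rof R M \in unitmx.
Proof. by rewrite RofT unitmx_tr. Qed.

(** The commutation phase of [w k] and [w l] is computed from [theta] and, through [w_mono], from
    [theta']; equal phases have arguments that differ by an integer. *)
Let theta_rel : exists K : 'M[int]_n,
  Rof R M *m theta' *m (Rof R M)^T = theta + Rof R K.
Proof.
pose X := Rof R M *m theta' *m (Rof R M)^T - theta.
have Xint k l : X k l \is a Num.int.
  have [a aE] := w_mono k; have [b bE] := w_mono l.
  have [_ wC] := wR; have := wC k l.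
  rewrite aE bE -!cscaleAl -!cscaleAr !scalerA (mono_comm (col k N) (col l N) uR).
  rewrite scalerA [e2pi b * e2pi a]mulrC.
  rewrite ![_ * (e2pi a * e2pi b)]mulrC -!mulrA => h.
  have := scale_unitary_inj (unitaryM (monoU (col l N)) (monoU (col k N))) h.
  move=> /(mulfI (e2pi_neq0 a)) /(mulfI (e2pi_neq0 b)) /e2pi_eq.
  congr (_ \is a Num.int); rewrite !mxE; congr (_ - _).
  under [RHS]eq_bigr do rewrite !mxE mulr_suml.
  rewrite exchange_big; apply: eq_bigr => i _; apply: eq_bigr => j _.
  by rewrite !mxE.
exists (\matrix_(k, l) Num.floor (X k l)).
apply/matrixP => k l; have := floorK (Xint k l); rewrite [RHS]mxE !mxE => ->.
by rewrite addrC subrK.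
Qed.

Let angles (g : G) : exists t : 'cV[R]_n, forall j, alpha g (u j) = e2pi (t j 0) *: u j.
Proof.
have /choice[t tP] : forall j, exists t : R, alpha g (u j) = e2pi t *: u j.
  move=> j; apply: (eig_line_unitary (alpha_eig g (u_eig j))) => //.
  exact: (sm_unitary (alphaM g)).
by exists (\col_j t j) => j; rewrite mxE.
Qed.

Let alpha_mono (g : G) (t : 'cV[R]_n) k : (forall j, alpha g (u j) = e2pi (t j 0) *: u j) ->
  alpha g (mono u k) = e2pi (int_dot k t) *: mono u k.
Proof. by move=> gt; apply: gauge_mono. Qed.

Let alpha_w (g : G) k : alpha g (w k) = w k.
Proof.
have [_ _ rg] := iotaP; have : range iota (w k) by exists (qtorus_gen T k).
by rewrite rg; apply.
Qed.

(** [G] fixes [w k], a monomial whose exponents form the [k]-th row of [M]; so [M t] is integral. *)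
Let angles_lattice (g : G) (t : 'cV[R]_n) : (forall j, alpha g (u j) = e2pi (t j 0) *: u j) ->
  exists z, t = invmx (Rof R M) *m Rof R z.
Proof.
move=> gt; have [|z zE] := int_vec (s := Rof R M *m t).
  move=> k; apply: e2pi_eq1; have [a aE] := w_mono k.
  have := alpha_w g k; rewrite aE (sm_Z (alphaM g)) (alpha_mono _ gt) scalerA => h.
  have := scale_unitary_inj (monoU (col k N)) h; rewrite -[RHS]mulr1 => /(mulfI (e2pi_neq0 a)).
  move=> <-; congr e2pi; rewrite /int_dot mxE; apply: eq_bigr => i _.
  by rewrite !mxE.
by exists z; rewrite -zE mulmxA mulVmx // mul1mx.
Qed.

Lemma connected_model : exists (T'' : quantum_torus theta'),
  [/\ exists K : 'M[int]_n, Rof R M *m theta' *m (Rof R M)^T = theta + Rof R K &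
     equivalent alpha (gauge_lattice T'' M)].
Proof.
exists T'; split; first exact: theta_rel.
have /choice[t tP] := angles.
have tL (g : G) : lattice_pred M (\pi_(torus R n) (t g))%qT.
  by apply/asboolP; have [z zE] := angles_lattice (tP g); exists z; rewrite zE.
pose phi (g : G) : lattice_quotient R M := exist _ (\pi_(torus R n) (t g))%qT (tL g).
have piE (x y : 'cV[R]_n) : (exists z, x - y = Rof R z) ->
    (\pi_(torus R n) x = \pi_(torus R n) y)%qT.
  move=> [z zE]; apply/eqP; rewrite -Quotient.idealrBE zE; apply/mxOverP => i j.
  by rewrite mxE intr_int.
have alphaE (g : G) : alpha g = gauge_lattice T' M (phi g).
  rewrite /gauge_lattice /= gauge_torus_pi.
  apply: (@gauge_unique _ _ _ T' (t g) (alpha g : A -> A) (alphaM g)) => k.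
  exact: tP.
have tX (g h : G) : exists z, t (g * h)%g - (t g + t h) = Rof R z.
  apply: int_vec => k; rewrite !mxE; apply: e2pi_eq.
  apply: (scale_unitary_inj (uU k)); rewrite -tP (dyn_actM alpha) tP (sm_Z (alphaM g)).
  by rewrite tP scalerA -e2piD addrC.
have phi_inj : injective phi.
  move=> g h gh; apply: (free_faithful alpha_free) => a.
  by rewrite !alphaE gh.
(* Otherwise the lattice of the angles [t g] would be proper in [M^-1 Z^n], and a
   monomial outside [Z^n] in its dual lattice would be fixed by [G]. *)
have phi_surj x : exists g, phi g = x.
  case: x => x xL; have /asboolP[k kE] := xL.
  pose L y := exists g z, y - t g = Rof R z.
  have [W [Wu LW]] : exists W : 'M[int]_n, Rof R W \in unitmx /\
      forall y, L y <-> exists k : 'cV[int]_n, y = invmx (Rof R W) *m Rof R k.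
    have t1 : exists z, t 1%g = Rof R z.
      have [z] := tX 1%g 1%g; rewrite mulg1 opprD addrA subrr sub0r => zE.
      by exists (- z); rewrite -[LHS]opprK zE /Rof map_mxN.
    have tV (g : G) : exists z, t g^-1%g + t g = Rof R z.
      have [z zE] := tX g^-1%g g; have [z1 z1E] := t1; exists (z1 - z).
      by rewrite /Rof map_mxB -/(Rof R z) -/(Rof R z1) -zE -z1E mulVg opprB [RHS]addrC subrK.
    apply: (@lattice_basis R n L #|G|) => [y y' [g [z gz]] [h [z' hz]]|z||y [g [z gz]]].
    - exists (g * h^-1)%g; have [a aE] := tX g h^-1%g; have [b bE] := tV h.
      exists (z - z' - a - b); rewrite /Rof !map_mxB -!/(Rof R _) -gz -hz -aE -bE.
      by apply/colP => i; rewrite !mxE; ring.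
    - by have [a aE] := t1; exists 1%g, (z - a); rewrite aE /Rof map_mxB.
    - by rewrite -cardsT cardG_gt0.
    apply: int_vec => i; rewrite mxE; have -> : y i 0 = (z i 0)%:~R + t g i 0.
      by have /colP/(_ i) := gz; rewrite !mxE => <-; rewrite subrK.
    rewrite mulrDr rpredD //; first by rewrite rpredM ?intr_int ?intr_nat.
    exact: (alpha_period (uU i) (tP g i)).
  (* The rows of [W] pair integrally with every [t g], so the corresponding monomials are fixed by
     [G] and have integral weights. This makes [W] an integer multiple of [M]. *)
  have /choice[Z ZP] : forall i : 'I_n, exists z, V *m Rof R (row i W)^T = Rof R z.
    move=> i; apply: (fixed_eig (mono_eig (row i W)^T)) => // g.
    rewrite (alpha_mono _ (tP g)) e2pi_int ?scale1r //.
    have /LW[l lE] : L (t g) by exists g, 0; rewrite subrr /Rof map_mx0.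
    have -> : int_dot (row i W)^T (t g) = (Rof R W *m t g) i 0.
      by rewrite /int_dot mxE; apply: eq_bigr => j _; rewrite !mxE.
    by rewrite lE mulmxA mulmxV // mul1mx mxE intr_int.
  pose Zm : 'M[int]_n := \matrix_(i, j) Z i j 0.
  have WZ : Rof R W = Rof R Zm *m Rof R M.
    apply/matrixP => i j; have := ZP i => /(congr1 (mulmx (Rof R N))).
    rewrite mulmxA mulmxV // mul1mx => /colP/(_ j); rewrite !mxE => ->.
    by apply: eq_bigr => l _; rewrite !mxE mulrC.
  have /LW[g [z gz]] : exists l, invmx (Rof R M) *m Rof R k = invmx (Rof R W) *m Rof R l.
    exists (Zm *m k); rewrite RofM -[Rof R Zm](mulmxK M_unit) -WZ -(mulmxA (Rof R W)) mulKmx //.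
  exists g; apply/val_inj => /=; rewrite kE; apply: piE; exists (- z).
  by rewrite -opprB gz /Rof map_mxN.
(* The algebra underlying [T'] is [A] itself. *)
exists id, phi; split=> [||g h|g a].
- by split; [exact: sm_id|exists id].
- by have /choice[psi psiK] := phi_surj; exists psi => // g; apply: phi_inj.
- apply/val_inj => /=; rewrite [RHS](_ : _ = (\pi_(torus R n) (t g + t h))%qT).
    exact/piE/tX.
  by rewrite raddfD.
by rewrite alphaE.
Qed.

End Model.

Lemma connected_gauge_model : exists (M : 'M[int]_n) (theta' : 'M[R]_n)
    (T' : quantum_torus theta'),
  [/\ Rof R M \in unitmx, theta'^T = - theta',
     exists K : 'M[int]_n, Rof R M *m theta' *m (Rof R M)^T = theta + Rof R K &
     equivalent alpha (gauge_lattice T' M)].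
Proof.
have [N [Nu SN]] := lattice_S.
have /choice[u uP] : forall j : 'I_n, exists u, unitary u /\ eig (col j (invmx (Rof R N))) u.
  move=> j; have /SN[u uu xu] : exists k : 'cV[int]_n,
      col j (invmx (Rof R N)) = invmx (Rof R N) *m Rof R k.
    exists (delta_mx j 0); rewrite colE; congr (_ *m _); apply/colP => i.
    by rewrite !mxE; case: (_ && _).
  by exists u.
have uU j : unitary (u j) by have [] := uP j.
have u_eig j : eig (col j (invmx (Rof R N))) (u j) by have [] := uP j.
have /choice[c cP] : forall kl : 'I_n * 'I_n, exists t : R,
    u kl.1 ** u kl.2 = e2pi t *: (u kl.2 ** u kl.1).
  move=> [k l]; apply: (eig_line_unitary (eigM (u_eig k) (u_eig l))).
  - by rewrite addrC; exact: eigM.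
  - exact: unitaryM.
  - exact: unitaryM.
(* The phases [c] are determined modulo integers only, so an arbitrary choice need not be skew; its
   part above the diagonal is reflected. *)
pose theta' : 'M[R]_n := \matrix_(k, l)
  (if (k < l)%N then c (k, l) else if (l < k)%N then - c (l, k) else 0).
have skew : theta'^T = - theta'.
  by apply/matrixP => k l; rewrite !mxE; case: ltngtP; rewrite ?opprK ?oppr0.
have uR : qtorus_rel theta' u.
  split=> // k l; rewrite mxE; case: ltngtP => [_|_|/val_inj ->].
  - exact: (cP (k, l)).
  - by apply: (qcomm_sym (c := c (l, k))); exact: (cP (l, k)).
  - by rewrite e2pi0 scale1r.
have [T' [tK eqv]] := connected_model Nu SN uU u_eig uR.
by exists N^T, theta', T'; split=> //; rewrite /Rof -map_trmx unitmx_tr.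
Qed.

End Connected.

(** * The gauge action and the converse *)

Lemma complex_cauchy (R : realType) (c : nat -> R[i]) :
  (forall e : R, 0 < e -> exists N, forall m k, (N <= m)%N -> (N <= k)%N ->
     nm (c m - c k) < e) ->
  exists l, forall e : R, 0 < e -> exists N, forall m, (N <= m)%N -> nm (c m - l) < e.
Proof.
move=> h.
have real_case (f : R[i] -> R) : (forall z z', `|f z - f z'| <= nm (z - z')) ->
    exists l, forall e : R, 0 < e -> exists N, forall m, (N <= m)%N -> `|f (c m) - l| < e.
  move=> fL; have uC : cvg ((f \o c) @ \oo).
    apply: R_complete; apply/cauchy_exP => e e0.
    have [N hN] := h e e0; exists (f (c N)); exists N => // m /= Nm.
    by rewrite /ball /=; apply: le_lt_trans (fL _ _) _; exact: hN.
  exists (lim ((f \o c) @ \oo)) => e e0.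
  have /cvgrPdist_lt /(_ e e0)[N _ hN] := uC.
  by exists N => m Nm; rewrite distrC; exact: hN.
have nmRI (z : R[i]) : nm z = Num.sqrt (complex.Re z ^+ 2 + complex.Im z ^+ 2).
  by rewrite /nm normc_def.
have [|a aP] := real_case (@complex.Re R).
  move=> z z'; have -> : complex.Re z - complex.Re z' = complex.Re (z - z').
    by case: z z' => ? ? [].
  by rewrite nmRI -sqrtr_sqr ler_wsqrtr // lerDl sqr_ge0.
have [|b bP] := real_case (@complex.Im R).
  move=> z z'; have -> : complex.Im z - complex.Im z' = complex.Im (z - z').
    by case: z z' => ? ? [].
  by rewrite nmRI -sqrtr_sqr ler_wsqrtr // lerDr sqr_ge0.
exists (a +i* b)%C => e e0.
have [N hN] := aP (e / 2) ltac:(by rewrite divr_gt0).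
have [N' hN'] := bP (e / 2) ltac:(by rewrite divr_gt0).
exists (maxn N N') => m; rewrite geq_max => /andP[/hN h1 /hN' h2].
have -> : c m - (a +i* b)%C =
    ((complex.Re (c m) - a)%:C)%C + 'i%C * ((complex.Im (c m) - b)%:C)%C.
  case: (c m) => p q; apply/eqP; rewrite eq_complex /=.
  by rewrite !(mul0r, mulr0, mul1r, subr0, addr0, add0r, oppr0) !eqxx.
apply: le_lt_trans (nmD _ _) _; rewrite nmcM !nm_real.
rewrite nm_i; lra.
Qed.

Section TorusModel.
Variables (R : realType) (n : nat) (theta : 'M[R]_n) (T : quantum_torus theta).
Notation u := (qtorus_gen T).
Let uR : qtorus_rel theta u := qtorus_genP T.

Lemma qtorus_ind (D : T -> Prop) : submodule_closed D ->
  (forall k, D (mono u k)) -> forall x, D x.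
Proof.
move=> [D0 Dlin Dcl] Dm x; apply: Dcl => e e0.
have [d [p [r [[c [-> _]] xp _]]]] := qtorus_dense x e0.
exists (\sum_f c f *: mono u (box_key f)) => //.
by elim/big_ind: _ => [//|y z Dy Dz|f _]; [rewrite -[y]scale1r|rewrite -[_ *: _]addr0];
  exact: Dlin.
Qed.

Lemma gauge_morphism s : star_morphism (gauge T s).
Proof. by have [] := gaugeP T s. Qed.

Lemma gauge_add s t x : gauge T (s + t) x = gauge T s (gauge T t x).
Proof.
suff -> : gauge T (s + t) = gauge T s \o gauge T t by [].
apply/esym/gauge_unique; first by apply: sm_comp; exact: gauge_morphism.
move=> k /=; have [_ ->] := gaugeP T t; rewrite (sm_Z (gauge_morphism s)).
by have [_ ->] := gaugeP T s; rewrite scalerA mxE -e2piD addrC.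
Qed.

Lemma gauge_int z x : gauge T (Rof R z) x = x.
Proof.
suff <- : id = gauge T (Rof R z) by [].
apply: gauge_unique; first exact: sm_id.
by move=> k; rewrite mxE e2pi_int ?scale1r // intr_int.
Qed.

Lemma gauge0 x : gauge T 0 x = x.
Proof. by have := gauge_int 0 x; rewrite /Rof map_mx0. Qed.

Lemma gauge_mono_act s k : gauge T s (mono u k) = e2pi (int_dot k s) *: mono u k.
Proof. by have [gM gu] := gaugeP T s; exact: gauge_mono. Qed.

(** The grid mean fixes [x] and sends a polynomial close to [x] to its constant term. So scalars
    approximate [x], and they form a Cauchy sequence. *)
Lemma gauge_ergodic x : (forall s, gauge T s x = x) -> exists c, x = c *: cone.
Proof.
move=> fx.
have app (e : R) : 0 < e -> exists c, nm (x - c *: cone) < e.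
  move=> e0; have [d [p [r [[c [-> _]] xp _]]]] := qtorus_dense x e0.
  have [f0 f0E] : exists f : {ffun 'I_n -> 'I_(d.*2.+1)}, 0 = box_key f.
    by apply: in_box_key => i; rewrite mxE.
  have := grid_mean c f0 (fun t => gauge_morphism (grid R t))
    (fun t => proj2 (gaugeP T (grid R t))).
  rewrite -f0E mono0 => E; exists (c f0).
  set P := \sum_f _ in xp E; pose N : R := (d.*2.+1 ^ n)%:R.
  have N0 : 0 < N by rewrite ltr0n expn_gt0.
  have NE : ((d.*2.+1 ^ n)%:R : R[i]) = (N%:C)%C by rewrite rmorph_nat.
  have : (N%:C)%C *: (x - c f0 *: cone) =
      \sum_(t : {ffun 'I_n -> 'I_(d.*2.+1)}) gauge T (grid R t) (x - P).
    rewrite scalerBr -NE -E.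
    have -> : (d.*2.+1 ^ n)%:R *: x = \sum_(t : {ffun 'I_n -> 'I_(d.*2.+1)}) x.
      by rewrite sumr_const card_ffun !card_ord scaler_nat.
    rewrite -sumrB; apply: eq_bigr => t _.
    rewrite (sm_B (gauge_morphism _)) fx /int_dot big1 ?oppr0 ?e2pi0 ?scale1r //.
    by move=> i _; rewrite mxE mul0r.
  move=> /(congr1 (@nm _ _)); rewrite nmZ nm_real gtr0_norm // => h.
  rewrite -(ltr_pM2l N0) h; apply: le_lt_trans (nm_sum _ _ _) _.
  apply: (@le_lt_trans _ _ (\sum_(t : {ffun 'I_n -> 'I_(d.*2.+1)}) nm (x - P))).
    by apply: ler_sum => t _; exact/sm_contractive/gauge_morphism.
  by rewrite sumr_const card_ffun !card_ord -[X in X < _]mulr_natl ltr_pM2l.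
have /choice[c cP] : forall m : nat, exists c, nm (x - c *: cone) < m.+1%:R^-1.
  by move=> m; apply: app; rewrite invr_gt0.
have arch := @invSn_eventually_lt R.
have [e e0|l lP] := @complex_cauchy R c.
  have [N NP] := arch (e / 2) ltac:(by rewrite divr_gt0); exists N => m k Nm Nk.
  have := nm_dist_trans x (c m *: (cone : T)) (c k *: cone).
  rewrite -scalerBl nmZ nm_cone mulr1 (nm_distC (c m *: cone) x).
  move: (lt_trans (cP m) (NP m Nm)) (lt_trans (cP k) (NP k Nk)); lra.
exists l; apply: (@nm_eq_lim _ _ _ _ 2) => e e0.
have [N NP] := arch e e0; have [N' N'P] := lP e e0.
have := nm_dist_trans (c (maxn N N') *: (cone : T)) x (l *: cone).
rewrite -scalerBl nmZ nm_cone mulr1.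
move: (lt_trans (cP _) (NP _ (leq_maxl N N'))) (N'P _ (leq_maxr N N')); lra.
Qed.

Lemma dotv_continuous (b s0 : 'cV[R]_n) (e : R) : 0 < e ->
  nbhs (s0 : Rn R n) [set s : 'cV[R]_n | `|dotv b (s - s0)| < e].
Proof.
move=> e0; pose K := \sum_i `|b i 0| + 1.
have K0 : 0 < K by rewrite ltr_wpDl // sumr_ge0.
exists (fun i j => [set t : R | `|t - (s0 : 'cV[R]_n) i j| < e / K]) => [i j|s hs].
  apply/nbhs_normP; exists (e / K) => /=; first by rewrite divr_gt0.
  by move=> t; rewrite /ball_ /= distrC.
apply: (@le_lt_trans _ _ (\sum_i `|b i 0| * (e / K))).
  apply: le_trans (ler_norm_sum _ _ _) _; apply: ler_sum => i _.
  by rewrite normrM ler_wpM2l // ltW //; have := hs i 0; rewrite !mxE.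
rewrite -mulr_suml mulrA ltr_pdivrMr // mulrC ltr_pM2l // /K ltrDl //.
Qed.

(** Since the gauge maps are contractions, the vectors with continuous orbits form a closed
    subspace, and on monomials only a phase varies. *)
Lemma gauge_orbit_continuous (X : 'M[R]_n) x (s0 : 'cV[R]_n) (e : R) : 0 < e ->
  nbhs (s0 : Rn R n)
    [set s : 'cV[R]_n | nm (gauge T (X *m s) x - gauge T (X *m s0) x) < e].
Proof.
move: x e; apply: qtorus_ind; first split=> [e e0|c x y hx hy e e0|x h e e0].
- by apply: filterE => s /=; rewrite !(sm_0 (gauge_morphism _)) subrr nm0.
- have c0 : 0 < nm c + 1 by rewrite ltr_wpDl ?nm_ge0.
  have := hx (e / 2 / (nm c + 1)) ltac:(by rewrite !divr_gt0).
  have := hy (e / 2) ltac:(by rewrite divr_gt0).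
  apply: filterS2 => s /= h1 h2.
  rewrite !(sm_D (gauge_morphism _)) !(sm_Z (gauge_morphism _)) opprD addrACA -scalerBr.
  apply: le_lt_trans (nmD _ _) _; rewrite nmZ.
  have h3 := ler_wpM2l (nm_ge0 c) (ltW h2).
  by have := mul_half_div_succ_le (nm_ge0 c) e0; lra.
- have e3 : 0 < e / 3 by rewrite divr_gt0.
  have [y hy xy] := h _ e3; have := hy _ e3; apply: filterS => s /= h1.
  have h2 := nm_dist_trans (gauge T (X *m s) y) (gauge T (X *m s) x) (gauge T (X *m s0) x).
  have h3 := nm_dist_trans (gauge T (X *m s0) y) (gauge T (X *m s) y) (gauge T (X *m s0) x).
  have h4 := sm_contractive (gauge_morphism (X *m s)) (x - y).
  have h5 := sm_contractive (gauge_morphism (X *m s0)) (y - x).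
  rewrite !(sm_B (gauge_morphism _)) in h4 h5; rewrite (nm_distC y x) in h5; lra.
move=> k e e0; have [d d0 dP] := e2pi_continuous0 e0.
apply: filterS (dotv_continuous (X^T *m Rof R k) s0 d0) => s /= hs.
rewrite !gauge_mono_act -scalerBl nmZ (nm_unitary (mono_unitary _ uR)) mulr1.
have dE (t : 'cV[R]_n) : int_dot k (X *m t) = dotv (X^T *m Rof R k) t.
  rewrite /int_dot /dotv; under eq_bigr do rewrite mxE mulr_sumr.
  rewrite exchange_big; apply: eq_bigr => i _; rewrite mxE mulr_suml.
  by apply: eq_bigr => j _; rewrite !mxE; ring.
have -> : e2pi (int_dot k (X *m s)) - e2pi (int_dot k (X *m s0)) =
    e2pi (int_dot k (X *m s0)) * (e2pi (dotv (X^T *m Rof R k) (s - s0)) - 1).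
  rewrite mulrBr mulr1 -e2piD !dE; congr (e2pi _ - _).
  rewrite /dotv -big_split /=; apply: eq_bigr => i _; rewrite [(s - s0) i 0]mxE [(- s0) i 0]mxE.
  by ring.
by rewrite nmcM nm_e2pi mul1r; exact: dP.
Qed.

Lemma gauge_commute s t x : gauge T s (gauge T t x) = gauge T t (gauge T s x).
Proof. by rewrite -!gauge_add addrC. Qed.

End TorusModel.

(** * Gauge models are connected coverings *)

Section Reverse.
Variables (R : realType) (n : nat) (theta : 'M[R]_n) (T : quantum_torus theta).
Variables (A : cstarAlgType R) (G : finGroupType).
Variable alpha : dynsys A (discrete_topology G).
Variables (M : 'M[int]_n) (theta' : 'M[R]_n) (T' : quantum_torus theta') (K : 'M[int]_n).
Hypothesis M_unit : Rof R M \in unitmx.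
Hypothesis theta_rel : Rof R M *m theta' *m (Rof R M)^T = theta + Rof R K.
Variables (Phi : A -> T') (Psi : T' -> A).
Hypotheses (PhiM : star_morphism Phi) (PhiK : cancel Phi Psi) (PsiK : cancel Psi Phi).
Let L := invmx (Rof R M).
(** Together with [gauge_alpha], the form in which the group isomorphism is used: the maps [alpha g]
    are, through [Phi], exactly the gauge maps at the points of [M^-1 Z^n]. *)
Hypothesis alpha_gauge : forall g : G, exists z, forall a,
  Phi (alpha g a) = gauge T' (L *m Rof R z) (Phi a).
Hypothesis gauge_alpha : forall z, exists g : G, forall a,
  Phi (alpha g a) = gauge T' (L *m Rof R z) (Phi a).

Notation u' := (qtorus_gen T').
Let PsiM : star_morphism Psi := sm_can PhiM PhiK PsiK.
Let alphaM (g : G) : star_morphism (alpha g). Proof. by have [] := dyn_automorphism alpha g. Qed.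
Let u'R : qtorus_rel theta' u' := qtorus_genP T'.

Let bact (s : Rn R n) (a : A) : A := Psi (gauge T' (L *m (s : 'cV[R]_n)) (Phi a)).

Let bactM s : star_morphism (bact s).
Proof.
apply: (sm_comp (f := fun a => gauge T' (L *m (s : 'cV[R]_n)) (Phi a)) (g := Psi)) => //.
by apply: (sm_comp (f := Phi)) => //; exact: gauge_morphism.
Qed.

Let bactD (s t : 'cV[R]_n) a : bact (s + t) a = bact s (bact t a).
Proof. by rewrite /bact mulmxDr gauge_add PsiK. Qed.

Let bact0 a : bact (0 : 'cV[R]_n) a = a.
Proof. by rewrite /bact mulmx0 gauge0 PhiK. Qed.

Let bact_auto s : star_isomorphism (bact s).
Proof.
split; first exact: bactM.
exists (bact (- (s : 'cV[R]_n))) => a; rewrite -bactD ?addNr ?addrN; exact: bact0.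
Qed.

Let bact_cont : continuous (fun p : Rn R n * A => bact p.1 p.2).
Proof.
move=> [s0 a0]; apply/nm_cvgP => e e0; have e2 : 0 < e / 2 by rewrite divr_gt0.
exists ([set s : 'cV[R]_n |
    nm (gauge T' (L *m s) (Phi a0) - gauge T' (L *m s0) (Phi a0)) < e / 2],
  [set a | nm (a - a0) < e / 2]).
  split; first exact: gauge_orbit_continuous.
  by apply/nm_nbhsP; exists (e / 2).
move=> [s a] [/= hs ha]; rewrite /bact -(sm_B PsiM).
apply: le_lt_trans (sm_contractive PsiM _) _.
apply: le_lt_trans (nm_dist_trans (gauge T' (L *m (s : 'cV[R]_n)) (Phi a0)) _ _) _.
have := sm_contractive (gauge_morphism T' (L *m (s : 'cV[R]_n))) (Phi (a - a0)).
have := sm_contractive PhiM (a - a0).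
rewrite (sm_B PhiM) (sm_B (gauge_morphism _ _)); lra.
Qed.

Definition conj_gauge : dynsys A (Rn R n) :=
  @DynSys _ _ (Rn R n) bact bact_auto bact0 bactD bact_cont.

Let row_col (k : 'I_n) : 'cV[int]_n := (row k M)^T.
Let v (k : 'I_n) : T' := mono u' (row_col k).

Let row_dot k (s : 'cV[R]_n) : int_dot (row_col k) s = (Rof R M *m s) k 0.
Proof. by rewrite /int_dot mxE; apply: eq_bigr => i _; rewrite !mxE. Qed.

Let vR : qtorus_rel theta v.
Proof.
split=> [k|k l]; first exact: (mono_unitary _ u'R).
rewrite /v (mono_comm (row_col k) (row_col l) u'R); congr (_ *: _).
rewrite -[RHS](@e2piDint _ _ (K k l)%:~R) ?intr_int //; congr e2pi.
have /matrixP/(_ k l) := theta_rel; rewrite [in RHS]mxE [X in _ = _ + X]mxE => <-.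
rewrite mxE; under [RHS]eq_bigr do rewrite !mxE mulr_suml.
rewrite exchange_big; apply: eq_bigr => i _; apply: eq_bigr => j _.
by rewrite !mxE.
Qed.

Let gauge_v s k : gauge T' (L *m s) (v k) = e2pi (s k 0) *: v k.
Proof. by rewrite gauge_mono_act row_dot mulmxA mulmxV // mul1mx. Qed.

Let emb : T -> T' := sval (cid (qtorus_universal T vR)).

Let embP : star_morphism emb /\ forall k, emb (qtorus_gen T k) = v k.
Proof. by rewrite /emb; case: cid => f []. Qed.

Let embM : star_morphism emb := proj1 embP.

Let emb_gauge s x : emb (gauge T s x) = gauge T' (L *m s) (emb x).
Proof.
suff : emb \o gauge T s = gauge T' (L *m s) \o emb by move=> /(congr1 (@^~ x)).
apply: qtorus_uniq => [||k] /=.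
- by apply: sm_comp embM; exact: gauge_morphism.
- by apply: sm_comp embM _; exact: gauge_morphism.
have [_ ->] := gaugeP T s; have [_ ev] := embP.
by rewrite (sm_Z embM) ev gauge_v.
Qed.

(** The generators [v] carry a gauge action, namely that of [T'] at [M^-1 s]. So polynomials can be
    compared in the direction opposite to contractivity of [emb], which is therefore isometric. *)
Let emb_expansive x : nm x <= nm (emb x).
Proof.
apply/ler_addgt0Pr => e e0.
have [d [p [r [[c [pE _]] xp _]]]] := qtorus_dense x (ltac:(by rewrite divr_gt0) : 0 < e / 2).
have gv (s : 'cV[R]_n) : exists2 g : T' -> T', star_morphism g &
    forall i, g (v i) = e2pi (s i 0) *: v i.
  by exists (gauge T' (L *m s)); [exact: gauge_morphism|exact: gauge_v].
have pv : qpol v (qtorus_gen T) d (emb p) p.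
  exists c; split=> //; rewrite pE (sm_sum embM); apply: eq_bigr => f _.
  rewrite (sm_Z embM) mono_morph //; congr (_ *: mono _ _); apply/funext => k.
  by have [_ ev] := embP; rewrite /= ev.
have := qpol_contractive vR (qtorus_genP T) gv pv.
have := sm_contractive embM (p - x); rewrite (sm_B embM) (nm_distC p x).
have := nmD (emb p - emb x) (emb x); rewrite subrK.
have := nmD (x - p) p; rewrite subrK; lra.
Qed.

Let avg (a : A) : A := ((#|G|%:R^-1 : R)%:C)%C *: \sum_(g : G) alpha g a.

Let G0 : (0 : R) < #|G|%:R.
Proof. by rewrite ltr0n -cardsT cardG_gt0. Qed.

Let avg_lin c a b : avg (c *: a + b) = c *: avg a + avg b.
Proof.
rewrite /avg scalerA mulrC -scalerA -scalerDr; congr (_ *: _).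
rewrite scaler_sumr -big_split; apply: eq_bigr => g _.
by rewrite (sm_D (alphaM g)) (sm_Z (alphaM g)).
Qed.

Let avg_contr a : nm (avg a) <= nm a.
Proof.
rewrite nmZ nm_invn mulrC ler_pdivrMr //; apply: le_trans (nm_sum _ _ _) _.
apply: (@le_trans _ _ (\sum_(g : G) nm a)).
  by apply: ler_sum => g _; exact/sm_contractive/alphaM.
by rewrite sumr_const mulr_natr.
Qed.

Let avg_fixed a : (forall g : G, alpha g a = a) -> avg a = a.
Proof.
move=> fa; rewrite /avg; under eq_bigr do rewrite fa.
rewrite sumr_const -[a *+ _]scaler_nat scalerA -(rmorph_nat (real_complex R)) -rmorphM /=.
by rewrite mulVf ?gt_eqF // scale1r.
Qed.

Let avg_act h a : avg (alpha h a) = avg a.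
Proof.
rewrite /avg; congr (_ *: _); rewrite [RHS](reindex_inj (mulIg h)).
by apply: eq_bigr => g _; rewrite (dyn_actM alpha).
Qed.

(* The average over [G] of a monomial vanishes unless [G] fixes the monomial, and
   then its exponent lies in [M^T Z^n]. *)
Let avg_emb k : exists x, emb x = Phi (avg (Psi (mono u' k))).
Proof.
have [fixed|/existsNP[h hk]] :=
  pselect (forall g : G, alpha g (Psi (mono u' k)) = Psi (mono u' k)).
  rewrite avg_fixed // PsiK.
  have kint (z : 'cV[int]_n) : int_dot k (L *m Rof R z) \is a Num.int.
    have [g gz] := gauge_alpha z; apply: e2pi_eq1.
    have := gz (Psi (mono u' k)); rewrite fixed !PsiK gauge_mono_act => /esym/eqP.
    rewrite -subr_eq0 -[X in _ - X]scale1r -scalerBl scaler_eq0.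
    by rewrite (negPf (unitary_neq0 (mono_unitary k u'R))) orbF subr_eq0 => /eqP.
  have /choice[b bE] : forall i : 'I_n, exists m : int,
      int_dot k (L *m Rof R (delta_mx i 0)) = m%:~R.
    by move=> i; have /intrP[m mE] := kint (delta_mx i 0); exists m.
  pose bv : 'cV[int]_n := \col_i b i.
  (* Integrality on all of [M^-1 Z^n] says that [k = M^T bv]. *)
  have kE : (Rof R k)^T = (Rof R bv)^T *m Rof R M.
    rewrite -[LHS](mulmxKV M_unit); congr (_ *m _); apply/rowP => i.
    rewrite !mxE -bE /int_dot; apply: eq_bigr => j _; rewrite !mxE; congr (_ * _).
    rewrite (bigD1 i) //= big1 ?addr0 => [|l li]; first by rewrite !mxE !eqxx mulr1.
    by rewrite !mxE (negPf li) mulr0.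
  have vb s : gauge T' s (mono v bv) = e2pi (int_dot k s) *: mono v bv.
    rewrite mono_morph; last exact: gauge_morphism.
    have -> : gauge T' s \o v = fun i => e2pi ((Rof R M *m s) i 0) *: v i.
      by apply/funext => i /=; rewrite gauge_mono_act row_dot.
    rewrite mono_scale; congr (e2pi _ *: _).
    transitivity (((Rof R bv)^T *m (Rof R M *m s)) 0 0).
      by rewrite /int_dot [RHS]mxE; apply: eq_bigr => i _; rewrite !mxE.
    by rewrite mulmxA -kE mxE; apply: eq_bigr => i _; rewrite !mxE.
  have vU := mono_unitary bv vR.
  (* Both monomials have the same weight, so the product is gauge invariant and hence a scalar. *)
  have [|c cE] := @gauge_ergodic _ _ _ T' (star (mono v bv) ** mono u' k).
    move=> s; have gM := gauge_morphism T' s.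
    rewrite (sm_M gM) (sm_star gM) vb gauge_mono_act starZ -cscaleAl -cscaleAr scalerA.
    by rewrite conjc_e2pi scale1r.
  exists (c *: mono (qtorus_gen T) bv); rewrite (sm_Z embM) mono_morph //.
  have -> : emb \o qtorus_gen T = v by apply/funext => i; have [_ ev] := embP; rewrite /= ev.
  by have [_ v2] := vU; rewrite -[RHS]cmul1x -v2 -cmulA cE -cscaleAr cmulx1.
exists 0; rewrite (sm_0 embM).
have [z zP] := alpha_gauge h.
have hE : alpha h (Psi (mono u' k)) = e2pi (int_dot k (L *m Rof R z)) *: Psi (mono u' k).
  by rewrite -[LHS]PhiK zP PsiK gauge_mono_act (sm_Z PsiM).
suff -> : avg (Psi (mono u' k)) = 0 by rewrite (sm_0 PhiM).
have avgZ c a : avg (c *: a) = c *: avg a.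
  have avg0 : avg 0 = 0 by rewrite /avg big1 ?scaler0 // => g _; rewrite (sm_0 (alphaM g)).
  by have := avg_lin c a 0; rewrite avg0 !addr0.
(* The average is unchanged by a factor, a phase different from 1, so it vanishes. *)
have := avg_act h (Psi (mono u' k)); rewrite hE avgZ => /eqP.
rewrite -subr_eq0 -[X in _ - X]scale1r -scalerBl scaler_eq0 => /orP[/eqP|/eqP //].
move=> /subr0_eq c1; exfalso; apply: hk; by rewrite hE c1 scale1r.
Qed.

(** Monomials suffice once the property passes to limits: [emb] does not shrink norms, so preimages
    of a convergent sequence are Cauchy. *)
Let avg_range y : exists x, emb x = Phi (avg (Psi y)).
Proof.
move: y; apply: qtorus_ind; last exact: avg_emb.
split=> [|c y z [x xE] [x' xE']|y h].
- exists 0; rewrite (sm_0 embM) (sm_0 PsiM) /avg big1 ?scaler0 ?(sm_0 PhiM) //.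
  by move=> g _; rewrite (sm_0 (alphaM g)).
- exists (c *: x + x'); rewrite (sm_D embM) (sm_Z embM) xE xE' (sm_D PsiM) (sm_Z PsiM).
  by rewrite avg_lin (sm_D PhiM) (sm_Z PhiM).
have avgB a b : avg (a - b) = avg a - avg b.
  by rewrite addrC -scaleN1r avg_lin scaleN1r addrC.
pose E z := Phi (avg (Psi z)).
have EB z z' : E z - E z' = E (z - z') by rewrite /E (sm_B PsiM) avgB (sm_B PhiM).
have Ec z : nm (E z) <= nm z.
  apply: le_trans (sm_contractive PhiM _) _; apply: le_trans (avg_contr _) _.
  exact: sm_contractive.
have /choice[f fP] : forall m : nat, exists x, nm (emb x - E y) < m.+1%:R^-1.
  move=> m; have [|z [x xE] yz] := h m.+1%:R^-1; first by rewrite invr_gt0.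
  exists x; rewrite xE EB; apply: le_lt_trans (Ec _) _; by rewrite nm_distC.
have arch := @invSn_eventually_lt R.
have [e e0|x xP] := @nm_cauchy _ T f.
  have [N NP] := arch (e / 2) ltac:(by rewrite divr_gt0); exists N => m k Nm Nk.
  apply: le_lt_trans (emb_expansive _) _; rewrite (sm_B embM).
  have := nm_dist_trans (E y) (emb (f m)) (emb (f k)); rewrite (nm_distC (E y)).
  move: (lt_trans (fP m) (NP m Nm)) (lt_trans (fP k) (NP k Nk)); lra.
exists x; apply: (@nm_eq_lim _ _ _ _ 2) => e e0.
have [N NP] := arch e e0; have [N' N'P] := xP e e0.
have := nm_dist_trans (emb (f (maxn N N'))) (emb x) (E y).
have := sm_contractive embM (f (maxn N N') - x).
rewrite (sm_B embM) (nm_distC (emb x) (emb (f _))) -/(E y).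
move: (lt_trans (fP _) (NP _ (leq_maxl N N'))) (N'P _ (leq_maxr N N')); lra.
Qed.

Lemma connected_of_gauge_model : connected_covering T alpha.
Proof.
exists (Psi \o emb); split.
  split; first exact: sm_comp.
    move=> x y /= /(can_inj PsiK) xy; apply/eqP; rewrite -subr_eq0; apply/eqP/nm_le0.
    by apply: le_trans (emb_expansive _) _; rewrite (sm_B embM) xy subrr nm0.
  apply/seteqP; split=> [_ [x _ <-] g|a fa] /=.
    have [z zP] := alpha_gauge g; rewrite -[LHS]PhiK zP PsiK -emb_gauge gauge_int //.
  have [x xE] := avg_range (Phi a); exists x => //=.
  by rewrite xE PhiK PhiK avg_fixed.
exists conj_gauge; split.
- split; last by move=> s x; rewrite /= /bact PsiK emb_gauge.
  (* [M^-1 s] is reduced to the unit cube modulo [Z^n], because integer parameters act trivially. *)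
  apply: (quotient_compact (M := Rof R M)) => s.
  pose x := L *m s; have xE : L *m s = x by [].
  clearbody x; pose z : 'cV[int]_n := \col_i Num.floor (x i 0).
  exists (x - Rof R z).
    move=> i; rewrite !mxE; have /andP[h1 h2] := floor_itv (x i 0).
    by rewrite subr_ge0 h1 /= lerBlDr addrC -intrD1 ltW.
  move=> a; rewrite /= /bact mulmxA mulVmx // mul1mx; congr Psi.
  by rewrite xE -[in LHS](subrK (Rof R z) x) gauge_add gauge_int.
- apply/seteqP; split=> [a fa|_ [c _ <-]] /=.
    have [|c cE] := @gauge_ergodic _ _ _ T' (Phi a).
      move=> s; have := fa (Rof R M *m s); rewrite /= /bact mulmxA mulVmx // mul1mx.
      by move=> /(congr1 Phi); rewrite PsiK.
    by exists c => //; rewrite -[RHS]PhiK cE (sm_Z PsiM) (sm_1 PsiM).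
  by move=> s /=; rewrite (sm_Z (bactM s)) (sm_1 (bactM s)).
move=> g s a; have [z zP] := alpha_gauge g; apply: (can_inj PhiK).
by rewrite zP /= /bact !PsiK gauge_commute zP.
Qed.

End Reverse.

Theorem theorem4p6 (R : realType) (n : nat) (theta : 'M[R]_n)
    (theta_skew : theta^T = - theta) (theta_qi : quite_irrational theta)
    (T : quantum_torus theta) (A : cstarAlgType R) (G : finGroupType)
    (alpha : dynsys A (discrete_topology G)) (alpha_cov : covering T alpha) :
  connected_covering T alpha <->
  exists (M : 'M[int]_n) (theta' : 'M[R]_n) (T' : quantum_torus theta'),
    [/\ map_mx intr M \in @unitmx R n,
        theta'^T = - theta',
        exists K : 'M[int]_n,
          map_mx intr M *m theta' *m (map_mx intr M)^T = theta + map_mx intr K &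
        equivalent alpha (gauge_lattice T' M)].
Proof.
split=> [[iota [iotaP [beta [lift erg comm]]]]|].
  by have [fr _] := alpha_cov; exact: (connected_gauge_model fr iotaP lift erg comm).
move=> [M [theta' [T' [Mu _ [K MK] [Phi [phi [[PhiM PhiB] phiB phiM eqv]]]]]]].
have [Psi PhiK PsiK] := PhiB.
apply: (connected_of_gauge_model T Mu MK PhiM PhiK PsiK) => [g|z].
  have /asboolP[z zE] := valP (phi g : lattice_quotient R M).
  by exists z => a; rewrite eqv /gauge_lattice zE gauge_torus_pi.
have zL : lattice_pred M (\pi_(torus R n) (invmx (Rof R M) *m Rof R z))%qT.
  by apply/asboolP; exists z.
have [psi _ psiK] := phiB.
pose l : lattice_quotient R M :=
  exist (fun x : torus R n => lattice_pred M x) _ zL.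
exists (psi l) => a; rewrite eqv psiK.
by rewrite /gauge_lattice gauge_torus_pi.
Qed.
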